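(* The categories $\mathsf{CNOT}$ and $\mathsf{ParIso}(\mathsf{CTor}_2)^{*}$ are equivalent.
   Context: $\mathsf{CNOT}$ is the strict symmetric monoidal category whose objects are the natural numbers $n$ (numbers of wires), with $n\otimes m=n+m$ on objects, generated by morphisms $\mathsf{cnot}:2\to 2$, $|1\rangle:0\to 1$, $\langle 1|:1\to 0$ (together with the symmetry $\sigma:2\to 2$), subject to the identities (CNT.1)–(CNT.9) below and no others. Composition is written diagrammatically: $fg$ means first $f$, then $g$. On $k$ wires numbered $1,\dots,k$ from top to bottom, $C_{i\to j}$ denotes the $\mathsf{cnot}$ gate with control wire $i$ and target wire $j$ (obtained from $\mathsf{cnot}$, whose control is its first wire, using symmetries and identities); $1_k$ is the identity. Identities: (CNT.1) $C_{1\to2}C_{2\to1}C_{1\to2}=\sigma$; (CNT.2) $C_{1\to2}C_{1\to2}=1_2$; (CNT.3) on 3 wires $C_{2\to1}C_{2\to3}=C_{2\to3}C_{2\to1}$; (CNT.4) $(|1\rangle\otimes1_1)C_{1\to2}=(|1\rangle\otimes1_1)C_{1\to2}(\langle1|\otimes1_1)(|1\rangle\otimes1_1)$ and $C_{1\to2}(\langle1|\otimes1_1)=(\langle1|\otimes1_1)(|1\rangle\otimes1_1)C_{1\to2}(\langle1|\otimes1_1)$; (CNT.5) on 3 wires $C_{1\to2}C_{3\to2}=C_{3\to2}C_{1\to2}$; (CNT.6) $|1\rangle\langle1|=1_0$; (CNT.7) $(|1\rangle\otimes|1\rangle\otimes1_1)C_{1\to2}C_{2\to3}(\langle1|\otimes1_2)=(|1\rangle\otimes|1\rangle\otimes1_1)C_{1\to2}(\langle1|\otimes1_2)$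 and $(|1\rangle\otimes1_2)C_{2\to3}C_{1\to2}(\langle1|\otimes\langle1|\otimes1_1)=(|1\rangle\otimes1_2)C_{1\to2}(\langle1|\otimes\langle1|\otimes1_1)$; (CNT.8) on 3 wires $C_{1\to2}C_{2\to3}C_{1\to2}=C_{2\to3}C_{1\to3}$; (CNT.9) $(|1\rangle\otimes|1\rangle\otimes1_1)C_{1\to2}(\langle1|\otimes\langle1|\otimes1_1)=(|1\rangle\otimes|1\rangle\otimes\langle1|)C_{1\to2}(\langle1|\otimes\langle1|\otimes|1\rangle)$. A torsor is a set $X$ with a ternary operation $(a,b,c)\mapsto a\times_b c$ satisfying $(a\times_b c)\times_d e=a\times_{d\times_c b}e=a\times_b(c\times_d e)$ and $a\times_b b=b\times_b a=a$; it is commutative if $a\times_b c=c\times_b a$ and of characteristic 2 if $a\times_b a=b$. Homomorphisms are functions preserving the ternary operation. $\mathsf{CTor}_2$ is the category of finitely generated commutative torsors of characteristic 2 (the empty torsor included) and their homomorphisms; it has pullbacks. For a category $\mathbb{X}$ with pullbacks, $\mathsf{Par}(\mathbb{X})$ has the same objects, and maps $A\to B$ are spans $A\xleftarrow{m}A'\xrightarrow{f}B$ with $m$ monic, modulo isomorphism of $A'$, composed by pullback; it is a restriction category with $\overline{(m,f)}=(m,m)$. A map $f$ is a partial isomorphism if there is $g$ with $fg=\overline f$ and $gf=\overline g$; $\mathsf{ParIso}(\mathbb{X})$ is the subcategory of partial isomorphisms. $\mathsf{ParIso}(\mathsf{CTor}_2)^{*}$ denotes $\mathsf{ParIso}(\mathsf{CTor}_2)$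 with the empty torsor removed. *)

(* Defs.v *)
From Stdlib Require Import List Setoid Morphisms RelationClasses Classical_Prop.
From mathcomp Require Import all_boot.

Set Implicit Arguments.
Unset Strict Implicit.
Unset Printing Implicit Defensive.

Declare Scope cat_scope.
Delimit Scope cat_scope with cat.
Local Open Scope cat_scope.

(* Hom-sets are setoids: [heq] is the equality of parallel morphisms, so that
   quotients (terms modulo relations, spans modulo isomorphism) are carried by
   [heq].  Composition is diagrammatic. *)
Record category := Category {
  Ob :> Type;
  Hom : Ob -> Ob -> Type;
  heq : forall A B : Ob, Hom A B -> Hom A B -> Prop;
  idm : forall A : Ob, Hom A A;
  cmp : forall A B C : Ob, Hom A B -> Hom B C -> Hom A C;
  heq_equiv : forall A B : Ob, Equivalence (@heq A B);
  cmp_heq : forall (A B C : Ob) (f f' : Hom A B) (g g' : Hom B C),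
    heq f f' -> heq g g' -> heq (cmp f g) (cmp f' g');
  cmpA : forall (A B C D : Ob) (f : Hom A B) (g : Hom B C) (h : Hom C D),
    heq (cmp f (cmp g h)) (cmp (cmp f g) h);
  cmp1m : forall (A B : Ob) (f : Hom A B), heq (cmp (idm A) f) f;
  cmpm1 : forall (A B : Ob) (f : Hom A B), heq (cmp f (idm B)) f
}.

Arguments idm {c} A.

Notation "f ;; g" := (cmp f g) (at level 40, left associativity) : cat_scope.
Notation "f =~ g" := (heq f g) (at level 70, no associativity) : cat_scope.

#[export] Existing Instance heq_equiv.
#[export] Hint Extern 0 (heq _ _) => reflexivity : core.

#[export] Instance cmp_proper (C : category) (X Y Z : C) :
  Proper (@heq C X Y ==> @heq C Y Z ==> @heq C X Z) (@cmp C X Y Z).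
Proof. by move=> f f' ff' g g' gg'; apply: cmp_heq. Qed.

Definition inverse_pair (C : category) (A B : C) (f : Hom A B) (g : Hom B A) :
    Prop :=
  f ;; g =~ idm A /\ g ;; f =~ idm B.

Definition is_iso (C : category) (A B : C) (f : Hom A B) : Prop :=
  exists g : Hom B A, inverse_pair f g.

Definition monic (C : category) (A B : C) (m : Hom A B) : Prop :=
  forall (Q : C) (h k : Hom Q A), h ;; m =~ k ;; m -> h =~ k.

Record functor (C D : category) := Functor {
  fob :> C -> D;
  fmap : forall A B : C, Hom A B -> Hom (fob A) (fob B);
  fmap_heq : forall (A B : C) (f g : Hom A B), f =~ g -> fmap f =~ fmap g;
  fmap_id : forall A : C, fmap (idm A) =~ idm (fob A);
  fmap_cmp : forall (X Y Z : C) (f : Hom X Y) (g : Hom Y Z),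
    fmap (f ;; g) =~ fmap f ;; fmap g
}.

Definition functor_id (C : category) : functor C C.
Proof. by exists (fun A => A) (fun A B f => f). Defined.

Definition functor_cmp (C D E : category) (F : functor C D) (G : functor D E) :
  functor C E.
Proof.
exists (fun A => G (F A)) (fun A B f => fmap G (fmap F f)).
- by move=> A B f g fg; do 2!apply: fmap_heq.
- by move=> A; rewrite (fmap_heq G (fmap_id F A)) fmap_id.
- by move=> X Y Z f g; rewrite (fmap_heq G (fmap_cmp F f g)) fmap_cmp.
Defined.

Definition nat_isomorphic (C D : category) (F G : functor C D) : Prop :=
  exists eta : forall A : C, Hom (F A) (G A),
    (forall (A B : C) (f : Hom A B), fmap F f ;; eta B =~ eta A ;; fmap G f)
    /\ (forall A : C, is_iso (eta A)).

Definition equivalent_categories (C D : category) : Prop :=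
  exists (F : functor C D) (G : functor D C),
    nat_isomorphic (functor_cmp F G) (functor_id C)
    /\ nat_isomorphic (functor_cmp G F) (functor_id D).

Definition full_subcategory (C : category) (P : C -> Prop) : category.
Proof.
exists {A : C | P A} (fun A B => Hom (proj1_sig A) (proj1_sig B))
  (fun A B f g => f =~ g) (fun A => idm (proj1_sig A))
  (fun X Y Z f g => f ;; g).
- by move=> A B; apply: heq_equiv.
- by move=> *; apply: cmp_heq.
- by move=> *; apply: cmpA.
- by move=> *; apply: cmp1m.
- by move=> *; apply: cmpm1.
Defined.

(* Restriction categories (Cockett and Lack), axioms R1 to R4. *)
Record restriction_category := RestrictionCategory {
  rcat :> category;
  restr : forall A B : rcat, Hom A B -> Hom A A;
  restr_heq : forall (A B : rcat) (f g : Hom A B), f =~ g -> restr f =~ restr g;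
  restr1 : forall (A B : rcat) (f : Hom A B), restr f ;; f =~ f;
  restr2 : forall (X Y Z : rcat) (f : Hom X Y) (g : Hom X Z),
    restr f ;; restr g =~ restr g ;; restr f;
  restr3 : forall (X Y Z : rcat) (f : Hom X Y) (g : Hom X Z),
    restr (restr f ;; g) =~ restr f ;; restr g;
  restr4 : forall (X Y Z : rcat) (f : Hom X Y) (g : Hom Y Z),
    f ;; restr g =~ restr (f ;; g) ;; f
}.

Definition partial_iso (C : restriction_category) (A B : C) (f : Hom A B) :
    Prop :=
  exists g : Hom B A, f ;; g =~ restr f /\ g ;; f =~ restr g.

Lemma restr_idm (C : restriction_category) (A : C) : restr (idm A) =~ idm A.
Proof. by rewrite -[X in X =~ _]cmpm1 restr1. Qed.

Lemma partial_iso_idm (C : restriction_category) (A : C) : partial_iso (idm A).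
Proof. by exists (idm A); rewrite cmp1m restr_idm. Qed.

Lemma partial_iso_half (C : restriction_category) (X Y Z : C)
    (f : Hom X Y) (f' : Hom Y X) (g : Hom Y Z) (g' : Hom Z Y) :
  f ;; f' =~ restr f -> g ;; g' =~ restr g ->
  (f ;; g) ;; (g' ;; f') =~ restr (f ;; g).
Proof.
move=> ff gg.
rewrite cmpA -(cmpA f g g') gg restr4 -cmpA ff restr2 -restr3.
by apply: restr_heq; rewrite cmpA restr1.
Qed.

Lemma partial_iso_cmp (C : restriction_category) (X Y Z : C)
    (f : Hom X Y) (g : Hom Y Z) :
  partial_iso f -> partial_iso g -> partial_iso (f ;; g).
Proof.
move=> [f' [ff' f'f]] [g' [gg' g'g]]; exists (g' ;; f').
by split; apply: partial_iso_half.
Qed.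

Definition ParIso (C : restriction_category) : category.
Proof.
exists C (fun A B => {f : Hom A B | partial_iso f})
  (fun A B f g => proj1_sig f =~ proj1_sig g)
  (fun A => exist _ (idm A) (partial_iso_idm A))
  (fun X Y Z f g => exist _ (proj1_sig f ;; proj1_sig g)
     (partial_iso_cmp (proj2_sig f) (proj2_sig g))).
- move=> A B; split=> [f | f g | f g h] /=; first by reflexivity.
  + by move=> fg; symmetry.
  + by move=> fg gh; transitivity (proj1_sig g).
- by move=> * /=; apply: cmp_heq.
- by move=> * /=; apply: cmpA.
- by move=> * /=; apply: cmp1m.
- by move=> * /=; apply: cmpm1.
Defined.

Record pullback (C : category) (X Y Z : C) (f : Hom X Z) (g : Hom Y Z) :=
  Pullback {
  pb_ob :> C;
  pb_fst : Hom pb_ob X;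
  pb_snd : Hom pb_ob Y;
  pb_comm : pb_fst ;; f =~ pb_snd ;; g;
  pb_univ : forall (Q : C) (q : Hom Q X) (r : Hom Q Y), q ;; f =~ r ;; g ->
    exists u : Hom Q pb_ob, (u ;; pb_fst =~ q /\ u ;; pb_snd =~ r) /\
      forall v : Hom Q pb_ob, v ;; pb_fst =~ q /\ v ;; pb_snd =~ r -> v =~ u
}.

Definition pullbacks (C : category) : Type :=
  forall (X Y Z : C) (f : Hom X Z) (g : Hom Y Z), pullback f g.

Record partial_map (C : category) (A B : C) := PartialMap {
  pm_ob : C;
  pm_dom : Hom pm_ob A;
  pm_map : Hom pm_ob B;
  pm_monic : monic pm_dom
}.

Definition partial_map_iso (C : category) (A B : C) (s t : partial_map A B) :
    Prop :=
  exists phi : Hom (pm_ob s) (pm_ob t), is_iso phi /\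
    (phi ;; pm_dom t =~ pm_dom s /\ phi ;; pm_map t =~ pm_map s).

Lemma monic_idm (C : category) (A : C) : monic (idm A).
Proof. by move=> Q h k; rewrite !cmpm1. Qed.

Lemma monic_cmp (C : category) (X Y Z : C) (m : Hom X Y) (n : Hom Y Z) :
  monic m -> monic n -> monic (m ;; n).
Proof. by move=> mm mn Q h k; rewrite !cmpA => /mn /mm. Qed.

Lemma monic_pb_fst (C : category) (X Y Z : C) (f : Hom X Z) (g : Hom Y Z)
  (P : pullback f g) : monic g -> monic (pb_fst P).
Proof.
move=> mg Q h k hk.
have hkr : h ;; pb_snd P =~ k ;; pb_snd P.
  by apply: mg; rewrite -!cmpA -pb_comm !cmpA hk.
have e : (h ;; pb_fst P) ;; f =~ (h ;; pb_snd P) ;; g.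
  by rewrite -!cmpA pb_comm.
have [u [_ uu]] := pb_univ P e.
rewrite (uu h); last by split; reflexivity.
by rewrite (uu k) ?hk ?hkr; [reflexivity | split; reflexivity].
Qed.

Definition pm_id (C : category) (A : C) : partial_map A A :=
  PartialMap (idm A) (@monic_idm C A).

Definition pm_cmp (C : category) (pb : pullbacks C) (X Y Z : C)
    (s : partial_map X Y) (t : partial_map Y Z) : partial_map X Z :=
  let P := pb _ _ _ (pm_map s) (pm_dom t) in
  @PartialMap C X Z P (pb_fst P ;; pm_dom s) (pb_snd P ;; pm_map t)
    (monic_cmp (monic_pb_fst (pm_monic (p := t))) (pm_monic (p := s))).

Definition pm_restr (C : category) (X Y : C) (s : partial_map X Y) :
    partial_map X X :=
  PartialMap (pm_dom s) (pm_monic (p := s)).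

(* Generalized elements of the graph of a partial map; all the laws of Par are
   checked on them. *)
Definition pm_graph (C : category) (A B : C) (s : partial_map A B) (Q : C)
    (q : Hom Q A) (r : Hom Q B) : Prop :=
  exists u : Hom Q (pm_ob s), u ;; pm_dom s =~ q /\ u ;; pm_map s =~ r.

Lemma pm_graph_fun (C : category) (A B : C) (s : partial_map A B) (Q : C)
    (q q' : Hom Q A) (r r' : Hom Q B) :
  pm_graph s q r -> pm_graph s q' r' -> q =~ q' -> r =~ r'.
Proof.
move=> [u [uq ur]] [v [vq vr]] qq.
have uv : u =~ v by apply: (pm_monic (p := s)); rewrite uq vq.
by rewrite -ur -vr uv.
Qed.

Lemma pm_graph_heq (C : category) (A B : C) (s : partial_map A B) (Q : C)
    (q q' : Hom Q A) (r r' : Hom Q B) :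
  q =~ q' -> r =~ r' -> pm_graph s q r -> pm_graph s q' r'.
Proof. by move=> qq rr [u [uq ur]]; exists u; rewrite uq ur. Qed.

Lemma partial_map_isoP (C : category) (A B : C) (s t : partial_map A B) :
  partial_map_iso s t <->
  (forall (Q : C) (q : Hom Q A) (r : Hom Q B),
     pm_graph s q r <-> pm_graph t q r).
Proof.
split.
  move=> [phi [[psi [pp pp']] [pd pm]]] Q q r; split=> -[u [uq ur]].
    by exists (u ;; phi); rewrite -!cmpA pd pm.
  by exists (u ;; psi); rewrite -!cmpA -pd -pm !(cmpA psi) pp' !cmp1m.
move=> st.
have [|phi [p1 p2]] := (st _ (pm_dom s) (pm_map s)).1.
  by exists (idm _); rewrite !cmp1m; split; reflexivity.
have [|psi [q1 q2]] := (st _ (pm_dom t) (pm_map t)).2.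
  by exists (idm _); rewrite !cmp1m; split; reflexivity.
exists phi; split=> //; exists psi; split.
  by apply: (pm_monic (p := s)); rewrite -cmpA q1 p1 cmp1m.
by apply: (pm_monic (p := t)); rewrite -cmpA p1 q1 cmp1m.
Qed.

Lemma pm_graph_id (C : category) (A Q : C) (q r : Hom Q A) :
  pm_graph (pm_id A) q r <-> q =~ r.
Proof.
split=> [[u [/= uq ur]] | qr]; first by rewrite -uq -ur.
by exists q; rewrite /= !cmpm1.
Qed.

Lemma pm_graph_restr (C : category) (A B Q : C) (s : partial_map A B)
    (q r : Hom Q A) :
  pm_graph (pm_restr s) q r <-> q =~ r /\ exists y, pm_graph s q y.
Proof.
split=> [[u [/= uq ur]] | [qr [y [u [uq uy]]]]].
  by split; [rewrite -uq -ur | exists (u ;; pm_map s), u].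
by exists u; split; rewrite /= uq.
Qed.

Lemma pm_graph_cmp (C : category) (pb : pullbacks C) (X Y Z Q : C)
    (s : partial_map X Y) (t : partial_map Y Z) (q : Hom Q X) (r : Hom Q Z) :
  pm_graph (pm_cmp pb s t) q r <->
  exists y, pm_graph s q y /\ pm_graph t y r.
Proof.
pose P := pb _ _ _ (pm_map s) (pm_dom t); split.
  move=> [u [/= uq ur]]; rewrite -/P in u uq ur.
  exists (u ;; pb_fst P ;; pm_map s); split.
    by exists (u ;; pb_fst P); rewrite -(cmpA u) uq.
  by exists (u ;; pb_snd P); rewrite -!cmpA ur pb_comm.
move=> [y [[a [aq ay]] [b [bq br]]]].
have e : a ;; pm_map s =~ b ;; pm_dom t by rewrite ay bq.
have [u [[ua ub] _]] := pb_univ P e.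
by exists u; rewrite /= !cmpA ua ub.
Qed.

Definition Par_category (C : category) (pb : pullbacks C) : category.
Proof.
exists C (@partial_map C) (@partial_map_iso C) (@pm_id C) (@pm_cmp C pb).
- move=> A B; split.
  + by move=> s; apply/partial_map_isoP.
  + move=> s t /partial_map_isoP st; apply/partial_map_isoP => Q q r.
    by rewrite st.
  + move=> s t w /partial_map_isoP st /partial_map_isoP tw.
    by apply/partial_map_isoP => Q q r; rewrite st tw.
- move=> X Y Z f f' g g' /partial_map_isoP ff /partial_map_isoP gg.
  apply/partial_map_isoP => Q q r; rewrite !pm_graph_cmp.
  by split=> -[y [h k]]; exists y; [rewrite -ff -gg|rewrite ff gg].
- move=> X Y Z W f g h; apply/partial_map_isoP => Q q r.
  rewrite !pm_graph_cmp; split.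
    move=> [y [fy /pm_graph_cmp [z [gz hz]]]].
    by exists z; split=> //; apply/pm_graph_cmp; exists y.
  move=> [z [/pm_graph_cmp [y [fy gz]] hz]].
  by exists y; split=> //; apply/pm_graph_cmp; exists z.
- move=> A B f; apply/partial_map_isoP => Q q r; rewrite pm_graph_cmp; split.
    move=> [y [/pm_graph_id qy]]; apply: pm_graph_heq; last by reflexivity.
    by symmetry.
  by move=> fq; exists q; split=> //; apply/pm_graph_id; reflexivity.
- move=> A B f; apply/partial_map_isoP => Q q r; rewrite pm_graph_cmp; split.
    by move=> [y [fy /pm_graph_id yr]]; apply: pm_graph_heq fy => //;
      reflexivity.
  by move=> fq; exists r; split=> //; apply/pm_graph_id; reflexivity.
Defined.

Definition Par (C : category) (pb : pullbacks C) : restriction_category.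
Proof.
exists (Par_category pb) (@pm_restr C).
- move=> A B f g /partial_map_isoP fg; apply/partial_map_isoP => Q q r.
  rewrite !pm_graph_restr.
  by split=> -[qr [y h]]; split=> //; exists y; apply/fg.
- move=> A B f; apply/partial_map_isoP => Q q r; rewrite pm_graph_cmp; split.
    move=> [y [/pm_graph_restr [qy _]]]; apply: pm_graph_heq.
      by symmetry.
    by reflexivity.
  move=> h; exists q; split=> //; apply/pm_graph_restr; split.
    by reflexivity.
  by exists r.
- have half X Y Z (f : partial_map X Y) (g : partial_map X Z) Q (q r : Hom Q X) :
      (exists y, pm_graph (pm_restr f) q y /\ pm_graph (pm_restr g) y r) ->
      exists y, pm_graph (pm_restr g) q y /\ pm_graph (pm_restr f) y r.
    move=> [y [/pm_graph_restr [qy [a ha]] /pm_graph_restr [yr [b hb]]]].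
    exists q; split; apply/pm_graph_restr; split.
    + by [].
    + by exists b; apply: pm_graph_heq hb => //; symmetry.
    + by rewrite qy.
    + by exists a.
  move=> X Y Z f g; apply/partial_map_isoP => Q q r; rewrite !pm_graph_cmp.
  by split; apply: half.
- move=> X Y Z f g; apply/partial_map_isoP => Q q r.
  rewrite pm_graph_restr pm_graph_cmp; split.
    move=> [qr [z /pm_graph_cmp [y [/pm_graph_restr [qy [a ha]] hz]]]].
    exists y; split; apply/pm_graph_restr; split=> //.
    + by exists a.
    + by rewrite -qy.
    + by exists z.
  move=> [y [/pm_graph_restr [qy [a ha]] /pm_graph_restr [yr [b hb]]]].
  split; first by rewrite qy.
  exists b; apply/pm_graph_cmp; exists y; split=> //.
  by apply/pm_graph_restr; split=> //; exists a.
- move=> X Y Z f g; apply/partial_map_isoP => Q q r; rewrite !pm_graph_cmp.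
  split.
    move=> [y [fy /pm_graph_restr [yr [z gz]]]]; exists q; split.
      apply/pm_graph_restr; split; first by reflexivity.
      by exists z; apply/pm_graph_cmp; exists y.
    by apply: pm_graph_heq fy => //; reflexivity.
  move=> [q' [/pm_graph_restr [qq [z /pm_graph_cmp [y [fy gz]]]] fr]].
  have yr : y =~ r := pm_graph_fun fy fr qq.
  by exists y; split=> //; apply/pm_graph_restr; split=> //; exists z.
Defined.

(* [tor a b c] is the ternary operation with b as its middle argument. *)
Record torsor := Torsor {
  carrier :> Type;
  tor : carrier -> carrier -> carrier -> carrier;
  torAl : forall a b c d e, tor (tor a b c) d e = tor a (tor d c b) e;
  torAr : forall a b c d e, tor a (tor d c b) e = tor a b (tor c d e);
  torK : forall a b, tor a b b = a;
  torKl : forall a b, tor b b a = a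
}.

Definition torsor_commutative (X : torsor) : Prop :=
  forall a b c : X, tor a b c = tor c b a.

Definition torsor_char2 (X : torsor) : Prop :=
  forall a b : X, tor a b a = b.

Definition torsor_finitely_generated (X : torsor) : Prop :=
  exists l : list X, forall P : X -> Prop,
    (forall x, In x l -> P x) ->
    (forall a b c, P a -> P b -> P c -> P (tor a b c)) ->
    forall x, P x.

Record torsor_hom (X Y : torsor) := TorsorHom {
  thom :> X -> Y;
  thomP : forall a b c, thom (tor a b c) = tor (thom a) (thom b) (thom c)
}.

Record ctor2 := CTor2Object {
  ct_torsor :> torsor;
  ct_commutative : torsor_commutative ct_torsor;
  ct_char2 : torsor_char2 ct_torsor;
  ct_finitely_generated : torsor_finitely_generated ct_torsor
}.

Definition torsor_hom_id (X : torsor) : torsor_hom X X :=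
  TorsorHom (thom := fun x => x) (fun _ _ _ => erefl).

Definition torsor_hom_cmp (X Y Z : torsor) (f : torsor_hom X Y)
  (g : torsor_hom Y Z) : torsor_hom X Z.
Proof. by exists (fun x => g (f x)) => a b c; rewrite !thomP. Defined.

Definition CTor2 : category.
Proof.
exists ctor2 (fun X Y : ctor2 => torsor_hom X Y)
  (fun X Y f g => forall x, f x = g x)
  (fun X => torsor_hom_id X) (fun X Y Z f g => torsor_hom_cmp f g) => //.
- by move=> X Y; split=> [f | f g fg | f g h fg gh] x //; rewrite fg.
- by move=> X Y Z f f' g g' ff gg x /=; rewrite ff gg.
Defined.

Lemma ctor2_finite (X : ctor2) : exists l : list X, forall x, In x l.
Proof.
have [[|g l] gen] := ct_finitely_generated X.
  by exists nil; apply: (gen (fun=> In _ nil)).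
pose add (a b : X) := tor a g b.
have addC a b : add a b = add b a by apply: ct_commutative.
have addA a b c : add a (add b c) = add (add a b) c.
  by rewrite /add torAl torAr.
have addK a b : add a (add a b) = b by rewrite addA /add ct_char2 torKl.
have torE a b c : tor a b c = add (add a b) c.
  by rewrite /add torAl ct_char2.
pose sp := fix sp (s : list X) : list X :=
  if s is h :: s' then sp s' ++ List.map (add h) (sp s') else g :: nil.
have sp_add s x y : In x (sp s) -> In y (sp s) -> In (add x y) (sp s).
  elim: s x y => [|h s IH] x y /=.
    by move=> [<-|//] [<-|//]; left; rewrite /add torK.
  move=> /in_app_iff [xs|/in_map_iff [x' [<- xs]]];
    move=> /in_app_iff [ys|/in_map_iff [y' [<- ys]]]; apply/in_app_iff.
  - by left; apply: IH.
  - right; apply/in_map_iff; exists (add x y'); split; last exact: IH.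
    by rewrite !addA (addC h).
  - right; apply/in_map_iff; exists (add x' y); split; last exact: IH.
    by rewrite !addA.
  - left; suff -> : add (add h x') (add h y') = add x' y' by apply: IH.
    by rewrite (addC h x') -addA addK.
have sp_g s : In g (sp s).
  by elim: s => [|h s IH]; [left | apply/in_app_iff; left].
have sp_in s x : In x s -> In x (sp s).
  elim: s => // h s IH /= [<-|/IH xs]; apply/in_app_iff; last by left.
  by right; apply/in_map_iff; exists g; split; rewrite ?[add _ _]torK.
exists (sp l); apply: gen => [x /= [<- //|]|a b c sa sb sc]; first exact: sp_in.
by rewrite torE; exact: sp_add (sp_add _ _ _ sa sb) sc.
Qed.

Lemma sig_eq (T : Type) (P : T -> Prop) (u v : {x | P x}) :
  proj1_sig u = proj1_sig v -> u = v.
Proof.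
case: u v => [x px] [y py] /= e; case: y / e py => py.
by rewrite (proof_irrelevance _ px py).
Qed.

Lemma finite_sig (T : Type) (P : T -> Prop) (l : list T) :
  exists s : list {x | P x}, forall u, In (proj1_sig u) l -> In u s.
Proof.
elim: l => [|x l [s sP]]; first by exists nil.
have [px|npx] := classic (P x).
  exists (exist P x px :: s) => u /= [ux|/sP us]; [left | by right].
  exact: sig_eq.
by exists s => u /= [ux|/sP //]; case: npx; rewrite ux; apply: proj2_sig.
Qed.

Definition pb_carrier (X Y Z : torsor) (f : torsor_hom X Z)
    (g : torsor_hom Y Z) : Type :=
  {p : X * Y | f p.1 = g p.2}.

Lemma pb_torP (X Y Z : torsor) (f : torsor_hom X Z) (g : torsor_hom Y Z)
    (a b c : pb_carrier f g) :
  f (tor (proj1_sig a).1 (proj1_sig b).1 (proj1_sig c).1)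
  = g (tor (proj1_sig a).2 (proj1_sig b).2 (proj1_sig c).2).
Proof. by rewrite !thomP !(proj2_sig a, proj2_sig b, proj2_sig c). Qed.

Definition pb_tor (X Y Z : torsor) (f : torsor_hom X Z) (g : torsor_hom Y Z)
    (a b c : pb_carrier f g) : pb_carrier f g :=
  exist (fun p => f p.1 = g p.2)
    (tor (proj1_sig a).1 (proj1_sig b).1 (proj1_sig c).1,
     tor (proj1_sig a).2 (proj1_sig b).2 (proj1_sig c).2) (pb_torP a b c).

Definition pb_torsor (X Y Z : torsor) (f : torsor_hom X Z)
  (g : torsor_hom Y Z) : torsor.
Proof.
exists (pb_carrier f g) (@pb_tor X Y Z f g).
- by move=> a b c d e; apply: sig_eq; rewrite /= !torAl.
- by move=> a b c d e; apply: sig_eq; rewrite /= !torAr.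
- by move=> [[a1 a2] ea] b; apply: sig_eq; rewrite /= !torK.
- by move=> [[a1 a2] ea] b; apply: sig_eq; rewrite /= !torKl.
Defined.

Definition ctor2_pb (X Y Z : ctor2) (f : torsor_hom X Z) (g : torsor_hom Y Z) :
  ctor2.
Proof.
exists (pb_torsor f g).
- by move=> a b c; apply: sig_eq => /=; congr pair; apply: ct_commutative.
- by move=> a [[b1 b2] eb]; apply: sig_eq; rewrite /= !ct_char2.
- have [lX lXP] := ctor2_finite X; have [lY lYP] := ctor2_finite Y.
  have [s sP] := finite_sig (fun p : X * Y => f p.1 = g p.2)
                   (list_prod lX lY).
  exists s => P Ps _ u; apply: Ps; apply: sP.
  by case: (proj1_sig u) => x y; apply/in_prod_iff; split.
Defined.

Definition pb_pr1 (X Y Z : ctor2) (f : torsor_hom X Z) (g : torsor_hom Y Z) :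
    torsor_hom (ctor2_pb f g) X :=
  @TorsorHom (ctor2_pb f g) X (fun p => (proj1_sig p).1) (fun _ _ _ => erefl).

Definition pb_pr2 (X Y Z : ctor2) (f : torsor_hom X Z) (g : torsor_hom Y Z) :
    torsor_hom (ctor2_pb f g) Y :=
  @TorsorHom (ctor2_pb f g) Y (fun p => (proj1_sig p).2) (fun _ _ _ => erefl).

Definition CTor2_pullbacks : pullbacks CTor2.
Proof.
move=> X Y Z f g.
apply: (@Pullback CTor2 X Y Z f g (ctor2_pb f g) (pb_pr1 f g) (pb_pr2 f g)).
  by move=> [p e].
move=> Q q r qr.
pose u (x : Q) : ctor2_pb f g :=
  exist (fun p => f p.1 = g p.2) (q x, r x) (qr x).
have uP a b c : u (tor a b c) = tor (u a) (u b) (u c).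
  by apply: sig_eq; rewrite /= !thomP.
exists (TorsorHom uP); split=> // v [vq vr] x; apply: sig_eq => /=.
by rewrite -vq -vr /=; case: (proj1_sig (v x)).
Defined.

Definition ParIso_CTor2_star : category :=
  full_subcategory (C := ParIso (Par CTor2_pullbacks))
    (fun X : ctor2 => inhabited X).

Inductive circuit : nat -> nat -> Type :=
| cid n : circuit n n
| ccmp m n p : circuit m n -> circuit n p -> circuit m p
| ctens m n p q : circuit m n -> circuit p q -> circuit (m + p) (n + q)
| csym m n : circuit (m + n) (n + m)
| cnot : circuit 2 2
| ket1 : circuit 0 1
| bra1 : circuit 1 0.

Declare Scope circuit_scope.
Delimit Scope circuit_scope with circuit.
Bind Scope circuit_scope with circuit.
Local Open Scope circuit_scope.

Notation "f >> g" := (ccmp f g) (at level 50, left associativity)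
  : circuit_scope.
Notation "f ** g" := (ctens f g) (at level 40, left associativity)
  : circuit_scope.

(* The transport is needed only because the strict laws of addition on objects
   are not all definitional. *)
Definition ccast (m m' n n' : nat) (em : m = m') (en : n = n')
    (f : circuit m n) : circuit m' n' :=
  ecast i (circuit i n') em (ecast j (circuit m j) en f).

Definition swap : circuit 2 2 := csym 1 1.
Definition cnot21 : circuit 2 2 := swap >> cnot >> swap.

(* [cnot3_ij] is the gate on three wires with control i and target j. *)
Definition cnot3_12 : circuit 3 3 := cnot ** cid 1.
Definition cnot3_21 : circuit 3 3 := cnot21 ** cid 1.
Definition cnot3_23 : circuit 3 3 := cid 1 ** cnot.
Definition cnot3_32 : circuit 3 3 := cid 1 ** cnot21.
Definition cnot3_13 : circuit 3 3 :=
  (cid 1 ** swap) >> cnot3_12 >> (cid 1 ** swap).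

Inductive ceq : forall m n : nat, circuit m n -> circuit m n -> Prop :=
| ceq_refl m n (f : circuit m n) : ceq f f
| ceq_sym m n (f g : circuit m n) : ceq f g -> ceq g f
| ceq_trans m n (f g h : circuit m n) : ceq f g -> ceq g h -> ceq f h
| ceq_cmp m n p (f f' : circuit m n) (g g' : circuit n p) :
    ceq f f' -> ceq g g' -> ceq (f >> g) (f' >> g')
| ceq_tens m n p q (f f' : circuit m n) (g g' : circuit p q) :
    ceq f f' -> ceq g g' -> ceq (f ** g) (f' ** g')
| ceq_cmpA m n p q (f : circuit m n) (g : circuit n p) (h : circuit p q) :
    ceq (f >> (g >> h)) (f >> g >> h)
| ceq_cmp1m m n (f : circuit m n) : ceq (cid m >> f) f
| ceq_cmpm1 m n (f : circuit m n) : ceq (f >> cid n) f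
| ceq_tens_id m n : ceq (cid m ** cid n) (cid (m + n))
| ceq_tens_cmp m n p m' n' p' (f : circuit m n) (g : circuit n p)
    (f' : circuit m' n') (g' : circuit n' p') :
    ceq ((f >> g) ** (f' >> g')) ((f ** f') >> (g ** g'))
| ceq_tensA m n p q r s (f : circuit m n) (g : circuit p q) (h : circuit r s) :
    ceq (ccast (addnA m p r) (addnA n q s) (f ** (g ** h))) (f ** g ** h)
| ceq_tens0m m n (f : circuit m n) : ceq (cid 0 ** f) f
| ceq_tensm0 m n (f : circuit m n) :
    ceq (ccast (addn0 m) (addn0 n) (f ** cid 0)) f
| ceq_sym_nat m n p q (f : circuit m n) (g : circuit p q) :
    ceq ((f ** g) >> csym n q) (csym m p >> (g ** f))
| ceq_symK m n : ceq (csym m n >> csym n m) (cid (m + n))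
| ceq_hexagon m n p :
    ceq (ccast (addnA m n p) (erefl (n + p + m)) (csym m (n + p)))
        ((csym m n ** cid p) >>
           ccast (addnA n m p) (addnA n p m) (cid n ** csym m p))
| CNT1 : ceq (cnot >> cnot21 >> cnot) swap
| CNT2 : ceq (cnot >> cnot) (cid 2)
| CNT3 : ceq (cnot3_21 >> cnot3_23) (cnot3_23 >> cnot3_21)
| CNT4a : ceq ((ket1 ** cid 1) >> cnot)
              ((ket1 ** cid 1) >> cnot >> (bra1 ** cid 1) >> (ket1 ** cid 1))
| CNT4b : ceq (cnot >> (bra1 ** cid 1))
              ((bra1 ** cid 1) >> (ket1 ** cid 1) >> cnot >> (bra1 ** cid 1))
| CNT5 : ceq (cnot3_12 >> cnot3_32) (cnot3_32 >> cnot3_12)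
| CNT6 : ceq (ket1 >> bra1) (cid 0)
| CNT7a : ceq ((ket1 ** ket1 ** cid 1) >> cnot3_12 >> cnot3_23 >>
                 (bra1 ** cid 2))
              ((ket1 ** ket1 ** cid 1) >> cnot3_12 >> (bra1 ** cid 2))
| CNT7b : ceq ((ket1 ** cid 2) >> cnot3_23 >> cnot3_12 >>
                 (bra1 ** bra1 ** cid 1))
              ((ket1 ** cid 2) >> cnot3_12 >> (bra1 ** bra1 ** cid 1))
| CNT8 : ceq (cnot3_12 >> cnot3_23 >> cnot3_12) (cnot3_23 >> cnot3_13)
| CNT9 : ceq ((ket1 ** ket1 ** cid 1) >> cnot3_12 >> (bra1 ** bra1 ** cid 1))
             ((ket1 ** ket1 ** bra1) >> cnot >> (bra1 ** bra1 ** ket1)).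

Definition CNOT : category.
Proof.
exists nat circuit ceq cid ccmp.
- by move=> m n; split;
    [exact: ceq_refl | exact: ceq_sym | exact: ceq_trans].
- exact: ceq_cmp.
- exact: ceq_cmpA.
- exact: ceq_cmp1m.
- exact: ceq_cmpm1.
Defined.

(* Main.v *)
From Stdlib Require Import FunctionalExtensionality PropExtensionality.
From Stdlib Require Import IndefiniteDescription Classical_Prop Lia.
From mathcomp Require Import all_boot.
Require Import Defs.

(** Let [sem] send a circuit to the partial affine injection of bit vectors it
    computes.  Every nonempty commutative torsor of characteristic 2 that is
    finitely generated has a basis, hence is isomorphic to some [vec n], so it
    is enough that [sem] be full and faithful.

    Fullness.  A nonempty partial affine isomorphism is the solution set of
    [b = A a], [a = B b] for total affine maps A and B; copying A(a) on fresh
    wires, exchanging the registers and uncomputing with B realizes it.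

    Faithfulness.  Padding with |1> and <1| turns every circuit into an
    endomorphism of N wires generated by the gates C_ij and the projections
    P_i = <1||1>, where the coherence of the symmetric structure makes C_ij and
    P_i well defined.  In the monoid they generate, with one spare wire set to
    1 and further wires set to 0, each word has the form Q h: Q projects on the
    affine domain and h is a product of gates C_ij.  An affine functional
    vanishing on the domain is a combination of the defining equations, so Q
    absorbs the corresponding controlled additions; hence Q depends only on the
    domain.  If h fixes the domain pointwise then Q h = Q: copy the register,
    apply h, use the copy to reset the register to 0, where the inverse of h
    is absorbed, and undo.  No presentation of GL_N(F_2) is needed. *)

(** The hinge between syntax and linear algebra is to express that x satisfies an equation e = 0 by
    x T = x, where T adds the value of e to a wire known to be 0. In this form the satisfied
    equations are closed under addition, so linear duality applies without elimination or choice of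
    a basis. That the target is 0 gives the form its strength: such a wire absorbs the gates that it
    controls, so a commutator identity carries the addition over to any other wire.

    The spare wires have separate duties. The constant wire makes affine equations linear. Tests are
    made on a wire a, and satisfied equations are read on a wire b; a test can be moved from one to
    the other, and therefore tests commute. The other zero wires hold the copy of the register.
    Padding only supplies wires in state 1; the zeros come from flips controlled by the constant
    wire, which commute with all words on the register.

    Inconsistent systems are treated apart, because the passage from affine to linear needs a
    solution. There 1 = 0 becomes a consequence, and every gate on the register is absorbed. *)

Set Implicit Arguments.
Unset Strict Implicit.
Unset Printing Implicit Defensive.

(** * Covectors and monoids generated by controlled gates *)

Declare Scope cm_scope.
Delimit Scope cm_scope with cm.

(* [cm_C i j] is the gate with control i and target j, [cm_P i] the projection
   on the states where wire i carries 1, and the product is diagrammatic. *)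
Record cnot_monoid (W : Type) (neq : W -> W -> Prop) := CnotMonoid {
  cm_sort :> Type;
  cm_mul : cm_sort -> cm_sort -> cm_sort;
  cm_one : cm_sort;
  cm_C : W -> W -> cm_sort;
  cm_P : W -> cm_sort;
  cm_mulA : forall x y z, cm_mul x (cm_mul y z) = cm_mul (cm_mul x y) z;
  cm_mul1x : forall x, cm_mul cm_one x = x;
  cm_mulx1 : forall x, cm_mul x cm_one = x;
  cm_CC : forall i j, neq i j -> cm_mul (cm_C i j) (cm_C i j) = cm_one;
  cm_CcommC : forall i j k l, neq i j -> neq k l -> neq i l -> neq j k ->
    cm_mul (cm_C i j) (cm_C k l) = cm_mul (cm_C k l) (cm_C i j);
  cm_CCC : forall i j k, neq i j -> neq j k -> neq i k ->
    cm_mul (cm_mul (cm_C i j) (cm_C j k)) (cm_C i j) =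
    cm_mul (cm_C j k) (cm_C i k);
  cm_SC : forall i j, neq i j ->
    cm_mul (cm_mul (cm_C i j) (cm_C j i)) (cm_C i j) =
    cm_mul (cm_mul (cm_C j i) (cm_C i j)) (cm_C j i);
  cm_PS : forall i j, neq i j ->
    cm_mul (cm_P i) (cm_mul (cm_mul (cm_C i j) (cm_C j i)) (cm_C i j)) =
    cm_mul (cm_mul (cm_mul (cm_C i j) (cm_C j i)) (cm_C i j)) (cm_P j);
  cm_PPS : forall i j, neq i j ->
    cm_mul (cm_mul (cm_P i) (cm_P j))
      (cm_mul (cm_mul (cm_C i j) (cm_C j i)) (cm_C i j)) =
    cm_mul (cm_P i) (cm_P j);
  cm_PP : forall i, cm_mul (cm_P i) (cm_P i) = cm_P i;
  cm_PcommP : forall i j, neq i j ->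
    cm_mul (cm_P i) (cm_P j) = cm_mul (cm_P j) (cm_P i);
  cm_PC : forall i j, neq i j ->
    cm_mul (cm_P i) (cm_C i j) = cm_mul (cm_C i j) (cm_P i);
  cm_PcommC : forall i j k, neq i j -> neq k i -> neq k j ->
    cm_mul (cm_P k) (cm_C i j) = cm_mul (cm_C i j) (cm_P k);
  cm_PPCC : forall i j k, neq i j -> neq j k -> neq i k ->
    cm_mul (cm_mul (cm_mul (cm_P i) (cm_P j)) (cm_C i j)) (cm_C j k) =
    cm_mul (cm_mul (cm_P i) (cm_P j)) (cm_C i j);
  cm_CCPP : forall i j k, neq i j -> neq j k -> neq i k ->
    cm_mul (cm_C j k) (cm_mul (cm_C i j) (cm_mul (cm_P i) (cm_P j))) =
    cm_mul (cm_C i j) (cm_mul (cm_P i) (cm_P j));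
  cm_PPCPP : forall i j k, neq i j -> neq j k -> neq i k ->
    cm_mul (cm_mul (cm_mul (cm_mul (cm_P i) (cm_P j)) (cm_C i j))
      (cm_mul (cm_P i) (cm_P j))) (cm_P k) =
    cm_mul (cm_mul (cm_mul (cm_P i) (cm_P j)) (cm_C i j))
      (cm_mul (cm_P i) (cm_P j))
}.

Arguments cm_one {W neq c}.
Arguments cm_C {W neq c}.
Arguments cm_P {W neq c}.
Notation "x * y" := (cm_mul x y) : cm_scope.
Notation "1" := cm_one : cm_scope.

Lemma In_mem (T : eqType) (x : T) (s : seq T) : List.In x s <-> x \in s.
Proof.
elim: s => [|y s IH] //=; rewrite inE; split.
  by move=> [->|/IH ->]; rewrite ?eqxx ?orbT.
by move=> /predU1P [->|/IH ?]; [left|right].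
Qed.

Section Covectors.
Variable W : finType.

Definition covector := W -> bool.
Definition cadd (e f : covector) : covector := fun i => e i (+) f i.
Definition czero : covector := fun=> false.
Definition cdelta (j : W) : covector := fun i => i == j.
Definition pairing (e x : W -> bool) : bool :=
  \big[addb/false]_i (e i && x i).

(* [pull i j e] is the covector [e] composed with the gate adding coordinate i
   to coordinate j. *)
Definition pull (i j : W) (e : covector) : covector :=
  fun k => if k == i then e i (+) e j else e k.
Definition push (i j : W) (x : W -> bool) : W -> bool :=
  fun k => if k == j then x j (+) x i else x k.

Lemma pairingDl e f x : pairing (cadd e f) x = pairing e x (+) pairing f x.
Proof.
by rewrite /pairing -big_split /=; apply: eq_bigr => i _; rewrite andb_addl.
Qed.

Lemma pairingDr e x y : pairing e (cadd x y) = pairing e x (+) pairing e y.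
Proof.
by rewrite /pairing -big_split /=; apply: eq_bigr => i _; rewrite andb_addr.
Qed.

Lemma pairing_delta j x : pairing (cdelta j) x = x j.
Proof.
rewrite /pairing (bigD1 j) //= /cdelta eqxx big1 ?addbF // => i.
by move/negbTE=> ->.
Qed.

Lemma pairing_deltar e j : pairing e (cdelta j) = e j.
Proof.
rewrite -[RHS](pairing_delta j); apply: eq_bigr => i _; exact: andbC.
Qed.

Lemma pull_add i j e :
  pull i j e = cadd e (if e j then cdelta i else czero).
Proof.
apply: functional_extensionality => k; rewrite /pull /cadd.
by case: eqP => [->|/eqP ki]; case: (e j);
  rewrite /cdelta /czero ?eqxx ?addbF // (negbTE ki) addbF.
Qed.

Lemma push_add i j x :
  push i j x = cadd x (if x i then cdelta j else czero).
Proof.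
apply: functional_extensionality => k; rewrite /push /cadd.
by case: eqP => [->|/eqP ki]; case: (x i);
  rewrite /cdelta /czero ?eqxx ?addbF // (negbTE ki) addbF.
Qed.

Lemma pairing0l x : pairing czero x = false.
Proof. by rewrite /pairing big1. Qed.

Lemma pairing0r e : pairing e czero = false.
Proof. by rewrite /pairing big1 // => i _; rewrite andbF. Qed.

Lemma pairing_pull i j e x : pairing (pull i j e) x = pairing e (push i j x).
Proof.
rewrite pull_add push_add pairingDl pairingDr; congr addb.
case ej: (e j); case xi: (x i); rewrite ?pairing0l ?pairing0r //.
- by rewrite pairing_delta pairing_deltar ej xi.
- by rewrite pairing_delta xi.
- by rewrite pairing_deltar ej.
Qed.

Lemma cadd0 e : cadd e czero = e.
Proof. by apply: functional_extensionality => k; rewrite /cadd addbF. Qed.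

Lemma caddK e f : cadd (cadd e f) f = e.
Proof.
by apply: functional_extensionality => k; rewrite /cadd -addbA addbb addbF.
Qed.

Lemma caddC e f : cadd e f = cadd f e.
Proof. by apply: functional_extensionality => k; rewrite /cadd addbC. Qed.

(* Linear duality, by induction on the family: if [f] is needed, pick a point
   where [e] is true; then [e + f] vanishes on the zeros of the other
   members. *)
Lemma span_ind (S : covector -> Prop) (es : seq covector) (e : covector) :
  S czero -> (forall f g, S f -> S g -> S (cadd f g)) ->
  (forall f, List.In f es -> S f) ->
  (forall x, (forall f, List.In f es -> pairing f x = false) ->
     pairing e x = false) ->
  S e.
Proof.
move=> S0 SD; elim: es e => [|f es IH] e Ses van.
  suff -> : e = czero by [].
  by apply: functional_extensionality => k; rewrite -pairing_deltar van.
have Ses' g : List.In g es -> S g by move=> ges; apply: Ses; right.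
have [[x1 [x1es ex1]]|nex] := classic (exists x,
    (forall g, List.In g es -> pairing g x = false) /\ pairing e x = true).
  suff Sef : S (cadd e f).
    by rewrite -(caddK e f); apply: SD => //; apply: Ses; left.
  apply: IH => // x xes; rewrite pairingDl.
  have fx1 : pairing f x1 = true.
    apply/negbNE/negP=> /negbTE fx1.
    suff : pairing e x1 = false by rewrite ex1.
    by apply: van => g [<-|/x1es].
  case fx: (pairing f x).
    have : pairing e (cadd x x1) = false.
      apply: van => g [<-|ges]; rewrite pairingDr ?fx ?fx1 //.
      by rewrite xes ?x1es.
    by rewrite pairingDr ex1; case: (pairing e x).
  by rewrite van // => g [<-|/xes].
apply: IH => // x xes; apply/negbTE/negP=> ex; apply: nex.
by exists x.
Qed.

(** [span_ind] for the coordinate covectors in the support of [e]: where all of them vanish, so does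
    every term of the pairing with [e]. *)
Lemma covector_ind (S : covector -> Prop) (e : covector) :
  S czero -> (forall f g, S f -> S g -> S (cadd f g)) ->
  (forall k, e k -> S (cdelta k)) -> S e.
Proof.
move=> S0 SD Sk.
apply: (span_ind (es := [seq cdelta k | k <- enum W & e k])) => //.
  move=> f /List.in_map_iff [k [<- /(In_mem k)]].
  by rewrite mem_filter => /andP [ek _]; apply: Sk.
move=> x xes; rewrite /pairing big1 // => i _.
case ei: (e i) => //=; rewrite -(pairing_delta i) xes //.
apply/List.in_map_iff; exists i; split=> //.
by apply/(In_mem i); rewrite mem_filter ei mem_enum.
Qed.

End Covectors.

Arguments czero {W}.
Arguments cadd {W}.
Arguments cdelta {W}.

(** * Algebra of controlled additions *)

Section Algebra.
Variables (W : finType) (M : @cnot_monoid W (fun i j => i != j)).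
Local Open Scope cm_scope.
Implicit Types (x y z g : M) (e f : covector W).

Local Notation C := (@cm_C W _ M).
Local Notation P := (@cm_P W _ M).

Let mulA := @cm_mulA W _ M.
Let mul1x := @cm_mul1x W _ M.
Let mulx1 := @cm_mulx1 W _ M.

Definition cm_comm x y := x * y = y * x.

Lemma comm1 x : cm_comm x 1.
Proof. by rewrite /cm_comm mul1x mulx1. Qed.

Lemma commM x y z : cm_comm x y -> cm_comm x z -> cm_comm x (y * z).
Proof. by rewrite /cm_comm => xy xz; rewrite mulA xy -mulA xz mulA. Qed.

Lemma comm_sym x y : cm_comm x y -> cm_comm y x.
Proof. by []. Qed.

Definition mprod (I : eqType) (r : seq I) (F : I -> M) : M :=
  foldr (fun i m => F i * m) 1 r.

Lemma eq_prod (I : eqType) (r : seq I) (F G : I -> M) :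
  {in r, F =1 G} -> mprod r F = mprod r G.
Proof.
elim: r => //= i r IH FG; rewrite FG ?mem_head // IH // => j jr.
by apply: FG; rewrite inE jr orbT.
Qed.

Lemma prod1 (I : eqType) (r : seq I) : mprod r (fun=> 1) = 1.
Proof. by elim: r => //= i r ->; rewrite mul1x. Qed.

Lemma comm_prod x (I : eqType) (r : seq I) (F : I -> M) :
  (forall i, i \in r -> cm_comm x (F i)) -> cm_comm x (mprod r F).
Proof.
elim: r => [|i r IH] xF /=; first exact: comm1.
apply: commM; first by apply: xF; rewrite mem_head.
by apply: IH => j jr; apply: xF; rewrite inE jr orbT.
Qed.

Lemma prod_split (I : eqType) (r : seq I) (F G : I -> M) :
  (forall i j, i \in r -> j \in r -> cm_comm (G i) (F j)) ->
  mprod r (fun i => F i * G i) = mprod r F * mprod r G.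
Proof.
elim: r => [|i r IH] FG /=; first by rewrite mul1x.
rewrite IH; last first.
  by move=> j k jr kr; apply: FG; rewrite inE ?jr ?kr orbT.
have : cm_comm (G i) (mprod r F).
  by apply: comm_prod => j jr; apply: FG; rewrite inE ?eqxx ?jr ?orbT.
by move=> GF; rewrite -!mulA; congr (_ * _); rewrite !mulA GF.
Qed.

Lemma prod_conj g (I : eqType) (r : seq I) (F : I -> M) : g * g = 1 ->
  g * mprod r F * g = mprod r (fun i => g * F i * g).
Proof.
move=> gg; elim: r => [|i r IH] /=; first by rewrite mulx1.
by rewrite -IH -!mulA (mulA g g) gg mul1x.
Qed.

Lemma prod_delta (I : eqType) (r : seq I) (j : I) x : uniq r -> j \in r ->
  mprod r (fun i => if i == j then x else 1) = x.
Proof.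
elim: r => //= i r IH /andP [ir ur]; rewrite inE => /orP [/eqP ->|jr].
  rewrite eqxx (eq_prod (G := fun=> 1)) ?prod1 ?mulx1 // => k kr /=.
  by case: (eqVneq k i) => // ki; rewrite -ki kr in ir.
rewrite IH //; case: (eqVneq i j) => [ij|]; first by rewrite ij jr in ir.
by rewrite mul1x.
Qed.

Lemma prod_pick (I : eqType) (r : seq I) (F : I -> M) j :
  j \in r -> {in r &, forall i k, cm_comm (F i) (F k)} ->
  mprod r F = F j * mprod (rem j r) F.
Proof.
move=> jr FF; elim: r jr FF => //= i r IH; rewrite inE.
case: (eqVneq i j) => [-> //|ij /= jr FF].
rewrite IH // => [|k l kr lr]; last by apply: FF; rewrite inE ?kr ?lr orbT.
by rewrite !mulA FF // !inE ?jr ?eqxx ?orbT.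
Qed.

Lemma prod_shift (I : eqType) (r : seq I) (F G : I -> M) g :
  (forall i, F i * g = g * G i) -> mprod r F * g = g * mprod r G.
Proof.
move=> FG; elim: r => [|i r IH] /=; first by rewrite mul1x mulx1.
by rewrite -mulA IH !mulA FG.
Qed.

Lemma prod_absorb (I : eqType) (r : seq I) (F : I -> M) x :
  (forall i, i \in r -> x * F i = x) -> x * mprod r F = x.
Proof.
elim: r => [|i r IH] xF /=; first by rewrite mulx1.
rewrite mulA xF ?mem_head // IH // => j jr.
by apply: xF; rewrite inE jr orbT.
Qed.

Lemma CK i j x : i != j -> x * C i j * C i j = x.
Proof. by move=> ij; rewrite -mulA cm_CC // mulx1. Qed.

(** Like [cm_CCC], this says that the commutator of [C i j] and [C j k] is [C i k], now read as a
    conjugation by the second gate. *)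
Lemma CCC' i j k : i != j -> j != k -> i != k ->
  C j k * C i j * C j k = C i j * C i k.
Proof.
move=> ij jk ik.
rewrite -[C j k * C i j * C j k](CK _ ij) -!mulA (mulA (C i j)) (mulA _ (C i j)).
rewrite cm_CCC // !mulA cm_CC // mul1x cm_CcommC //; by rewrite eq_sym.
Qed.

Lemma PcommC i j k : i != j -> k != j -> cm_comm (P k) (C i j).
Proof.
move=> ij kj; case: (eqVneq k i) => [->|ki]; first exact: cm_PC.
exact: cm_PcommC.
Qed.

Lemma PcommP i j : cm_comm (P i) (P j).
Proof. by case: (eqVneq i j) => [->|ij] //; apply: cm_PcommP. Qed.

(* x_k += e(x); meaningful when [e k = false]. *)
Definition cov_gate k e := mprod (enum W) (fun i => if e i then C i k else 1).
Local Notation T := cov_gate.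

Lemma neq_supp e i k : e i -> e k = false -> i != k.
Proof. by move=> ei ek; apply/eqP => ik; rewrite ik ek in ei. Qed.

Lemma comm_T x k e : (forall i, e i -> cm_comm x (C i k)) -> cm_comm x (T k e).
Proof.
move=> xe; apply: comm_prod => i _; case ei: (e i); last exact: comm1.
exact: xe.
Qed.

Lemma T0 k : T k czero = 1.
Proof. exact: prod1. Qed.

Lemma T_delta k j : T k (cdelta j) = C j k.
Proof.
rewrite /T (eq_prod (G := fun i => if i == j then C j k else 1)).
  by rewrite prod_delta ?enum_uniq ?mem_enum.
by move=> i _; rewrite /cdelta; case: eqP => // ->.
Qed.

(** As [k] controls no factor, all gates into [k] commute, and a control common to [e] and [f]
    occurs twice and cancels. *)
Lemma TD k e f : e k = false -> f k = false -> T k e * T k f = T k (cadd e f).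
Proof.
move=> ek fk; rewrite /T -prod_split; last first.
  move=> i j _ _; case fi: (f i); case ej: (e j); rewrite /cm_comm ?mulx1 ?mul1x //.
  have := neq_supp fi fk; have := neq_supp ej ek => jk ik.
  by apply: cm_CcommC => //; rewrite eq_sym.
apply: eq_prod => i _; rewrite /cadd.
case ei: (e i); case fi: (f i); rewrite /= ?mulx1 ?mul1x //.
by rewrite cm_CC // (neq_supp ei).
Qed.

Lemma TT k e : e k = false -> T k e * T k e = 1.
Proof.
move=> ek; rewrite TD // -(T0 k); congr T; apply: functional_extensionality => i.
by rewrite /cadd addbb.
Qed.

Lemma CcommT i j k e : i != j -> i != k -> e j = false -> e k = false ->
  cm_comm (C i j) (T k e).
Proof.
move=> ij ik ej ek; apply: comm_T => l el.
apply: cm_CcommC => //; first exact: neq_supp el ek.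
by rewrite eq_sym; apply: neq_supp el ej.
Qed.

Lemma TcommT k l e f : e k = false -> e l = false -> f k = false ->
  f l = false -> cm_comm (T k e) (T l f).
Proof.
move=> ek el fk fl; apply: comm_T => i fi; apply: comm_sym; apply: CcommT => //.
  exact: neq_supp fi fl.
exact: neq_supp fi fk.
Qed.

(** Conjugation by [C i j] fixes every factor [C l k] except the one with [l = j], which by [cm_CCC]
    yields an additional [C i k]: the change that [pull] makes at coordinate [i]. *)
Lemma T_pull i j k e : i != j -> i != k -> j != k -> e k = false ->
  C i j * T k e * C i j = T k (pull i j e).
Proof.
move=> ij ik jk ek; rewrite pull_add -TD //; last first.
  by case: (e j) => //=; rewrite /cdelta eq_sym; apply/negbTE.
have -> : T k (if e j then cdelta i else czero) = if e j then C i k else 1.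
  by case: (e j); rewrite ?T_delta ?T0.
rewrite /T prod_conj ?cm_CC //.
rewrite (eq_prod (G := fun l => (if e l then C l k else 1) *
    (if l == j then if e j then C i k else 1 else 1))).
  rewrite prod_split ?prod_delta ?enum_uniq ?mem_enum // => l m _ _.
  case: eqP => _; last exact/comm_sym/comm1.
  case: (e j); last exact/comm_sym/comm1.
  case em: (e m); last exact: comm1.
  have mk := neq_supp em ek.
  by apply: cm_CcommC => //; rewrite eq_sym.
move=> l _; case el: (e l); last first.
  rewrite mulx1 mul1x cm_CC //; case: eqP => // lj.
  by rewrite -lj el.
have lk := neq_supp el ek.
case: (eqVneq l j) => [lj|lj]; first by subst l; rewrite el cm_CCC.
rewrite mulx1 cm_CcommC ?CK //; by rewrite eq_sym.
Qed.

(** What is added to wire [k] between two gates from [k] to [l] also reaches [l]. So [T l e] is a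
    commutator of [T k e]; every transfer of an equation from one wire to another rests on this. *)
Lemma T_spread k l e : k != l -> e k = false -> e l = false ->
  C k l * T k e * C k l = T k e * T l e.
Proof.
move=> kl ek el; rewrite /T prod_conj ?cm_CC // -prod_split.
  apply: eq_prod => i _; case ei: (e i); last by rewrite !mulx1 cm_CC.
  by rewrite CCC' //; apply: neq_supp ei _.
move=> i j _ _; case ei: (e i); last exact/comm_sym/comm1.
case ej: (e j); last exact/comm1.
have := neq_supp ei el; have := neq_supp ej ek; have := neq_supp ej el.
have := neq_supp ei ek => ik jl jk il.
by apply: cm_CcommC => //; rewrite eq_sym.
Qed.

(** * Wires in state 0 and tests of affine equations *)

Variable o : W.

(* Wire [o] carries the constant 1, and [Z c] projects on [x_c = 0]. *)
Definition zero_proj c := locked (P o * C o c * P c * C o c).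
Local Notation Z := zero_proj.

Lemma Zdef c : Z c = P o * C o c * P c * C o c.
Proof. by rewrite /Z -lock. Qed.

Lemma ZE c : c != o -> Z c = C o c * (P o * P c) * C o c.
Proof. by move=> co; rewrite Zdef (cm_PC M) // 1?eq_sym // !mulA. Qed.

Lemma ZcommC c i j : c != o -> i != j -> i != c -> j != c -> j != o ->
  cm_comm (Z c) (C i j).
Proof.
move=> co ij ic jc jo; apply: comm_sym.
have comC : cm_comm (C i j) (C o c) by apply: cm_CcommC; rewrite // eq_sym.
have comP k : k != j -> cm_comm (C i j) (P k).
  by move=> kj; apply: comm_sym; apply: PcommC.
by rewrite Zdef; do ![apply: commM => //]; apply: comP; rewrite eq_sym.
Qed.

Lemma ZcommP c k : k != c -> c != o -> cm_comm (Z c) (P k).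
Proof.
move=> kc co; apply: comm_sym.
have comC : cm_comm (P k) (C o c) by apply: PcommC; rewrite // eq_sym.
by rewrite Zdef; do ![apply: commM => //]; exact: PcommP.
Qed.

Lemma ZP c : c != o -> Z c * P o = Z c.
Proof.
move=> co; rewrite (ZcommP _ co) // 1?eq_sym //.
by rewrite Zdef !mulA cm_PP.
Qed.

Lemma ZZ c : c != o -> Z c * Z c = Z c.
Proof.
move=> co; rewrite {2}Zdef !mulA ZP // Zdef CK // 1?eq_sym //.
by rewrite -(mulA _ (P c) (P c)) cm_PP.
Qed.

Lemma ZcommZ c d : c != o -> d != o -> cm_comm (Z c) (Z d).
Proof.
move=> co do_; case: (eqVneq c d) => [-> //|cd].
have comC : cm_comm (Z c) (C o d) by apply: ZcommC; rewrite // eq_sym.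
by rewrite (Zdef d); do ![apply: commM => //]; apply: ZcommP; rewrite // eq_sym.
Qed.

(** A control known to be 0 does nothing. Written with the flip [C o c], this is [cm_PPCC], the form
    that (CNT.7) takes in the monoid; [C_Z] is its mirror image. *)
Lemma Z_C c k : c != o -> k != c -> k != o -> Z c * C c k = Z c.
Proof.
by move=> co kc ko; rewrite ZE // -!(mulA (C o c)) cm_PPCC // eq_sym.
Qed.

Lemma C_Z c k : c != o -> k != c -> k != o -> C c k * Z c = Z c.
Proof.
by move=> co kc ko; rewrite ZE // (mulA (C c k)) cm_CCPP // eq_sym.
Qed.

Lemma ZcommT c k e : c != o -> k != c -> k != o -> e c = false ->
  e k = false -> cm_comm (Z c) (T k e).
Proof.
move=> co kc ko ec ek; apply: comm_T => i ei; apply: ZcommC => //.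
  exact: neq_supp ei ek.
exact: neq_supp ei ec.
Qed.

(** In diagrammatic order this constrains the output of [x]: wire [c] leaves it in state 0. *)
Definition is_zero x c := x * Z c = x.
Local Notation zero := is_zero.

Lemma zeroM x g c : zero x c -> cm_comm (Z c) g -> zero (x * g) c.
Proof. by rewrite /zero => xc cg; rewrite -mulA -cg mulA xc. Qed.

Lemma zero_P x c : c != o -> zero x c -> x * P o = x.
Proof. by move=> co xc; rewrite -xc -mulA ZP. Qed.

Lemma zero_C x c k : c != o -> k != c -> k != o -> zero x c -> x * C c k = x.
Proof. by move=> co kc ko xc; rewrite -{1}xc -mulA Z_C. Qed.

(** Both controls carry 1, so [k] is flipped twice. Formally, the two gates form the conjugate of
    [C j k] by [C o j], and [cm_PPCC] removes its middle. *)
Lemma PPCC2 j k : j != o -> k != o -> j != k ->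
  P o * P j * (C j k * C o k) = P o * P j.
Proof.
move=> jo ko jk; rewrite -(@cm_CCC W _ M) // 1?eq_sym // !mulA.
by rewrite cm_PPCC ?CK // eq_sym.
Qed.

(** With [b] in state 0, this is the equation e = 0 on the output of [x]: adding the value of [e] to
    [b] changes nothing. It is additive in [e], by [satD]. *)
Definition satisfies b x e := x * T b e = x.
Local Notation sat := satisfies.

Lemma sat0 b x : sat b x czero.
Proof. by rewrite /sat T0 mulx1. Qed.

Lemma satD b x e f : e b = false -> f b = false ->
  sat b x e -> sat b x f -> sat b x (cadd e f).
Proof. by move=> eb fb xe xf; rewrite /sat -TD // mulA xe. Qed.

(* [T k e] is the commutator of [T b e] with the gate from b to k. *)
Lemma sat_T b k x e : b != o -> zero x b -> k != b -> k != o ->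
  e b = false -> e k = false -> sat b x e -> x * T k e = x.
Proof.
move=> bo xb kb ko eb ek xe.
rewrite -{1}xe -mulA -T_spread // 1?eq_sym // !mulA (zero_C bo kb ko xb) xe.
exact: zero_C.
Qed.

(** The projection on e = 0: compute the value of [e] on a wire in state 0 and require that the wire
    still be 0. *)
Definition eqn_proj c e := locked (Z c * T c e * Z c).
Local Notation E := eqn_proj.

Lemma Edef c e : E c e = Z c * T c e * Z c.
Proof. by rewrite /E -lock. Qed.

(** By [T_spread], appending [T k e] amounts to conjugating [T c e] by [C c k], and the projections
    [Z c] at both ends absorb the two copies of [C c k]. *)
Lemma E_T c k e : c != o -> k != c -> k != o -> e c = false -> e k = false ->
  E c e * T k e = E c e.
Proof.
move=> co kc ko ec ek.
rewrite !Edef -mulA (ZcommT co kc ko ec ek) mulA -(mulA (Z c)).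
rewrite -T_spread // 1?eq_sym // !mulA.
by rewrite Z_C // -(mulA _ (C c k) (Z c)) C_Z.
Qed.

Lemma EcommT c k e f : c != o -> k != c -> k != o -> e c = false ->
  e k = false -> f c = false -> f k = false -> cm_comm (E c e) (T k f).
Proof.
move=> co kc ko ec ek fc fk; apply: comm_sym.
have ZT : cm_comm (T k f) (Z c) by apply: comm_sym; apply: ZcommT.
by rewrite Edef; do ![apply: commM => //]; apply: TcommT.
Qed.

Lemma EcommZ c d e : c != o -> d != o -> c != d -> e c = false ->
  e d = false -> cm_comm (E c e) (Z d).
Proof.
move=> co do_ cd ec ed; apply: comm_sym.
rewrite Edef.
by do ![apply: commM]; first [exact: ZcommZ | apply: ZcommT; rewrite // eq_sym].
Qed.

Lemma EcommE c d e f : c != o -> d != o -> c != d ->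
  e c = false -> e d = false -> f c = false -> f d = false ->
  cm_comm (E c e) (E d f).
Proof.
move=> co do_ cd ec ed fc fd.
rewrite (Edef d).
by do ![apply: commM]; first [exact: EcommZ | apply: EcommT; rewrite // eq_sym].
Qed.

Lemma zero_E c e x : c != o -> zero x c -> x * T c e = x -> x * E c e = x.
Proof. by move=> co xc xT; rewrite !Edef !mulA xc xT. Qed.

Lemma E_pull c i j e : c != o -> i != j -> i != c -> j != c -> j != o ->
  e c = false -> C i j * E c e * C i j = E c (pull i j e).
Proof.
move=> co ij ic jc jo ec; rewrite !Edef.
have ZC := ZcommC co ij ic jc jo.
by rewrite -T_pull // !mulA ZC -!mulA ZC.
Qed.

(** The three alternating gates exchange [a] and [i]. That they also exchange the gates into these
    wires follows from commutators alone: on its way to the left [C o a] creates copies of itself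
    and of [C o i], which cancel down to [C o i]. *)
Lemma swap_C a i : a != o -> i != o -> i != a ->
  (C a i * C i a * C a i) * C o a = C o i * (C a i * C i a * C a i).
Proof.
move=> ao io ia; have ai : a != i by rewrite eq_sym.
have oa : o != a by rewrite eq_sym.
have oi : o != i by rewrite eq_sym.
have e1 : C a i * C o a = C o a * C o i * C a i by rewrite -CCC' // CK.
have e2 : C i a * C o i = C o i * C o a * C i a by rewrite -CCC' // CK.
have e3 : C i a * C o a = C o a * C i a by apply: cm_CcommC.
have e4 : C a i * C o i = C o i * C a i by apply: cm_CcommC.
have e5 : C o a * C o i = C o i * C o a by apply: cm_CcommC.
rewrite -!mulA e1 -!mulA (mulA (C i a)) e3 -mulA (mulA (C i a)) e2 -!mulA.
rewrite (mulA (C o a)) e5 -mulA (mulA (C o a) (C o a)) cm_CC // mul1x.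
by rewrite mulA e4 -mulA.
Qed.

(* Setting wire a to 1, adding x_i + 1 to it and testing it for 1 amounts to
   testing x_i. *)
Lemma P_T_P a i : a != o -> i != o -> i != a ->
  P o * P a * (C i a * C o a * (P o * P a)) = P o * P a * P i.
Proof.
move=> ao io ia; have ai : a != i by rewrite eq_sym.
have oa : o != a by rewrite eq_sym.
have oi : o != i by rewrite eq_sym.
set S := C a i * C i a * C a i.
have CS : C i a = C a i * S * C a i.
  by rewrite /S !mulA cm_CC // mul1x CK.
have SP : S * P a = P i * S by rewrite /S -cm_SC // cm_PS.
have PPS : P a * P i * S = P a * P i by rewrite cm_PPS.
have -> : C i a * C o a * (P o * P a) = C a i * C o i * (P i * S * P o).
  rewrite {1}CS -(mulA (C a i * S)) -(mulA (C a i * S)) -(mulA (C a i)).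
  rewrite -(mulA (C a i) (C o a)) cm_CCPP // (mulA S) swap_C // -/S -SP.
  by rewrite (PcommP o a) !mulA.
rewrite mulA PPCC2 // -(mulA (P o)) (mulA (P a)) (mulA (P a)) PPS.
by rewrite -(mulA (P a)) (PcommP i o) (mulA (P a)) (PcommP a o) !mulA cm_PP.
Qed.

(** Turns a projection letter into the test of the affine equation x_i + 1 = 0, the constant being
    read from wire [o]. *)
Lemma zero_PE x a i : a != o -> i != o -> i != a -> zero x a ->
  x * P i = x * E a (cadd (cdelta i) (cdelta o)).
Proof.
move=> ao io ia xa; have oa : o != a by rewrite eq_sym.
have ai : a != i by rewrite eq_sym.
rewrite -xa -!mulA; congr (_ * _).
have CP : C o a * P i = P i * C o a by apply: comm_sym; apply: PcommC.
have CC : C o a * C i a = C i a * C o a by apply: cm_CcommC.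
have di : cdelta i a = false by rewrite /cdelta eq_sym; apply/negbTE.
have do_ : cdelta o a = false by rewrite /cdelta; apply/negbTE.
rewrite Edef -TD // !T_delta !mulA ZZ // ZE // -(mulA _ (C o a) (P i)) CP.
rewrite -(mulA _ (C o a) (C i a)) CC !mulA CK // -!(mulA (C o a)).
by rewrite -(P_T_P ao io ia) !mulA.
Qed.

(* The inconsistent case, the only one that uses (CNT.9). *)
Lemma absurd_P x b k : b != o -> k != o -> k != b -> zero x b ->
  x * C o b = x -> x * P k = x.
Proof.
move=> bo ko kb xb xC; have ob : o != b by rewrite eq_sym.
have <- : x * (Z b * C o b * Z b) = x by rewrite !mulA xb xC xb.
have CP : C o b * P k = P k * C o b by apply: comm_sym; apply: PcommC.
have -> : Z b * C o b * Z b =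
    C o b * (P o * P b * C o b * (P o * P b)) * C o b.
  by rewrite ZE // !mulA CK.
rewrite -mulA -(mulA (C o b * _)) CP (mulA _ (P k)) -(mulA (C o b)).
by rewrite cm_PPCPP // eq_sym.
Qed.

(** Under 1 = 0, wire [i] may be taken to carry 1 by [absurd_P]. Then [C i j] acts like [C o j],
    which is absorbed because 1 = 0 can be transferred to [j]. *)
Lemma absurd_C x b i j : b != o -> zero x b -> x * C o b = x ->
  i != o -> i != b -> j != o -> i != j -> x * C i j = x.
Proof.
move=> bo xb xC io ib jo ij; have ob : o != b by rewrite eq_sym.
have xP := absurd_P bo io ib xb xC.
have oj : o != j by rewrite eq_sym.
have xCo : x * C o j = x.
  case: (eqVneq j b) => [-> //|jb].
  have := @sat_T b j x (cdelta o) bo xb jb jo; rewrite /sat !T_delta; apply=> //.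
  - by rewrite /cdelta; apply/negbTE.
  - by rewrite /cdelta; apply/negbTE.
have xPP : x * (P o * P i) = x by rewrite mulA (zero_P bo xb).
rewrite -{1}xPP -[C i j](CK _ oj) -mulA (mulA (P o * P i)).
by rewrite PPCC2 // mulA xPP.
Qed.

End Algebra.

(** * Completeness for words in the gates and projections *)

Inductive letter n := LC (i j : 'I_n) | LP (i : 'I_n).

Definition letter_wf n (l : letter n) : bool :=
  if l is LC i j then i != j else true.

Definition step n (l : letter n) (p : 'I_n -> bool) : option ('I_n -> bool) :=
  match l with
  | LC i j => Some (push i j p)
  | LP i => if p i then Some p else None
  end.

Fixpoint run n (w : seq (letter n)) (p : 'I_n -> bool) :
    option ('I_n -> bool) :=
  if w is l :: w' then obind (run w') (step l p) else Some p.

Lemma run_rcons n (w : seq (letter n)) l p :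
  run (rcons w l) p = obind (step l) (run w p).
Proof.
elim: w p => [|l' w IH] p /=; first by case: (step l p).
by case: (step l' p) => //= q.
Qed.

Section Words.
Variable n : nat.
Local Notation W := (option (option (option ('I_n + 'I_n)))).
Variable M : @cnot_monoid W (fun i j => i != j).
Local Open Scope cm_scope.
Implicit Types (x : M) (e f : covector W) (h : seq ('I_n * 'I_n)).

Local Notation C := (@cm_C W _ M).
Local Notation P := (@cm_P W _ M).
Let mulA := @cm_mulA W _ M.
Let mul1x := @cm_mul1x W _ M.
Let mulx1 := @cm_mulx1 W _ M.

(** The constant 1, the spare wire for tests, the spare wire on which satisfied equations are read,
    the register, and the wires for its copy. *)
Definition w0 : W := None.
Definition wa : W := Some None.
Definition wb : W := Some (Some None).
Definition wx (i : 'I_n) : W := Some (Some (Some (inl i))).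
Definition wy (i : 'I_n) : W := Some (Some (Some (inr i))).

Local Notation Z := (@zero_proj _ M w0).
Local Notation E := (@eqn_proj _ M w0).
Local Notation T := (@cov_gate _ M).
Local Notation zero := (@is_zero _ M w0).
Local Notation sat := (@satisfies _ M wb).

Definition letter_ev (l : letter n) : M :=
  match l with LC i j => C (wx i) (wx j) | LP i => P (wx i) end.
Definition ev (w : seq (letter n)) : M :=
  foldr (fun l m => letter_ev l * m) 1 w.

Lemma ev_rcons w l : ev (rcons w l) = ev w * letter_ev l.
Proof.
elim: w => [|l' w IH] /=; first by rewrite mulx1 mul1x.
by rewrite IH mulA.
Qed.

Definition evC h : M := foldr (fun c m => C (wx c.1) (wx c.2) * m) 1 h.
Definition pullh h e : covector W :=
  foldr (fun c e => pull (wx c.1) (wx c.2) e) e h.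
Definition runC h (p : 'I_n -> bool) : 'I_n -> bool :=
  foldl (fun p c => push c.1 c.2 p) p h.
Definition wfC h := all (fun c => c.1 != c.2) h.

Lemma evC_cat h h' : evC (h ++ h') = evC h * evC h'.
Proof. by elim: h => [|c h IH] /=; rewrite ?mul1x // IH mulA. Qed.

Lemma wx_neq i j : i != j -> wx i != wx j.
Proof. by []. Qed.

Lemma wfC_rev h : wfC (rev h) = wfC h.
Proof. by rewrite /wfC all_rev. Qed.

Lemma evC_rev h : wfC h -> evC h * evC (rev h) = 1.
Proof.
elim: h => [|c h IH] /=; first by rewrite mulx1.
case/andP=> cc hh; rewrite rev_cons -cats1 evC_cat /= mulx1.
by rewrite -mulA (mulA (evC h)) IH // mul1x cm_CC.
Qed.

Lemma evC_revl h : wfC h -> evC (rev h) * evC h = 1.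
Proof. by move=> hh; rewrite -{2}(revK h) evC_rev // wfC_rev. Qed.

(** * Systems of equations and the normal form of words *)

Definition anc : seq W := [:: wa, wb & [seq wy i | i <- enum 'I_n]].
Definition anc_proj : M := locked (mprod anc Z).
Local Notation K := anc_proj.

Lemma Kdef : K = mprod anc Z.
Proof. by rewrite /K -lock. Qed.

(* Covectors in the coordinates x and the constant coordinate only. *)
Definition isX e := forall c, c \in anc -> e c = false.

Lemma anc_wy i : wy i \in anc.
Proof. by rewrite !inE map_f ?orbT // mem_enum. Qed.

Lemma anc_wa : wa \in anc. Proof. by rewrite !inE. Qed.
Lemma anc_wb : wb \in anc. Proof. by rewrite !inE. Qed.

Lemma anc_w0 c : c \in anc -> c != w0.
Proof. by rewrite !inE => /or3P [/eqP ->|/eqP ->|/mapP [i _ ->]]. Qed.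

Lemma anc_wx c i : c \in anc -> c != wx i.
Proof. by rewrite !inE => /or3P [/eqP ->|/eqP ->|/mapP [j _ ->]]. Qed.

Definition ready x := forall c, c \in anc -> zero x c.

Lemma ready_K x : ready x -> x * K = x.
Proof. by move=> xr; rewrite Kdef; apply: prod_absorb => c; apply: xr. Qed.

Lemma K_ready : ready K.
Proof.
move=> c ca; have ZZa : {in anc &, forall i k, cm_comm (Z i) (Z k)}.
  by move=> i k ia ka; apply: ZcommZ; apply: anc_w0.
have ZK : cm_comm (Z c) K by rewrite Kdef; apply: comm_prod => i ia; apply: ZZa.
by rewrite /is_zero -ZK Kdef (prod_pick ca ZZa) mulA ZZ // anc_w0.
Qed.

Lemma readyM x (g : M) : ready x -> (forall c, c \in anc -> cm_comm (Z c) g) ->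
  ready (x * g).
Proof. by move=> xr xg c ca; apply: zeroM; [apply: xr | apply: xg]. Qed.

Lemma ZcommCx c i j : c \in anc -> i != j -> cm_comm (Z c) (C (wx i) (wx j)).
Proof.
move=> ca ij; have cx k : wx k != c by rewrite eq_sym; apply: anc_wx.
by apply: ZcommC => //; apply: anc_w0.
Qed.

Lemma ZcommEvC c h : c \in anc -> wfC h -> cm_comm (Z c) (evC h).
Proof.
move=> ca; elim: h => [|d h IH] /=; first by move=> _; exact: comm1.
by case/andP=> dd hh; apply: commM; [apply: ZcommCx | apply: IH].
Qed.

Lemma ZcommE c d e : c \in anc -> d \in anc -> isX e -> cm_comm (Z c) (E d e).
Proof.
move=> ca da eX; case: (eqVneq c d) => [->|cd].
  by rewrite /cm_comm Edef -!mulA ZZ ?anc_w0 // !mulA ZZ ?anc_w0.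
by apply/comm_sym; apply: EcommZ; rewrite ?anc_w0 ?eX // eq_sym.
Qed.

Lemma KcommE d e : d \in anc -> isX e -> cm_comm K (E d e).
Proof.
move=> da eX; apply/comm_sym; rewrite Kdef; apply: comm_prod => c ca.
by apply/comm_sym; apply: ZcommE.
Qed.

Definition eqn_anc_proj e : M := K * E wa e.
Local Notation F := eqn_anc_proj.

Lemma KK : K * K = K.
Proof. exact: ready_K K_ready. Qed.

(** A test on one zero wire absorbs the same test on another, so both sides equal the product of the
    two tests. The freedom to choose the wire is what makes tests commute in [FcommF], where two
    different equations are put on different wires. *)
Lemma FE e : isX e -> F e = K * E wb e.
Proof.
move=> eX.
have half c d : c \in anc -> d \in anc -> c != d ->
    K * E c e * E d e = K * E c e.
  move=> ca da cd; apply: zero_E; rewrite ?anc_w0 //.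
    by apply: zeroM; [apply: K_ready | apply: ZcommE].
  by rewrite -mulA E_T ?anc_w0 ?eX // eq_sym.
have EE : cm_comm (E wa e) (E wb e).
  by apply: EcommE; rewrite ?eX ?anc_wa ?anc_wb.
rewrite /F -(half wa wb anc_wa anc_wb isT) -(half wb wa anc_wb anc_wa isT).
by rewrite -!mulA EE.
Qed.

Lemma FcommF e f : isX e -> isX f -> cm_comm (F e) (F f).
Proof.
move=> eX fX.
have EE : cm_comm (E wa e) (E wb f).
  by apply: EcommE; rewrite ?eX ?fX ?anc_wa ?anc_wb.
have FF c d e1 e2 : c \in anc -> d \in anc -> isX e1 -> isX e2 ->
    K * E c e1 * (K * E d e2) = K * (E c e1 * E d e2).
  move=> ca da e1X e2X.
  by rewrite mulA -(mulA K) -KcommE // mulA KK mulA.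
rewrite /cm_comm (FE fX) /F !FF ?anc_wa ?anc_wb // EE.
by [].
Qed.

Definition prodF es : M := foldr (fun e m => F e * m) 1 es.
Definition allX es := forall e, List.In e es -> isX e.

Lemma allX_cons e es : allX (e :: es) -> isX e /\ allX es.
Proof. by move=> a; split=> [|f fes]; apply: a; [left|right]. Qed.

Lemma prodF_rcons es e : prodF (rcons es e) = prodF es * F e.
Proof.
elim: es => [|f es IH] /=; first by rewrite mulx1 mul1x.
by rewrite IH mulA.
Qed.

Lemma comm_prodF x es : (forall e, List.In e es -> cm_comm x (F e)) ->
  cm_comm x (prodF es).
Proof.
elim: es => [|e es IH] xF /=; first exact: comm1.
by apply: commM; [apply: xF; left | apply: IH => f fes; apply: xF; right].
Qed.

Lemma ZcommF c e : c \in anc -> isX e -> cm_comm (Z c) (F e).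
Proof.
move=> ca eX; apply: commM; last by apply: ZcommE; rewrite ?anc_wa.
by rewrite Kdef; apply: comm_prod => d da; apply: ZcommZ; apply: anc_w0.
Qed.

Definition eqns_proj es := K * prodF es.
Local Notation Q := eqns_proj.

Lemma Q_ready es : allX es -> ready (Q es).
Proof.
move=> esX; apply: readyM; first exact: K_ready.
by move=> c ca; apply: comm_prodF => e ees; apply: ZcommF => //; apply: esX.
Qed.

Lemma QcommQ es es' : allX es -> allX es' -> cm_comm (Q es) (Q es').
Proof.
move=> esX esX'.
have KF fs : allX fs -> cm_comm K (prodF fs).
  move=> fsX; apply: comm_prodF => e ees; apply: commM => //.
  by apply: KcommE; rewrite ?anc_wa //; apply: fsX.
apply: commM; first by apply/comm_sym/commM => //; apply: KF.
apply/comm_sym/commM; first by apply/comm_sym; apply: KF.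
apply: comm_prodF => e ees; apply/comm_sym; apply: comm_prodF => f fes.
by apply: FcommF; [apply: esX | apply: esX'].
Qed.

Definition prodE es : M := foldr (fun e m => E wa e * m) 1 es.

Lemma QE es : allX es -> Q es = K * prodE es.
Proof.
rewrite /Q; elim: es => [|e es IH] //= /allX_cons [eX esX].
have KE := KcommE anc_wa eX.
have -> : F e = K * E wa e by [].
by rewrite 2!mulA KK KE -!mulA (IH esX) !mulA KE.
Qed.

(** Tests use [wa] and satisfaction uses [wb], so the addition can travel left past the later tests
    up to the test of [e] itself, where [E_T] absorbs it. *)
Lemma sat_Q es e : allX es -> List.In e es -> sat (Q es) e.
Proof.
move=> esX ees; rewrite /satisfies QE // -mulA; congr (_ * _).
have eX := esX _ ees.
elim: es esX ees => [//|f es IH] /allX_cons [fX esX] /= [fe|ees]; last first.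
  by rewrite -mulA IH.
rewrite fe -mulA.
have <- : cm_comm (T wb e) (prodE es).
  elim: es {IH} esX => [|g es IH] /=; first by move=> _; exact: comm1.
  move=> /allX_cons [gX esX]; apply: commM; last exact: IH.
  by apply/comm_sym; apply: EcommT; rewrite ?eX ?gX ?anc_wa ?anc_wb.
by rewrite mulA E_T // eX ?anc_wa ?anc_wb.
Qed.

Lemma ready_sat_T x e k : ready x -> isX e -> sat x e -> k != wb -> k != w0 ->
  e k = false -> x * T k e = x.
Proof.
move=> xr eX xe kb k0 ek; apply: (@sat_T _ M w0 wb) => //.
  by apply: xr; rewrite anc_wb.
by rewrite eX ?anc_wb.
Qed.

Lemma ready_sat_F x e : ready x -> isX e -> sat x e -> x * F e = x.
Proof.
move=> xr eX xe; rewrite mulA ready_K //; apply: zero_E => //.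
  by apply: xr; rewrite anc_wa.
by apply: ready_sat_T; rewrite ?eX ?anc_wa.
Qed.

Lemma Q_mono es es' : allX es -> allX es' ->
  (forall e, List.In e es' -> sat (Q es) e) -> Q es * Q es' = Q es.
Proof.
move=> esX esX' es_sat; rewrite mulA ready_K; last exact: Q_ready.
have := Q_ready esX; move: (Q es) es_sat => x x_sat xr.
elim: es' esX' x_sat => [|e es' IH] /=; first by rewrite mulx1.
move=> /allX_cons [eX esX'] x_sat.
rewrite mulA ready_sat_F ?IH //; first by move=> f fes; apply: x_sat; right.
by apply: x_sat; left.
Qed.

(** By [Q_mono] each projection absorbs the other, and the two commute. *)
Lemma Q_eq es es' : allX es -> allX es' ->
  (forall e, List.In e es' -> sat (Q es) e) ->
  (forall e, List.In e es -> sat (Q es') e) -> Q es = Q es'.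
Proof.
move=> esX esX' s1 s2.
by rewrite -(Q_mono esX esX' s1) QcommQ // (Q_mono esX' esX s2).
Qed.

Lemma isX_pull i j e : isX e -> isX (pull (wx i) (wx j) e).
Proof.
by move=> eX c ca; rewrite /pull (negbTE (anc_wx i ca)) eX.
Qed.

Lemma isX_pullh h e : isX e -> isX (pullh h e).
Proof. by move=> eX; elim: h => //= c h IH; apply: isX_pull. Qed.

Lemma isX_wx i : isX (cdelta (wx i)).
Proof. by move=> c ca; rewrite /cdelta; apply/negbTE/anc_wx. Qed.

Lemma isX_w0 : isX (cdelta w0).
Proof. by move=> c ca; rewrite /cdelta; apply/negbTE/anc_w0. Qed.

Lemma isXD e f : isX e -> isX f -> isX (cadd e f).
Proof. by move=> eX fX c ca; rewrite /cadd eX ?fX. Qed.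

Lemma E_evC h e : wfC h -> isX e -> E wa (pullh h e) * evC h = evC h * E wa e.
Proof.
move=> hh eX; elim: h hh => [|c h IH] /=; first by rewrite mulx1 mul1x.
case/andP=> cc hh; rewrite -mulA -IH // mulA -E_pull //; last first.
  by rewrite isX_pullh ?anc_wa.
by rewrite CK // mulA.
Qed.

Lemma T_evC k h e : wfC h -> (forall i, k != wx i) -> e k = false ->
  T k (pullh h e) * evC h = evC h * T k e.
Proof.
move=> hh kx ek; elim: h hh => [|c h IH] /=; first by rewrite mulx1 mul1x.
case/andP=> cc hh; have xk i : wx i != k by rewrite eq_sym.
rewrite -mulA -IH // mulA -T_pull //; last first.
  by elim: h {IH hh} => //= d h IH; rewrite /pull (negbTE (kx _)).
by rewrite CK // mulA.
Qed.

(** Homogenization: the coordinate 1 at the constant wire turns affine functions of [p] into linear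
    ones. *)
Definition hom (p : 'I_n -> bool) : W -> bool := fun k =>
  match k with
  | None => true
  | Some (Some (Some (inl i))) => p i
  | _ => false
  end.

Lemma hom_push i j p : hom (push i j p) = push (wx i) (wx j) (hom p).
Proof.
by apply: functional_extensionality => -[[[[k|k]|]|]|].
Qed.

Lemma pairing_pullh h e p :
  pairing (pullh h e) (hom p) = pairing e (hom (runC h p)).
Proof.
elim: h p => [|c h IH] p //=.
by rewrite pairing_pull -hom_push IH.
Qed.

Definition kills es p := all (fun e => ~~ pairing e (hom p)) es.

(* The projections are moved to the left through the gates. *)
Lemma word_nf w : all (@letter_wf n) w -> exists es h,
  [/\ allX es, wfC h, K * ev w = Q es * evC h &
   forall p, run w p = if kills es p then Some (runC h p) else None].
Proof.
elim/last_ind: w => [_|w l IH]; first by exists [::], [::]; split=> // e [].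
rewrite all_rcons => /andP [ll /IH [es [h [esX hh e r]]]].
case: l ll => [i j|i] /= ij.
  exists es, (rcons h (i, j)); split=> //.
  - by rewrite /wfC all_rcons ij.
  - by rewrite ev_rcons mulA e -mulA -cats1 evC_cat /= mulx1.
  - move=> p; rewrite run_rcons r; case: kills => //=.
    by rewrite /runC foldl_rcons.
(* The projection comes after the gates [h]. As the equation x_i + 1 = 0 it can be expressed through
   the state before [h] by [pullh], and so joins the tests on the left. *)
pose f := cadd (cdelta (wx i)) (cdelta w0).
have fX : isX f by apply: isXD; [apply: isX_wx | apply: isX_w0].
have phX : isX (pullh h f) by apply: isX_pullh.
exists (rcons es (pullh h f)), h; split=> //.
- move=> f'; rewrite -cats1 => /(@List.in_app_or _ _ _ _).
  by move=> [/esX //|[<- //|[]]].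
- have rx : ready (Q es * evC h).
    by apply: readyM; [apply: Q_ready | move=> c ca; apply: ZcommEvC].
  rewrite ev_rcons mulA e /= (@zero_PE _ M w0 _ wa) //; last first.
    by apply: rx; rewrite anc_wa.
  rewrite -(mulA (Q es)) -E_evC // mulA; congr (_ * _).
  have -> : Q (rcons es (pullh h f)) = Q es * (K * E wa (pullh h f)).
    by rewrite /Q prodF_rcons mulA.
  by rewrite mulA ready_K //; apply: Q_ready.
- move=> p; rewrite run_rcons r /kills all_rcons pairing_pullh /f pairingDl.
  rewrite !pairing_delta /= addbT negbK; case: all; rewrite ?andbF ?andbT //=.
Qed.

(** * Simultaneous additions and maps that fix the domain *)

Definition Tm (t : 'I_n -> W) (H : 'I_n -> covector W) : M :=
  mprod (enum 'I_n) (fun j => T (t j) (H j)).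

(** No target is also a control: all factors of [Tm] commute, and [Tm] is additive in [H] and an
    involution. *)
Definition off (t : 'I_n -> W) (H : 'I_n -> covector W) :=
  forall i j, H i (t j) = false.

Lemma TmD t H H' : off t H -> off t H' ->
  Tm t H * Tm t H' = Tm t (fun j => cadd (H j) (H' j)).
Proof.
move=> tH tH'; rewrite /Tm -prod_split; last by move=> i j _ _; apply: TcommT.
by apply: eq_prod => j _; rewrite TD.
Qed.

Lemma Tm_inv t H : off t H -> Tm t H * Tm t H = 1.
Proof.
move=> tH; rewrite TmD // -(prod1 M (enum 'I_n)); apply: eq_prod => j _ /=.
by rewrite -TD // TT.
Qed.

Lemma Tm_absorb x t H : (forall j, x * T (t j) (H j) = x) -> x * Tm t H = x.
Proof. by move=> xT; apply: prod_absorb. Qed.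

Lemma Tm_pick t H j : off t H ->
  Tm t H = T (t j) (H j) * mprod (rem j (enum 'I_n)) (fun i => T (t i) (H i)).
Proof.
move=> tH; apply: (@prod_pick _ M _ _ _ j); first by rewrite mem_enum.
by move=> i k _ _; apply: TcommT.
Qed.

Definition copy_xy : M := Tm wy (fun j => cdelta (wx j)).
Definition copy_yx : M := Tm wx (fun j => cdelta (wy j)).

Lemma off_xy : off wy (fun j => cdelta (wx j)). Proof. by []. Qed.
Lemma off_yx : off wx (fun j => cdelta (wy j)). Proof. by []. Qed.

(** Reads an equation of the register on its copy. The constant coordinate is dropped, so this is
    meaningful for linear equations supported on the register. *)
Definition ysubst e : covector W := fun k =>
  if k is Some (Some (Some (inr i))) then e (wx i) else false.

Lemma ysubstD e f : ysubst (cadd e f) = cadd (ysubst e) (ysubst f).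
Proof. by apply: functional_extensionality => -[[[[k|k]|]|]|]. Qed.

Lemma ysubst_delta i : ysubst (cdelta (wx i)) = cdelta (wy i).
Proof. by apply: functional_extensionality => -[[[[k|k]|]|]|]. Qed.

Lemma pullhD h e f : pullh h (cadd e f) = cadd (pullh h e) (pullh h f).
Proof.
elim: h => //= c h ->; apply: functional_extensionality => k.
by rewrite /pull /cadd; case: eqP => // _; rewrite addbACA.
Qed.

Lemma ysubst0 : ysubst czero = czero.
Proof. by apply: functional_extensionality => -[[[[i|i]|]|]|]. Qed.

Lemma pullh0 h : pullh h czero = czero.
Proof.
elim: h => //= c h ->; apply: functional_extensionality => k.
by rewrite /pull; case: eqP.
Qed.

Lemma pullh_y h j : pullh h (cdelta (wy j)) = cdelta (wy j).
Proof.
elim: h => //= c h ->; apply: functional_extensionality => k.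
by rewrite /pull; case: eqP => // ->.
Qed.

Lemma pullh_x h j k : (forall i, k != wx i) ->
  pullh h (cdelta (wx j)) k = false.
Proof.
move=> kx; elim: h => [|c h IH] /=; first by rewrite /cdelta; apply/negbTE.
by rewrite /pull (negbTE (kx _)).
Qed.

Lemma pullhK h e : wfC h -> pullh h (pullh (rev h) e) = e.
Proof.
elim: h e => [|c h IH] e //= /andP [cc hh]; rewrite rev_cons -cats1.
rewrite {2}/pullh foldr_cat -/(pullh _ _) IH //=.
apply: functional_extensionality => k; rewrite /pull eqxx.
case: (eqVneq (wx c.2) (wx c.1)) => [c21|_].
  by have := wx_neq cc; rewrite c21 eqxx.
by case: eqP => [->|//]; rewrite addbK.
Qed.

(** A row operation: by [T_spread], what is added to wire [k] between the two gates is also added to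
    wire [l]. *)
Lemma conj_yx k l (H : 'I_n -> covector W) : k != l -> off wx H ->
  C (wx k) (wx l) * Tm wx H * C (wx k) (wx l) =
  Tm wx (fun j => if j == l then cadd (H l) (H k) else H j).
Proof.
move=> kl xH.
have -> : (fun j => if j == l then cadd (H l) (H k) else H j) =
    (fun j => cadd (H j) (if j == l then H k else czero)).
  apply: functional_extensionality => j; case: eqP => [-> //|_].
  by rewrite cadd0.
rewrite -TmD //; last by move=> i j; case: eqP.
have -> : Tm wx (fun j => if j == l then H k else czero) = T (wx l) (H k).
  rewrite -[RHS](@prod_delta _ M _ (enum 'I_n) l) ?enum_uniq ?mem_enum //.
  by apply: eq_prod => j _; case: eqP => [-> //|_]; rewrite T0.
rewrite /Tm prod_conj ?cm_CC //.
rewrite (eq_prod (G := fun j => T (wx j) (H j) *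
    (if j == k then T (wx l) (H k) else 1))); last first.
  move=> j _; case: (eqVneq j k) => [->|jk]; first by rewrite T_spread.
  by rewrite CcommT ?CK ?mulx1 // wx_neq // eq_sym.
rewrite prod_split ?prod_delta ?enum_uniq ?mem_enum // => i j _ _.
case: eqP => _; last exact/comm_sym/comm1.
exact: TcommT.
Qed.

(** By linearity, adding y after [h] and then undoing [h] adds the image of y under the inverse of
    [h]. Each gate of [h] contributes one row operation. *)
Lemma conj_evC_yx h : wfC h ->
  evC h * copy_yx * evC (rev h) =
  Tm wx (fun j => ysubst (pullh (rev h) (cdelta (wx j)))).
Proof.
elim: h => [_|[k l] h IH] /=.
  transitivity copy_yx; first by rewrite mul1x; exact: mulx1.
  by rewrite /copy_yx; congr Tm; apply: functional_extensionality => j;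
    rewrite -ysubst_delta.
case/andP=> /= kl hh; rewrite rev_cons -cats1 evC_cat /= mulx1.
have -> : C (wx k) (wx l) * evC h * copy_yx * (evC (rev h) * C (wx k) (wx l))
    = C (wx k) (wx l) * (evC h * copy_yx * evC (rev h)) * C (wx k) (wx l).
  by rewrite !mulA.
rewrite IH // conj_yx //; congr Tm; apply: functional_extensionality => j.
have -> : pullh (rev h ++ [:: (k, l)]) (cdelta (wx j)) =
    pullh (rev h) (pull (wx k) (wx l) (cdelta (wx j))).
  by rewrite /pullh foldr_cat.
rewrite pull_add pullhD ysubstD /cdelta; case: (eqVneq j l) => [->|jl].
  by rewrite eqxx.
rewrite (_ : wx l == wx j = false); last by apply/negbTE; rewrite eq_sym.
by rewrite pullh0 ysubst0 cadd0.
Qed.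

(* Below, [y] is the state after copying x on the wires y, [z] the one after
   applying h, and [t] the one after resetting x to 0 by means of the copy. *)
Lemma fixing_absorbed x h : ready x -> wfC h ->
  (forall j, sat x (cadd (cdelta (wx j)) (pullh h (cdelta (wx j))))) ->
  (forall j, sat x (cadd (cdelta (wx j)) (pullh (rev h) (cdelta (wx j))))) ->
  x * evC h = x.
Proof.
move=> xr hh sh srh; pose y := x * copy_xy.
have [ya yb] : zero y wa /\ zero y wb.
  by split; (apply: zeroM; first by apply: xr);
    apply: comm_prod => j _; apply: ZcommT.
have y_sat e : isX e -> sat x e -> sat y e.
  move=> eX xe; rewrite /satisfies /y -mulA.
  have -> : copy_xy * T wb e = T wb e * copy_xy.
    apply/comm_sym/comm_prod => j _; apply: TcommT; rewrite ?eX ?anc_wb //.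
    exact: anc_wy.
  by rewrite mulA xe.
have y_xy j : sat y (cadd (cdelta (wx j)) (cdelta (wy j))).
  rewrite /satisfies -TD // !T_delta /y /copy_xy (Tm_pick j off_xy) T_delta.
  set R := mprod _ _.
  have RC : R * (C (wx j) wb * C (wy j) wb) = C (wx j) wb * C (wy j) wb * R.
    apply/comm_sym/comm_prod => i; rewrite mem_rem_uniq ?enum_uniq // T_delta.
    by rewrite inE => /andP [ij _]; apply/comm_sym/commM; apply: cm_CcommC.

  rewrite -!mulA RC (mulA (C (wx j) (wy j))).
  (* Before the copy, the sum x_j + y_j was the old y_j, which is 0; so only a gate controlled by
     y_j remains. *)
  have -> : C (wx j) (wy j) * (C (wx j) wb * C (wy j) wb) =
      C (wy j) wb * C (wx j) (wy j).
    have e1 : C (wx j) (wy j) * C (wx j) wb = C (wx j) wb * C (wx j) (wy j).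
      exact: cm_CcommC.
    have e2 : C (wx j) (wy j) * C (wy j) wb =
        C (wx j) wb * C (wy j) wb * C (wx j) (wy j).
      by rewrite -(@cm_CcommC _ _ M (wy j) wb (wx j) wb) // -cm_CCC // CK.
    by rewrite mulA e1 -mulA e2 !mulA cm_CC // mul1x.
  rewrite !mulA (@zero_C _ M w0 _ (wy j)) //; apply: xr; exact: anc_wy.
pose z := y * evC h.
have zb : zero z wb by apply: zeroM => //; apply: ZcommEvC; rewrite ?anc_wb.
have z_xy j : sat z (cadd (cdelta (wx j)) (cdelta (wy j))).
  rewrite /satisfies /z -mulA -T_evC // pullhD pullh_y mulA.
  (* Read before [h], the equation compares h(x)_j with y_j; it is the sum of the assumption [sh]
     and of x_j = y_j. *)
  have -> : cadd (pullh h (cdelta (wx j))) (cdelta (wy j)) =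
      cadd (cadd (cdelta (wx j)) (pullh h (cdelta (wx j))))
        (cadd (cdelta (wx j)) (cdelta (wy j))).
    apply: functional_extensionality => k; rewrite /cadd.
    by rewrite (addbC (cdelta (wx j) k)) addbA addbK.
  congr (_ * _); apply: satD; rewrite ?y_xy //.
    by rewrite /cadd pullh_x.
  apply: y_sat; last exact: sh.
  by apply: isXD; [|apply: isX_pullh]; apply: isX_wx.
pose t := z * copy_yx.
have tb : zero t wb by apply: zeroM => //; apply: comm_prod => j _; apply: ZcommT.
have t_x j : t * C (wx j) wb = t.
  rewrite /t /copy_yx (Tm_pick j off_yx) T_delta.
  set R := mprod _ _.
  have RC : R * C (wx j) wb = C (wx j) wb * R.
    apply/comm_sym/comm_prod => i; rewrite mem_rem_uniq ?enum_uniq // T_delta.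
    rewrite inE => /andP [ij _]; by apply/comm_sym; apply: cm_CcommC.
  rewrite -!mulA RC (mulA (C (wy j) (wx j))).
  have -> : C (wy j) (wx j) * C (wx j) wb =
      C (wx j) wb * C (wy j) wb * C (wy j) (wx j).
    by rewrite -cm_CCC // CK.
  rewrite !mulA -(mulA z) -!T_delta TD // z_xy.
  by [].
(* In [t] the register is 0, so every gate within it has control 0. *)
have t_C h' : wfC h' -> t * evC h' = t.
  elim: h' => [|c h' IH] /=; first by rewrite mulx1.
  case/andP=> cc gg; rewrite mulA.
  suff -> : t * C (wx c.1) (wx c.2) = t by apply: IH.
  rewrite -T_delta; apply: (@sat_T _ M w0 wb) => //.
    by rewrite /cdelta; apply/negbTE/wx_neq; rewrite eq_sym.
  by rewrite /satisfies T_delta.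
(* In [y] the register agrees with its copy, so a linear equation may be moved to the copy; by
   additivity one coordinate at a time suffices. *)
have y_ysubst e : (forall k, e k -> exists i, k = wx i) -> sat y e ->
    sat y (ysubst e).
  move=> ex ye; have eb : e wb = false by apply/negbTE/negP => /ex [].
  suff [_ yee] : cadd e (ysubst e) wb = false /\ sat y (cadd e (ysubst e)).
    rewrite -(caddK (ysubst e) e) (caddC (ysubst e)) /satisfies -TD //.
      by rewrite mulA yee.
    by rewrite /cadd eb.
  apply: (@covector_ind _ (fun f => cadd f (ysubst f) wb = false /\
    sat y (cadd f (ysubst f)))) => [|f g [fb yf] [gb yg]|k /ex [i ->]].
  - rewrite (_ : cadd _ _ = czero); first by split=> //; apply: sat0.
    by apply: functional_extensionality => -[[[[k|k]|]|]|].
  - rewrite (_ : cadd _ _ = cadd (cadd f (ysubst f)) (cadd g (ysubst g))).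
      by split; [rewrite {1}/cadd fb gb | apply: satD].
    apply: functional_extensionality => k.
    by rewrite ysubstD /cadd addbACA.
  - by rewrite ysubst_delta; split.
(* Inserting the inverse of [h] at [t] costs nothing, and adding the copy back yields [z]. In terms
   of [y], the register has then received y and its image under the inverse of [h], whose sum
   vanishes by [srh]. *)
have yh : z = y.
  have : t * evC (rev h) * copy_yx = z.
    by rewrite t_C ?wfC_rev // /t -mulA Tm_inv ?mulx1.
  move<-; have -> : t * evC (rev h) = y * (evC h * copy_yx * evC (rev h)).
    by rewrite /t /z !mulA.
  rewrite conj_evC_yx // -(mulA y) TmD //.
  apply: Tm_absorb => j; apply: (@sat_T _ M w0 wb) => //.
  rewrite -ysubst_delta -ysubstD caddC; apply: y_ysubst.
    move=> k ek; apply: NNPP => nk.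
    have kx i : k != wx i by apply/eqP => ki; apply: nk; exists i.
    by move: ek; rewrite /cadd pullh_x // /cdelta (negbTE (kx j)).
  apply: y_sat; last exact: srh.
  by apply: isXD; [|apply: isX_pullh]; apply: isX_wx.
have -> : x = y * copy_xy by rewrite /y -mulA Tm_inv // mulx1.
have -> : y * copy_xy * evC h = y * (copy_xy * evC h) by rewrite mulA.
(* Moved after [h], the uncopying adds the old register, which is the image of the present one under
   the inverse of [h]. Once [z] is replaced by [y], [srh] turns this image into the register
   itself. *)
have -> : copy_xy * evC h =
    evC h * Tm wy (fun j => pullh (rev h) (cdelta (wx j))).
  by apply: prod_shift => j; rewrite -T_evC ?pullhK // pullh_x.
rewrite mulA -/z yh.
have -> : Tm wy (fun j => pullh (rev h) (cdelta (wx j))) =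
  Tm wy (fun j => cadd (cdelta (wx j)) (pullh (rev h) (cdelta (wx j)))) * copy_xy.
  rewrite TmD //; last by move=> i j; rewrite /cadd pullh_x.
  congr Tm; apply: functional_extensionality => j.
  by rewrite (caddC (cdelta _)) caddK.
rewrite mulA; congr (_ * _); apply: Tm_absorb => j.
apply: (@sat_T _ M w0 wb) => //.
- by rewrite /cadd pullh_x.
- by rewrite /cadd pullh_x.
- apply: y_sat; last exact: srh.
  by apply: isXD; [|apply: isX_pullh]; apply: isX_wx.
Qed.

(** Duality through [span_ind]; the condition at [wb] is carried along because [satD] needs it. *)
Lemma sat_vanishing es e : allX es -> isX e ->
  (forall z, (forall f, List.In f es -> pairing f z = false) ->
     pairing e z = false) ->
  sat (Q es) e.
Proof.
move=> esX eX van.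
suff [] : e wb = false /\ sat (Q es) e by [].
apply: (span_ind (S := fun f => f wb = false /\ sat (Q es) f)) van.
- by split=> //; apply: sat0.
- by move=> f g [fb sf] [gb sg]; split; [rewrite /cadd fb gb | apply: satD].
- by move=> f fes; split; [rewrite esX ?anc_wb | apply: sat_Q].
Qed.

Lemma pairing_isX e (z : W -> bool) : isX e -> z w0 ->
  pairing e z = pairing e (hom (fun i => z (wx i))).
Proof.
move=> eX z0; apply: eq_bigr => -[[[[i|i]|]|]|] _ //; last by rewrite z0.
- by rewrite (eX (wy i)) // anc_wy.
- by rewrite (eX wb) // anc_wb.
- by rewrite (eX wa) // anc_wa.
Qed.

Lemma killsP es p :
  kills es p <-> forall e, List.In e es -> pairing e (hom p) = false.
Proof.
elim: es => [|e es IH]; first by split.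
rewrite /kills /= -/(kills es p); split.
  by case/andP=> /negbTE ep /IH esp f [<- //|/esp].
move=> ep; rewrite ep /=; last by left.
by apply/IH => f fes; apply: ep; right.
Qed.

(** A solution of the homogenized system whose constant coordinate is 0 is a direction and not a
    point. Adding the point [p0] makes it a point, and [e] vanishes on both. *)
Lemma sat_kills es e p0 : allX es -> isX e -> kills es p0 ->
  (forall p, kills es p -> pairing e (hom p) = false) -> sat (Q es) e.
Proof.
move=> esX eX es0 van; apply: sat_vanishing => // z zes.
have van1 (y : W -> bool) : y w0 ->
    (forall f, List.In f es -> pairing f y = false) ->
    pairing e y = false.
  move=> y0 yes; rewrite pairing_isX // van //; apply/killsP => f fes.
  by rewrite -pairing_isX ?yes //; apply: esX.
case z0: (z w0); first exact: van1.
have := van1 (cadd z (hom p0)); rewrite pairingDr (van p0) // addbF; apply.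
  by rewrite /cadd z0.
move=> f fes; rewrite pairingDr zes //=.
by move/killsP: es0; apply.
Qed.

(** Without solutions, all zeros of the homogenized system have constant coordinate 0, so 1 = 0 is a
    linear consequence of the equations. *)
Lemma absurd_sat es : allX es -> (forall p, ~~ kills es p) ->
  sat (Q es) (cdelta w0).
Proof.
move=> esX nk; apply: sat_vanishing => //; first exact: isX_w0.
move=> z zes; rewrite pairing_delta; apply/negbTE/negP => z0.
move: (nk (fun i => z (wx i))) => /negP; apply; apply/killsP => f fes.
by rewrite -pairing_isX ?zes //; apply: esX.
Qed.

Lemma absurd_absorb_C es i j : allX es -> (forall p, ~~ kills es p) ->
  i != w0 -> i != wb -> j != w0 -> i != j -> Q es * C i j = Q es.
Proof.
move=> esX /(absurd_sat esX) s0 i0 ib j0 ij.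
apply: (@absurd_C _ M w0 _ wb) => //; first by apply: Q_ready; rewrite ?anc_wb.
by rewrite -T_delta.
Qed.

Lemma absurd_absorb_sat es e : allX es -> (forall p, ~~ kills es p) ->
  isX e -> sat (Q es) e.
Proof.
move=> esX nk eX; apply: prod_absorb => i _; case ei: (e i); last exact: mulx1.
case: (eqVneq i w0) => [->|i0]; first by rewrite -T_delta; apply: absurd_sat.
apply: absurd_absorb_C => //; apply/eqP => ib; move: ei.
- by rewrite ib eX ?anc_wb.
- by rewrite ib eX ?anc_wb.
Qed.

Lemma absurd_absorb_evC es h : allX es -> (forall p, ~~ kills es p) ->
  wfC h -> Q es * evC h = Q es.
Proof.
move=> esX nk; elim: h => [|c h IH] /=; first by rewrite mulx1.
by case/andP=> cc hh; rewrite mulA absurd_absorb_C // IH.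
Qed.

Lemma runC_cat h h' p : runC (h ++ h') p = runC h' (runC h p).
Proof. by rewrite /runC foldl_cat. Qed.

Lemma runC_rev h p : wfC h -> runC (rev h) (runC h p) = p.
Proof.
elim: h p => [//|c h IH] p /andP [cc hh]; rewrite rev_cons -cats1 runC_cat.
rewrite -[runC (c :: h) p]/(runC h (push c.1 c.2 p)) IH //.
apply: functional_extensionality => k; rewrite /= /push eqxx.
by case: eqP => [->|//]; rewrite (negbTE cc) addbK.
Qed.

Theorem words_complete w w' : all (@letter_wf n) w -> all (@letter_wf n) w' ->
  (forall p, run w p = run w' p) -> K * ev w = K * ev w'.
Proof.
move=> /word_nf [es [h [esX hh -> r]]] /word_nf [es' [h' [esX' hh' -> r']]] ww.
have kk p : kills es p = kills es' p.
  by have := ww p; rewrite r r'; do 2!case: kills.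
have [[p0 k0]|nk] := classic (exists p, kills es p); last first.
  have nk1 p : ~~ kills es p by apply/negP => k; apply: nk; exists p.
  have nk2 p : ~~ kills es' p by rewrite -kk.
  rewrite !absurd_absorb_evC //.
  by apply: Q_eq => // e ees; apply: absurd_absorb_sat => //;
    [apply: esX' | apply: esX].
have <- : Q es = Q es'.
  apply: Q_eq => // e ees; apply: (@sat_kills _ _ p0) => //; rewrite -?kk //.
  - exact: esX'.
  - by move=> p; rewrite kk => /killsP; apply.
  - exact: esX.
  - by move=> p; rewrite -kk => /killsP; apply.
(* Both words have the same projection. It remains that this projection absorbs [h] followed by the
   inverse of [h'], a map fixing the common domain pointwise. *)
pose g := h ++ rev h'.
have gg : wfC g by rewrite /wfC all_cat -!/(wfC _) wfC_rev hh.
suff e : Q es * evC g = Q es.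
  rewrite -{2}e evC_cat -!mulA evC_revl ?mulx1 //.
have fix_g p : kills es p -> runC g p = p.
  move=> kp; rewrite /g runC_cat.
  suff -> : runC h p = runC h' p by apply: runC_rev.
  by have := ww p; rewrite r r' -kk kp => -[].
have fix_rg p : kills es p -> runC (rev g) p = p.
  by move=> kp; rewrite -{1}(fix_g _ kp) runC_rev.
have fixed h1 j : wfC h1 -> (forall p, kills es p -> runC h1 p = p) ->
    sat (Q es) (cadd (cdelta (wx j)) (pullh h1 (cdelta (wx j)))).
  move=> ff fp; apply: (@sat_kills _ _ p0) => //.
    by apply: isXD; [|apply: isX_pullh]; apply: isX_wx.
  by move=> p kp; rewrite pairingDl pairing_pullh fp // addbb.
apply: fixing_absorbed => //; first exact: Q_ready.
- by move=> j; apply: fixed.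
- by move=> j; apply: fixed; rewrite ?wfC_rev.
Qed.

(** Padding delivers the spare wires in state 1. Flipping them from the constant wire makes them 0;
    the flips commute with words on the register and can be undone at the end. *)
Lemma words_complete_ones x w w' : x * P w0 = x ->
  (forall c, c \in anc -> x * P c = x) ->
  all (@letter_wf n) w -> all (@letter_wf n) w' ->
  (forall p, run w p = run w' p) -> x * ev w = x * ev w'.
Proof.
move=> x0 xP ww ww' eqw; pose flip := mprod anc (C w0).
have CC c d : c \in anc -> d \in anc -> cm_comm (C w0 c) (C w0 d).
  by move=> /anc_w0 c0 /anc_w0 d0; apply: cm_CcommC; rewrite // eq_sym.
have flipK : flip * flip = 1.
  rewrite /flip -prod_split; last by move=> c d ca da; apply: CC.
  rewrite -(prod1 M anc); apply: eq_prod => c /anc_w0 c0 /=.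
  by rewrite cm_CC // eq_sym.
have flip_ev v : all (@letter_wf n) v -> cm_comm flip (ev v).
  elim: v => [|l v IH] /=; first by move=> _; exact: comm1.
  case/andP=> ll vv; apply: commM; last exact: IH.
  apply/comm_sym/comm_prod => c ca; have c0 := anc_w0 ca.
  have cx i : wx i != c by rewrite eq_sym; apply: anc_wx.
  case: l ll => [i j|i] /= ij.
    by apply: cm_CcommC; rewrite ?cx // eq_sym.
  by apply: PcommC; rewrite ?cx // eq_sym.
have r : ready (x * flip).
  move=> c ca; have c0 := anc_w0 ca; have c0' : w0 != c by rewrite eq_sym.
  have -> : flip = mprod (rem c anc) (C w0) * C w0 c.
    rewrite /flip (prod_pick ca); last by move=> d d' da da'; apply: CC.
    by apply: comm_prod => d /mem_rem da; apply: CC.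
  set R := mprod _ _; rewrite /is_zero ZE // !mulA CK //.
  have RP k : k == w0 \/ k == c -> R * P k = P k * R.
    move=> kk; apply/comm_sym/comm_prod => d.
    rewrite mem_rem_uniq /anc ?inE; last first.
      rewrite /= !inE /= map_inj_uniq ?enum_uniq ?andbT; last by move=> a b [].
      by apply/andP; split; apply/negP => /mapP [].
    case/andP=> dc; rewrite -!in_cons => /anc_w0 d0.
    apply: PcommC; rewrite 1?eq_sym //.
    by case: kk => /eqP ->.
  rewrite -(mulA x) RP; last by left.
  rewrite mulA x0 -(mulA x) RP; last by right.
  by rewrite mulA xP.
have e : x * flip * ev w = x * flip * ev w'.
  by rewrite -(ready_K r) -mulA (words_complete ww ww' eqw) mulA.
have fl v : all (@letter_wf n) v -> x * ev v = x * flip * ev v * flip.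
  move=> vv; rewrite -(mulA (x * flip)) -(flip_ev _ vv) -(mulA x).
  by rewrite (mulA flip flip) flipK mul1x.
by rewrite (fl _ ww) (fl _ ww') e.
Qed.

End Words.

(** * Circuits modulo the identities *)

(** Equivalence classes, so that relations become the Leibniz equalities that [cnot_monoid] asks
    for; extensionality identifies the classes of related circuits. *)
Definition mor m n := {S : circuit m n -> Prop | exists f, S = @ceq m n f}.

Definition cls m n (f : circuit m n) : mor m n :=
  exist _ (ceq f) (ex_intro _ f erefl).

Lemma cls_eq m n (f g : circuit m n) : cls f = cls g <-> ceq f g.
Proof.
split=> [[fg]|fg]; first by rewrite fg; apply: ceq_refl.
apply: sig_eq; apply: functional_extensionality => h /=.
apply: propositional_extensionality; split=> [fh|gh].
  exact: ceq_trans (ceq_sym fg) fh.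
exact: ceq_trans fg gh.
Qed.

Definition repr m n (u : mor m n) : circuit m n :=
  proj1_sig (constructive_indefinite_description _ (proj2_sig u)).

Lemma reprK m n (u : mor m n) : cls (repr u) = u.
Proof.
rewrite /repr; case: constructive_indefinite_description => f /= uf.
exact: sig_eq.
Qed.

Lemma repr_ceq m n (f : circuit m n) : ceq (repr (cls f)) f.
Proof. by apply/cls_eq; rewrite reprK. Qed.

Definition mone n : mor n n := cls (cid n).
Definition mcmp m n p (u : mor m n) (v : mor n p) : mor m p :=
  locked (cls (repr u >> repr v)%circuit).
Definition mtens m n p q (u : mor m n) (v : mor p q) : mor (m + p) (n + q) :=
  locked (cls (repr u ** repr v)%circuit).
Definition mcast m m' n n' (em : m = m') (en : n = n') (u : mor m n) :
    mor m' n' :=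
  ecast i (mor i n') em (ecast j (mor m j) en u).

Declare Scope mor_scope.
Delimit Scope mor_scope with mor.
Bind Scope mor_scope with mor.
Local Open Scope mor_scope.
Notation "u >> v" := (mcmp u v) : mor_scope.
Notation "u ** v" := (mtens u v) : mor_scope.

Lemma cls_cmp m n p (f : circuit m n) (g : circuit n p) :
  cls (f >> g)%circuit = cls f >> cls g.
Proof.
rewrite /mcmp -lock; apply/cls_eq.
by apply: ceq_cmp; apply: ceq_sym; apply: repr_ceq.
Qed.

Lemma cls_tens m n p q (f : circuit m n) (g : circuit p q) :
  cls (f ** g)%circuit = cls f ** cls g.
Proof.
rewrite /mtens -lock; apply/cls_eq.
by apply: ceq_tens; apply: ceq_sym; apply: repr_ceq.
Qed.

Lemma cls_cast m m' n n' (em : m = m') (en : n = n') (f : circuit m n) :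
  cls (ccast em en f) = mcast em en (cls f).
Proof. by case: m' / em; case: n' / en. Qed.

Lemma mcast_id m n (em : m = m) (en : n = n) (u : mor m n) : mcast em en u = u.
Proof. by rewrite (eq_irrelevance em erefl) (eq_irrelevance en erefl). Qed.

Lemma mcmpA m n p q (u : mor m n) (v : mor n p) (w : mor p q) :
  u >> (v >> w) = u >> v >> w.
Proof.
rewrite -(reprK u) -(reprK v) -(reprK w) -!cls_cmp; apply/cls_eq.
exact: ceq_cmpA.
Qed.

Lemma mcmp1m m n (u : mor m n) : mone m >> u = u.
Proof. by rewrite -(reprK u) -cls_cmp; apply/cls_eq; apply: ceq_cmp1m. Qed.

Lemma mcmpm1 m n (u : mor m n) : u >> mone n = u.
Proof. by rewrite -(reprK u) -cls_cmp; apply/cls_eq; apply: ceq_cmpm1. Qed.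

Lemma mtens1 m n : mone m ** mone n = mone (m + n).
Proof. by rewrite -cls_tens; apply/cls_eq; apply: ceq_tens_id. Qed.

Lemma mtens_cmp m n p m' n' p' (u : mor m n) (v : mor n p) (u' : mor m' n')
  (v' : mor n' p') : (u >> v) ** (u' >> v') = (u ** u') >> (v ** v').
Proof.
rewrite -(reprK u) -(reprK v) -(reprK u') -(reprK v').
by rewrite -!cls_cmp -!cls_tens -cls_cmp; apply/cls_eq; apply: ceq_tens_cmp.
Qed.

Lemma mtensA m n p q r s (u : mor m n) (v : mor p q) (w : mor r s) :
  mcast (addnA m p r) (addnA n q s) (u ** (v ** w)) = u ** v ** w.
Proof.
rewrite -(reprK u) -(reprK v) -(reprK w) -!cls_tens -cls_cast.
by apply/cls_eq; apply: ceq_tensA.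
Qed.

Lemma mtens0m m n (u : mor m n) : mone 0 ** u = u.
Proof. by rewrite -(reprK u) -cls_tens; apply/cls_eq; apply: ceq_tens0m. Qed.

Lemma mtensm0 m n (u : mor m n) :
  mcast (addn0 m) (addn0 n) (u ** mone 0) = u.
Proof.
rewrite -(reprK u) -cls_tens -cls_cast; apply/cls_eq; exact: ceq_tensm0.
Qed.

Definition msym m n : mor (m + n) (n + m) := cls (csym m n).

Lemma msym_nat m n p q (u : mor m n) (v : mor p q) :
  (u ** v) >> msym n q = msym m p >> (v ** u).
Proof.
rewrite -(reprK u) -(reprK v) -!cls_tens -!cls_cmp; apply/cls_eq.
exact: ceq_sym_nat.
Qed.

Lemma msymK m n : msym m n >> msym n m = mone (m + n).
Proof. by rewrite -cls_cmp; apply/cls_eq; apply: ceq_symK. Qed.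

Lemma mhexagon m n p :
  mcast (addnA m n p) (erefl (n + p + m)) (msym m (n + p)) =
  (msym m n ** mone p) >> mcast (addnA n m p) (addnA n p m) (mone n ** msym m p).
Proof.
rewrite -!cls_tens -!cls_cast -cls_cmp; apply/cls_eq; exact: ceq_hexagon.
Qed.

Definition mcnot : mor 2 2 := cls cnot.
Definition mswap : mor 2 2 := msym 1 1.
Definition mket : mor 0 1 := cls ket1.
Definition mbra : mor 1 0 := cls bra1.
Definition mcnot21 : mor 2 2 := mswap >> mcnot >> mswap.
Definition mpr : mor 1 1 := mbra >> mket.

Lemma mor_ind (S : forall m n, mor m n -> Prop) :
  (forall n, S _ _ (mone n)) ->
  (forall m n p (u : mor m n) (v : mor n p), S _ _ u -> S _ _ v -> S _ _ (u >> v)) ->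
  (forall m n p q (u : mor m n) (v : mor p q), S _ _ u -> S _ _ v ->
     S _ _ (u ** v)) ->
  (forall m n, S _ _ (msym m n)) -> S _ _ mcnot -> S _ _ mket -> S _ _ mbra ->
  forall m n (u : mor m n), S _ _ u.
Proof.
move=> S1 Sc St Ss Sn Sk Sb m n u; rewrite -(reprK u).
elim: (repr u) => {m n u} [n|m n p f Sf g Sg|m n p q f Sf g Sg|m n|||] //.
- by rewrite cls_cmp; apply: Sc.
- by rewrite cls_tens; apply: St.
Qed.

(* With concrete arities on the left, both sides of associativity have
   convertible types and the transport disappears. *)
Lemma tA1 p q r s (u : mor 1 1) (v : mor p q) (w : mor r s) :
  u ** (v ** w) = (u ** v ** w : mor (1 + (p + r)) (1 + (q + s))).
Proof. by rewrite -mtensA mcast_id. Qed.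

Lemma tA2 p q r s (u : mor 2 2) (v : mor p q) (w : mor r s) :
  u ** (v ** w) = (u ** v ** w : mor (2 + (p + r)) (2 + (q + s))).
Proof. by rewrite -mtensA mcast_id. Qed.

Lemma tAket p q r s (v : mor p q) (w : mor r s) :
  mket ** (v ** w) = (mket ** v ** w : mor (0 + (p + r)) (1 + (q + s))).
Proof. by rewrite -mtensA mcast_id. Qed.

Lemma tAbra p q r s (v : mor p q) (w : mor r s) :
  mbra ** (v ** w) = (mbra ** v ** w : mor (1 + (p + r)) (0 + (q + s))).
Proof. by rewrite -mtensA mcast_id. Qed.

Definition up m n (u : mor m n) : mor m.+1 n.+1 := mone 1 ** u.

Lemma up1 n : up (mone n) = mone n.+1.
Proof. exact (mtens1 1 n). Qed.

Lemma up_cmp m n p (u : mor m n) (v : mor n p) : up (u >> v) = up u >> up v.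
Proof. by have := mtens_cmp (mone 1) (mone 1) u v; rewrite mcmp1m. Qed.

Lemma up_up m n (u : mor m n) : up (up u) = mone 2 ** u.
Proof. by rewrite /up (tA1 (mone 1) (mone 1) u) mtens1. Qed.

Lemma up_tens m n p q (u : mor m n) (v : mor p q) :
  up (u ** v) = (up u ** v : mor (m + p).+1 (n + q).+1).
Proof. exact: (tA1 (mone 1) u v). Qed.

Lemma tens_swap m n p q (u : mor m n) (v : mor p q) :
  (u ** mone p) >> (mone n ** v) = (mone m ** v) >> (u ** mone q).
Proof. by rewrite -!mtens_cmp !mcmp1m !mcmpm1. Qed.

Lemma tens_split m n p q (u : mor m n) (v : mor p q) :
  u ** v = (u ** mone p) >> (mone n ** v).
Proof. by rewrite -mtens_cmp mcmp1m mcmpm1. Qed.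

Lemma tens_cmp1 m n p q (u : mor m n) (v : mor n p) :
  (u >> v) ** mone q = (u ** mone q) >> (v ** mone q).
Proof. by rewrite -mtens_cmp mcmp1m. Qed.

(** The hexagon with two empty factors makes this symmetry idempotent, and it is invertible. *)
Lemma msym10 : msym 1 0 = mone 1.
Proof.
have e0 : msym 1 0 ** mone 0 = msym 1 0.
  by have := mtensm0 (msym 1 0 : mor 1 1); rewrite mcast_id.
have e1 : msym 1 0 = (msym 1 0 : mor 1 1) >> msym 1 0.
  have := mhexagon 1 0 0; rewrite !mcast_id e0.
  by rewrite (mtens0m (msym 1 0)).
have e2 : msym 0 1 >> msym 1 0 = mone 1 := msymK 0 1.
by rewrite -[LHS](mcmp1m (msym 1 0 : mor 1 1)) -e2 -mcmpA -e1.
Qed.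

Lemma msym01 : msym 0 1 = mone 1.
Proof.
have := msymK 0 1; rewrite msym10.
by rewrite (mcmpm1 (msym 0 1 : mor 1 1)).
Qed.

Lemma swapK : mswap >> mswap = mone 2.
Proof. exact: msymK 1 1. Qed.

Lemma msym12 : msym 1 2 = (mswap ** mone 1) >> (mone 1 ** mswap).
Proof. by have := mhexagon 1 1 1; rewrite !mcast_id. Qed.

(** Naturality of the symmetry between one wire and two slides [g] past the extra wire. *)
Lemma conj3 (g : mor 2 2) :
  mone 1 ** g =
  (mswap ** mone 1) >> (mone 1 ** mswap) >> (g ** mone 1) >>
  (mone 1 ** mswap) >> (mswap ** mone 1).
Proof.
have e := msym_nat (mone 1) g; rewrite msym12 in e.
have e1 : (mswap ** mone 1) >> (mswap ** mone 1) = mone 3.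
  by rewrite -(tens_cmp1 1 mswap mswap) swapK mtens1.
have e2 : (mone 1 ** mswap) >> (mone 1 ** mswap) = mone 3.
  by rewrite -mtens_cmp swapK mcmp1m mtens1.
rewrite -e -!mcmpA (mcmpA (mone 1 ** mswap)) e2.
by rewrite (mcmp1m (mswap ** mone 1 : mor 3 3)) e1 mcmpm1.
Qed.

(** * Gates at arbitrary positions *)

(** Positions out of range give the identity, which frees the composition and commutation laws from
    bounds. *)
Fixpoint at2 (g : mor 2 2) (a N : nat) {struct a} : mor N N :=
  match a, N return mor N N with
  | 0, b.+2 => g ** mone b
  | a'.+1, N'.+1 => up (at2 g a' N')
  | _, N' => mone N'
  end.

Fixpoint at1 (g : mor 1 1) (a N : nat) {struct a} : mor N N :=
  match a, N return mor N N with
  | 0, b.+1 => g ** mone b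
  | a'.+1, N'.+1 => up (at1 g a' N')
  | _, N' => mone N'
  end.

Lemma at2_cmp g h a N : at2 (g >> h) a N = at2 g a N >> at2 h a N.
Proof.
elim: a N => [|a IH] [|[|N]] /=; rewrite ?mcmp1m //.
- exact (tens_cmp1 _ g h).
- by rewrite IH up_cmp.
- by rewrite IH up_cmp.
Qed.

Lemma at2_1 a N : at2 (mone 2) a N = mone N.
Proof.
elim: a N => [|a IH] [|[|N]] //=; first exact (mtens1 2 N).
- by rewrite IH up1.
- by rewrite IH up1.
Qed.

Lemma at1_cmp g h a N : at1 (g >> h) a N = at1 g a N >> at1 h a N.
Proof.
elim: a N => [|a IH] [|N] /=; rewrite ?mcmp1m //.
- exact (tens_cmp1 _ g h).
- by rewrite IH up_cmp.
Qed.

Lemma far2 (g : mor 2 2) b (x : mor b b) :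
  (g ** mone b : mor b.+2 b.+2) >> up (up x) = up (up x) >> (g ** mone b).
Proof. by rewrite up_up; exact (tens_swap g x). Qed.

Lemma far1 (g : mor 1 1) b (x : mor b b) :
  (g ** mone b : mor b.+1 b.+1) >> up x = up x >> (g ** mone b).
Proof. exact (tens_swap g x). Qed.

Lemma at2_comm g h a c N : a.+1 < c ->
  at2 g a N >> at2 h c N = at2 h c N >> at2 g a N.
Proof.
elim: a c N => [|a IH] [|c] [|N] //= ac; rewrite ?mcmp1m ?mcmpm1 //.
  case: N c ac => [|N] [|c] //= _; rewrite ?up1 ?mcmp1m ?mcmpm1 //.
  exact: far2.
by rewrite -!up_cmp IH.
Qed.

Lemma at21_comm g h a c N : a.+1 < c ->
  at2 g a N >> at1 h c N = at1 h c N >> at2 g a N.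
Proof.
elim: a c N => [|a IH] [|c] [|N] //= ac; rewrite ?mcmp1m ?mcmpm1 //.
  case: N c ac => [|N] [|c] //= _; rewrite ?up1 ?mcmp1m ?mcmpm1 //.
  exact: far2.
by rewrite -!up_cmp IH.
Qed.

Lemma at1_comm g h a c N : a < c ->
  at1 g a N >> at1 h c N = at1 h c N >> at1 g a N.
Proof.
elim: a c N => [|a IH] [|c] [|N] //= ac; rewrite ?mcmp1m ?mcmpm1 //.
  exact: far1.
by rewrite -!up_cmp IH.
Qed.

Lemma at2_3_0 g b : at2 g 0 b.+3 = (g ** mone 1) ** mone b :> mor b.+3 b.+3.
Proof. by rewrite -(tA2 g (mone 1) (mone b)) /= -(mtens1 1 b). Qed.

Lemma at2_3_1 g b : at2 g 1 b.+3 = (mone 1 ** g) ** mone b :> mor b.+3 b.+3.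
Proof. exact: (tA1 (mone 1) g (mone b)). Qed.

Definition sw a N := at2 mswap a N.

Lemma swK a N : sw a N >> sw a N = mone N.
Proof. by rewrite -at2_cmp swapK at2_1. Qed.

Lemma at2_S g a N : a.+2 < N ->
  at2 g a.+1 N = sw a N >> sw a.+1 N >> at2 g a N >> sw a.+1 N >> sw a N.
Proof.
elim: a N => [|a IH] [|N] // aN.
  case: N aN => [|[|b]] // _; rewrite /sw !at2_3_0 !at2_3_1 (conj3 g).
  by rewrite !(tens_cmp1 b).
by rewrite /sw /= -!up_cmp -IH.
Qed.

(** The case of [at2_S] in which the gate being moved is itself a swap. *)
Lemma braid a N : a.+2 < N ->
  sw a N >> sw a.+1 N >> sw a N = sw a.+1 N >> sw a N >> sw a.+1 N.
Proof.
move=> aN; rewrite [X in _ = X >> _ >> _]/sw at2_S // -/(sw a N).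
rewrite -!mcmpA (mcmpA (sw a N) (sw a N)) swK mcmp1m swK mcmpm1.
by rewrite /sw.
Qed.

Lemma at1_S g a N : a.+1 < N -> at1 g a.+1 N = sw a N >> at1 g a N >> sw a N.
Proof.
elim: a N => [|a IH] [|N] // aN; last by rewrite /sw /= -!up_cmp -IH.
case: N aN => [|b] // _; rewrite /sw /=.
have e : mone 1 ** g = mswap >> (g ** mone 1) >> mswap.
  have := msym_nat (mone 1) g; rewrite -/mswap => <-.
  by rewrite -mcmpA swapK mcmpm1.
rewrite -(mtens1 1 b) (tA1 g (mone 1) (mone b)).
rewrite -(tens_cmp1 b mswap (g ** mone 1)).
rewrite -(tens_cmp1 b (mswap >> (g ** mone 1)) mswap) -e.
exact (tA1 (mone 1) g (mone b)).
Qed.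

(** * Words in adjacent transpositions and coherence *)

Definition swW N (u : seq nat) : mor N N :=
  foldr (fun a x => sw a N >> x) (mone N) u.

Lemma swW_cat N u v : swW N (u ++ v) = swW N u >> swW N v.
Proof. by elim: u => [|a u IH] /=; rewrite ?mcmp1m // IH mcmpA. Qed.

Lemma swW_rev N u : swW N u >> swW N (rev u) = mone N.
Proof.
elim: u => [|a u IH] /=; first exact: mcmp1m.
rewrite rev_cons -cats1 swW_cat /= mcmpm1 -mcmpA (mcmpA (swW N u)) IH mcmp1m.
exact: swK.
Qed.

Lemma swW_revl N u : swW N (rev u) >> swW N u = mone N.
Proof. by rewrite -{2}(revK u) swW_rev. Qed.

Lemma swW_S N u : swW N.+1 (map S u) = up (swW N u).
Proof.
elim: u => [|a u IH] /=; first by rewrite up1.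
by rewrite up_cmp -IH.
Qed.

(* The position reached by the wire entering at position x. *)
Definition tr a x := if x == a then a.+1 else if x == a.+1 then a else x.
Definition actw (u : seq nat) x := foldl (fun x a => tr a x) x u.

Lemma actw_cat u v x : actw (u ++ v) x = actw v (actw u x).
Proof. by rewrite /actw foldl_cat. Qed.

Lemma trL a : tr a a = a.+1.
Proof. by rewrite /tr eqxx. Qed.

Lemma trR a : tr a a.+1 = a.
Proof. by rewrite /tr gtn_eqF // eqxx. Qed.

Lemma trN a x : x != a -> x != a.+1 -> tr a x = x.
Proof. by rewrite /tr => /negbTE -> /negbTE ->. Qed.

Lemma trK a x : tr a (tr a x) = x.
Proof.
rewrite /tr; case: (eqVneq x a) => [->|xa]; first by rewrite gtn_eqF // eqxx.
case: (eqVneq x a.+1) => [->|xa1]; first by rewrite eqxx.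
by rewrite (negbTE xa) (negbTE xa1).
Qed.

Lemma actw_rev u x : actw (rev u) (actw u x) = x.
Proof.
elim: u x => [|a u IH] x //=.
by rewrite rev_cons -cats1 actw_cat IH /= trK.
Qed.

Lemma actw_inj u : injective (actw u).
Proof. exact: can_inj (actw_rev u). Qed.

Lemma actw_S0 u : actw (map S u) 0 = 0.
Proof. by elim: u. Qed.

Lemma actw_S u x : actw (map S u) x.+1 = (actw u x).+1.
Proof.
elim: u x => [|a u IH] x //=; rewrite -IH; congr (actw _ _).
by rewrite /tr !eqSS; case: (x == a); case: (x == a.+1).
Qed.

(** Lifts the wire at position [i] to the top and moves the wires above it down by one. *)
Fixpoint down i : seq nat := if i is i'.+1 then i' :: down i' else [::].

Lemma down_S i : down i.+1 = map S (down i) ++ [:: 0].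
Proof. by elim: i => //= i <-. Qed.

Lemma actw_D i : actw (down i) i = 0.
Proof. by elim: i => //= i IH; rewrite /tr gtn_eqF // eqxx. Qed.

Definition valid N (u : seq nat) := all (fun a => a.+1 < N) u.

Lemma valid_cat N u v : valid N (u ++ v) = valid N u && valid N v.
Proof. exact: all_cat. Qed.

Lemma valid_rev N u : valid N (rev u) = valid N u.
Proof. exact: all_rev. Qed.

Lemma valid_S N u : valid N.+1 (map S u) = valid N u.
Proof. by rewrite /valid all_map. Qed.

Lemma valid_D N i : i < N -> valid N (down i).
Proof.
elim: i => //= i IH iN; rewrite iN; exact: IH (ltnW iN).
Qed.

(** Morphism and permutation are followed together: a normal form is reached by rewriting, and its
    permutation then tells which one it is. *)
Definition weq N u v := swW N u = swW N v /\ actw u =1 actw v.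

Lemma weq_refl N u : weq N u u. Proof. by []. Qed.

Lemma weq_sym N u v : weq N u v -> weq N v u.
Proof. by move=> [e a]; split=> // x; rewrite a. Qed.

Lemma weq_trans N u v w : weq N u v -> weq N v w -> weq N u w.
Proof. by move=> [e a] [e' a']; split=> [|x]; rewrite ?e ?a. Qed.

Lemma weq_cat N u u' v v' : weq N u u' -> weq N v v' ->
  weq N (u ++ v) (u' ++ v').
Proof.
move=> [e a] [e' a']; split=> [|x]; first by rewrite !swW_cat e e'.
by rewrite !actw_cat a a'.
Qed.

Lemma weq_S N u v : weq N u v -> weq N.+1 (map S u) (map S v).
Proof.
move=> [e a]; split=> [|[|x]]; first by rewrite !swW_S e.
  by rewrite !actw_S0.
by rewrite !actw_S a.
Qed.

Lemma tr_far a b x : a.+1 < b -> tr a (tr b x) = tr b (tr a x).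
Proof.
move/ltP=> ab; rewrite /tr.
by case: (x =P a) => ?; case: (x =P a.+1) => ?; case: (x =P b) => ?;
  case: (x =P b.+1) => ?;
  repeat (case: eqP => ?); lia.
Qed.

Lemma weq_far N a b : a.+1 < b -> weq N [:: a; b] [:: b; a].
Proof.
move=> ab; split=> [|x]; last exact/esym/tr_far.
by rewrite /= !mcmpm1 at2_comm.
Qed.

Lemma weq_braid N a : a.+2 < N ->
  weq N [:: a; a.+1; a] [:: a.+1; a; a.+1].
Proof.
move=> aN; split=> [|x]; first by rewrite /= !mcmpm1 !mcmpA braid.
have n1 : tr a a.+2 = a.+2 by apply: trN; apply/eqP; lia.
have n2 : tr a.+1 a = a by apply: trN; apply/eqP; lia.
rewrite /=; case: (eqVneq x a) => [->|xa]; first by rewrite !(trL, trR, n1, n2).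
case: (eqVneq x a.+1) => [->|xa1]; first by rewrite !(trL, trR, n1, n2).
case: (eqVneq x a.+2) => [->|xa2]; first by rewrite !(trL, trR, n1, n2).
have e1 : tr a x = x by apply: trN.
have e2 : tr a.+1 x = x by apply: trN.
by rewrite !(e1, e2).
Qed.

Lemma weq_K N a : weq N [:: a; a] [::].
Proof. by split=> [|x]; rewrite /= ?mcmpm1 ?swK // trK. Qed.

Lemma weq_far_D N i b : i < b -> weq N (b :: down i) (down i ++ [:: b]).
Proof.
elim: i => [|i IH] ib /=; first exact: weq_refl.
apply: (@weq_trans _ _ ([:: i; b] ++ down i)).
  by apply: (@weq_cat _ [:: b; i] [:: i; b]) => //; apply/weq_sym/weq_far.
apply: (@weq_cat _ [:: i] [:: i] (b :: down i)) => //; exact: IH (ltnW ib).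
Qed.

Lemma weq_shift N a j : a < j -> j.+1 < N ->
  weq N (a :: down j.+1) (down j.+1 ++ [:: a.+1]).
Proof.
elim: j => // j IH aj jN; case: (eqVneq a j) => [->|neq].
  apply: (@weq_trans _ _ ([:: j.+1; j; j.+1] ++ down j)).
    by apply: (@weq_cat _ [:: j; j.+1; j] _ (down j)) => //; apply: weq_braid.
  apply: (@weq_cat _ [:: j.+1; j] [:: j.+1; j] (j.+1 :: down j)) => //.
  exact: weq_far_D.
have aj' : a < j by rewrite ltn_neqAle neq -ltnS.
apply: (@weq_trans _ _ ([:: j.+1; a] ++ down j.+1)).
  by apply: (@weq_cat _ [:: a; j.+1] [:: j.+1; a]) => //; apply: weq_far.
apply: (@weq_cat _ [:: j.+1] [:: j.+1] (a :: down j.+1)) => //.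
exact: IH (ltnW jN).
Qed.

(** Both words put wire [j.+1] on top and wire [i] just below it, lifted in the two possible
    orders. *)
Lemma weq_DD N i j : i <= j -> j.+1 < N ->
  weq N (down i ++ down j.+1) (down j.+1 ++ map S (down i)).
Proof.
move=> ij jN; elim: i ij => [|i IH] ij; first by rewrite /= cats0.
rewrite -[down i.+1]/([:: i] ++ down i) -catA.
apply: (@weq_trans _ _ ([:: i] ++ (down j.+1 ++ map S (down i)))).
  by apply: weq_cat => //; apply: IH (ltnW ij).
rewrite catA map_cat [RHS in weq _ _ RHS]catA.
by apply: weq_cat => //; apply: weq_shift.
Qed.

(* Coxeter normal form: first bring the wire that ends at position 0 there,
   then permute the others. *)
Lemma word_route N u : valid N.+1 u -> exists i u',
  [/\ i < N.+1, valid N u' & weq N.+1 u (down i ++ map S u')].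
Proof.
elim: N u => [|N IHN] u.
  by case: u => [|a u] //=; exists 0, [::].
elim/last_ind: u => [_|u a IH]; first by exists 0, [::].
rewrite {1}/valid all_rcons => /andP [aN /IH [i [u' [iN vu' uu']]]].
rewrite -cats1; case: a aN => [|a] aN; last first.
  exists i, (u' ++ [:: a]); split=> //; first by rewrite valid_cat vu' /= andbT.
  by rewrite map_cat catA; apply: weq_cat.
have [j [u'' [jN vu'' uu'']]] := IHN _ vu'.
have e : weq N.+2 (u ++ [:: 0]) (down i ++ down j.+1 ++ map S (map S u'')).
  apply: weq_trans (weq_cat uu' (weq_refl _ [:: 0])) _.
  rewrite -catA; apply: weq_cat => //.
  apply: (@weq_trans _ _ ((map S (down j) ++ map S (map S u'')) ++ [:: 0])).
    by apply: weq_cat => //; rewrite -map_cat; apply: weq_S.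
  rewrite down_S -!catA; apply: weq_cat => //.
  elim: u'' {vu'' uu''} => //= b u'' IHu.
  apply: (@weq_trans _ _ ([:: b.+2] ++ (0 :: map S (map S u'')))).
    exact: (@weq_cat _ [:: b.+2] [:: b.+2]).
  by apply: (@weq_cat _ [:: b.+2; 0] [:: 0; b.+2]) => //; apply/weq_sym/weq_far.
(* Two wires are lifted in turn, and the second ends on top. If [i <= j], [weq_DD] lifts that one
   first; otherwise [weq_DD] read backwards brings two transpositions at 0 together, and they
   cancel. *)
case: (leqP i j) => ij.
  exists j.+1, (down i ++ map S u''); split.
  - by [].
  - by rewrite valid_cat valid_D ?valid_S // (leq_ltn_trans ij).
  - apply: weq_trans e _; rewrite map_cat !catA; apply: weq_cat => //.
    exact: weq_DD.
case: i ij {uu'} iN e => // i ij iN e.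
exists j, (down i ++ map S u''); split.
- exact: ltnW.
- by rewrite valid_cat valid_D ?valid_S.
- apply: weq_trans e _; rewrite map_cat !catA; apply: weq_cat => //.
  rewrite (down_S j) catA.
  apply: (@weq_trans _ _ ((down j ++ down i.+1) ++ [:: 0])).
    by apply: weq_cat => //; apply/weq_sym/weq_DD.
  rewrite down_S -!catA; apply: weq_cat => //; rewrite -[RHS in weq _ _ RHS]cats0.
  by apply: weq_cat => //; apply: weq_K.
Qed.

(** In the normal form, the wire that ends on top starts at [i]; if it is wire 0, the prefix is
    empty. *)
Lemma stab1 N u : valid N.+1 u -> actw u 0 = 0 ->
  exists2 u', valid N u' & weq N.+1 u (map S u').
Proof.
move=> /word_route [i [u' [iN vu' uu']]] u0; exists u' => //.
suff i0 : i = 0 by rewrite i0 in uu'.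
by apply: (@actw_inj u); rewrite u0 uu'.2 actw_cat actw_D actw_S0.
Qed.

Lemma stab2 N u : valid N.+2 u -> actw u 0 = 0 -> actw u 1 = 1 ->
  exists2 u', valid N u' & weq N.+2 u (map S (map S u')).
Proof.
move=> vu u0 u1; have [u' vu' uu'] := stab1 vu u0.
have u'0 : actw u' 0 = 0 by apply: succn_inj; rewrite -actw_S -uu'.2.
have [u'' vu'' uu''] := stab1 vu' u'0; exists u'' => //.
exact: weq_trans uu' (weq_S uu'').
Qed.

Lemma actw_D_gt i j : i < j -> actw (down i) j = j.
Proof.
elim: i => //= i IH ij; rewrite trN ?gtn_eqF ?IH //; exact: ltnW.
Qed.

Lemma actw_D_lt i j : j < i -> actw (down i) j = j.+1.
Proof.
elim: i => //= i IH; rewrite ltnS leq_eqVlt => /predU1P [->|ji].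
  by rewrite trL actw_D_gt.
by rewrite trN ?IH // ltn_eqF // ltnW.
Qed.

(** The position of wire [j] among the others once wire [i] is taken out. *)
Definition skip i j := if j < i then j else j.-1.

Lemma actw_D_skip i j : j != i -> actw (down i) j = (skip i j).+1.
Proof.
rewrite /skip neq_ltn => /orP [ji|ij].
  by rewrite ji actw_D_lt.
by rewrite ltnNge (ltnW ij) actw_D_gt // prednK // (leq_ltn_trans _ ij).
Qed.

Lemma tr_lt N a x : a.+1 < N -> x < N -> tr a x < N.
Proof.
move=> aN xN; rewrite /tr; case: eqP => // _; case: eqP => // _.
exact: ltnW.
Qed.

Lemma actw_lt N u x : valid N u -> x < N -> actw u x < N.
Proof.
elim: u x => //= a u IH x /andP [aN vu] xN; apply: IH => //; exact: tr_lt.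
Qed.

Lemma skip_lt N i j : i < N.+1 -> j < N.+1 -> j != i -> skip i j < N.
Proof.
move=> iN jN ji; have := @actw_lt N.+1 (down i) j (valid_D iN) jN.
by rewrite actw_D_skip.
Qed.

Lemma routing N s : uniq s -> all (fun i => i < N) s ->
  exists2 u, valid N u & forall t, t < size s -> actw u (nth 0 s t) = t.
Proof.
move: {2}(size s) (erefl (size s)) => n; elim: n s N => [|n IH] s N.
  by move/size0nil=> -> _ _; exists [::].
case: s => //= i s [sn] /andP [nis us]; case: N => // N /andP [iN sN].
have ns j : j \in s -> j != i by apply: contraL => /eqP ->.
have [|||u vu uu] := IH (map (skip i) s) N.
- by rewrite size_map.
- rewrite map_inj_in_uniq // => j k /ns ji /ns ki jk.
  by apply: (@actw_inj (down i)); rewrite !actw_D_skip // jk.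
- apply/allP => k /mapP [j js ->]; apply: skip_lt (ns _ js) => //.
  exact: (allP sN).
exists (down i ++ map S u); first by rewrite valid_cat valid_D ?valid_S.
case=> [|t] ts /=; rewrite actw_cat; first by rewrite actw_D actw_S0.
rewrite actw_D_skip ?ns ?mem_nth // actw_S; congr S.
by rewrite -(nth_map 0 0) // uu // size_map.
Qed.

Definition cj N u (x : mor N N) := swW N u >> x >> swW N (rev u).

Lemma cj_cmp N u (x y : mor N N) : cj u (x >> y) = cj u x >> cj u y.
Proof.
rewrite /cj -!mcmpA; congr (_ >> (_ >> _)).
by rewrite (mcmpA (swW N (rev u))) swW_revl mcmp1m.
Qed.

Lemma cj1 N u : cj u (mone N) = mone N.
Proof. by rewrite /cj mcmpm1 swW_rev. Qed.

Lemma cj_cat N u v (x : mor N N) : cj u (cj v x) = cj (u ++ v) x.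
Proof. by rewrite /cj rev_cat !swW_cat !mcmpA. Qed.

(* Coherence: conjugates of x by two words agree as soon as the word comparing
   them is trivial on the wires where x acts. *)
Lemma cj_eq N u r (x y : mor N N) :
  swW N (rev r ++ u) = y -> y >> x = x >> y -> cj u x = cj r x.
Proof.
move=> ey yx; rewrite /cj.
have -> : swW N u = swW N r >> y.
  by rewrite -ey swW_cat mcmpA swW_rev mcmp1m.
rewrite -(mcmpA (swW N r)) yx mcmpA -!mcmpA; congr (_ >> (_ >> _)).
by rewrite -ey swW_cat -mcmpA swW_rev mcmpm1.
Qed.

Definition route i j := down i ++ map S (down (skip i j)).

Definition gateC N i j : mor N N := cj (route i j) (at2 mcnot 0 N).
Definition gateP N i : mor N N := cj (down i) (at1 mpr 0 N).

Lemma route0 i j : actw (route i j) i = 0.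
Proof. by rewrite actw_cat actw_D actw_S0. Qed.

Lemma route1 i j : j != i -> actw (route i j) j = 1.
Proof. by move=> ji; rewrite actw_cat actw_D_skip // actw_S actw_D. Qed.

Lemma route_valid N i j : i < N -> j < N -> j != i -> valid N (route i j).
Proof.
case: N => // N iN jN ji.
by rewrite valid_cat valid_D //= valid_S valid_D // skip_lt.
Qed.

Lemma actw_revE u x y : actw u x = y -> actw (rev u) y = x.
Proof. by move<-; rewrite actw_rev. Qed.

(** The word comparing two routes fixes positions 0 and 1, so by [stab2] it acts below the gate and
    commutes with it. *)
Lemma gateC_route N u i j : i < N -> j < N -> j != i -> valid N u ->
  actw u i = 0 -> actw u j = 1 -> cj u (at2 mcnot 0 N) = gateC N i j.
Proof.
case: N => [|[|N]] // iN jN ji vu ui uj.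
  by move: iN jN ji; rewrite !ltnS !leqn0 => /eqP -> /eqP ->.
have vr := route_valid iN jN ji.
have := @stab2 N (rev (route i j) ++ u); rewrite valid_cat valid_rev vr vu.
rewrite !actw_cat (actw_revE (route0 i j)) (actw_revE (route1 ji)).
case=> // w vw [e _]; apply: cj_eq e _.
by rewrite !swW_S; apply/esym/far2.
Qed.

Lemma gateP_route N u i : i < N -> valid N u -> actw u i = 0 ->
  cj u (at1 mpr 0 N) = gateP N i.
Proof.
case: N => [|N] // iN vu ui.
have vr := valid_D iN.
have := @stab1 N (rev (down i) ++ u); rewrite valid_cat valid_rev vr vu.
rewrite !actw_cat (actw_revE (actw_D i)).
case=> // w vw [e _]; apply: cj_eq e _.
by rewrite !swW_S; apply/esym/far1.
Qed.

Lemma gateC_cj N u i j i' j' : i < N -> j < N -> j != i -> valid N u ->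
  actw u i = i' -> actw u j = j' -> cj u (gateC N i' j') = gateC N i j.
Proof.
move=> iN jN ji vu <- <-.
have ji' : actw u j != actw u i by apply: contra_neq ji => /actw_inj.
rewrite /gateC cj_cat; apply: gateC_route => //.
- by rewrite valid_cat vu route_valid ?actw_lt.
- by rewrite actw_cat route0.
- by rewrite actw_cat route1.
Qed.

Lemma gateP_cj N u i i' : i < N -> valid N u -> actw u i = i' ->
  cj u (gateP N i') = gateP N i.
Proof.
move=> iN vu <-; rewrite /gateP cj_cat; apply: gateP_route => //.
- by rewrite valid_cat vu valid_D ?actw_lt.
- by rewrite actw_cat actw_D.
Qed.

Lemma cj_nil N (x : mor N N) : cj [::] x = x.
Proof. by rewrite /cj mcmp1m; exact: mcmpm1. Qed.

Lemma gateC_adj N a : a.+1 < N -> gateC N a a.+1 = at2 mcnot a N.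
Proof.
elim: a => [|a IH] aN.
  by rewrite -(@gateC_route _ [::]) ?cj_nil // ltnW.
rewrite at2_S // -(@gateC_cj _ [:: a; a.+1] a.+1 a.+2 a a.+1) //=.
- by rewrite IH 1?ltnW // /cj /= !mcmpm1 !mcmpA.
- exact: ltnW.
- by rewrite gtn_eqF.
- by rewrite aN ltnW.
- by rewrite trR trN // ltn_eqF.
- by rewrite (@trN a) ?trR // gtn_eqF.
Qed.

Lemma gateP_adj N a : a < N -> gateP N a = at1 mpr a N.
Proof.
elim: a => [|a IH] aN; first by rewrite -(@gateP_route _ [::]) ?cj_nil.
rewrite at1_S // -(@gateP_cj _ [:: a] a.+1 a) //=.
- by rewrite IH 1?ltnW // /cj /= !mcmpm1.
- by rewrite aN.
- by rewrite trR.
Qed.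

Lemma gateC_adj' N a : a.+1 < N -> gateC N a.+1 a = at2 mcnot21 a N.
Proof.
move=> aN; rewrite -(@gateC_cj _ [:: a] a.+1 a a a.+1) //=.
- by rewrite gateC_adj // /cj /= !mcmpm1 !at2_cmp.
- exact: ltnW.
- by rewrite ltn_eqF.
- by rewrite aN.
- by rewrite trR.
- by rewrite trL.
Qed.

Lemma gateC02 b : gateC b.+3 0 2 =
  at2 mswap 1 b.+3 >> at2 mcnot 0 b.+3 >> at2 mswap 1 b.+3.
Proof.
rewrite -(@gateC_cj _ [:: 1] 0 2 0 1) // gateC_adj //.
by rewrite /cj /= !mcmpm1.
Qed.

(** Conjugation is multiplicative, so a relation between gates on arbitrary distinct wires follows
    from the same relation on the first few wires. *)
Lemma transport N s : uniq s -> all (fun i => i < N) s ->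
  exists u,
  [/\ size s <= N,
   forall a c, a < size s -> c < size s -> a != c ->
     gateC N (nth 0 s a) (nth 0 s c) = cj u (gateC N a c) &
   forall a, a < size s -> gateP N (nth 0 s a) = cj u (gateP N a)].
Proof.
move=> us sN; have [u vu uu] := routing us sN; exists u.
have lt a : a < size s -> nth 0 s a < N.
  by move=> sa; apply: (allP sN); rewrite mem_nth.
split.
- rewrite -(size_iota 0 N); apply: uniq_leq_size us _ => i /(allP sN) iN.
  by rewrite mem_iota.
- move=> a c sa sc ac; apply/esym/gateC_cj; rewrite ?lt ?uu //.
  by rewrite nth_uniq // eq_sym.
- by move=> a sa; apply/esym/gateP_cj; rewrite ?lt ?uu.
Qed.

(** * The identities on arbitrary wires *)

Lemma loc_CC : mcnot >> mcnot = mone 2.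
Proof. by rewrite -cls_cmp; apply/cls_eq; apply: CNT2. Qed.

Lemma loc_S : mcnot >> mcnot21 >> mcnot = mswap.
Proof. by rewrite /mcnot21 -!cls_cmp; apply/cls_eq; apply: CNT1. Qed.

Lemma loc_3 : (mcnot21 ** mone 1) >> (mone 1 ** mcnot) =
  (mone 1 ** mcnot) >> (mcnot21 ** mone 1).
Proof.
by rewrite /mcnot21 -!cls_cmp -!cls_tens -!cls_cmp; apply/cls_eq; apply: CNT3.
Qed.

Lemma loc_5 : (mcnot ** mone 1) >> (mone 1 ** mcnot21) =
  (mone 1 ** mcnot21) >> (mcnot ** mone 1).
Proof.
by rewrite /mcnot21 -!cls_cmp -!cls_tens -!cls_cmp; apply/cls_eq; apply: CNT5.
Qed.

Lemma loc_8 :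
  (mcnot ** mone 1) >> (mone 1 ** mcnot) >> (mcnot ** mone 1) =
  (mone 1 ** mcnot) >>
    ((mone 1 ** mswap) >> (mcnot ** mone 1) >> (mone 1 ** mswap)).
Proof. by rewrite -!cls_tens -!cls_cmp; apply/cls_eq; apply: CNT8. Qed.

Lemma ket_bra : mket >> mbra = mone 0.
Proof. by rewrite -cls_cmp; apply/cls_eq; apply: CNT6. Qed.

Lemma loc_PP : mpr >> mpr = mpr.
Proof. by rewrite /mpr mcmpA -(mcmpA mbra) ket_bra mcmpm1. Qed.

Lemma prE : mpr ** mone 1 = (mbra ** mone 1) >> (mket ** mone 1).
Proof. exact: tens_cmp1. Qed.

Lemma loc_PC : (mpr ** mone 1) >> mcnot = mcnot >> (mpr ** mone 1).
Proof.
have a : (mket ** mone 1) >> mcnot =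
    (mket ** mone 1) >> mcnot >> (mbra ** mone 1) >> (mket ** mone 1).
  by rewrite -!cls_tens -!cls_cmp; apply/cls_eq; apply: CNT4a.
have b : mcnot >> (mbra ** mone 1) =
    (mbra ** mone 1) >> (mket ** mone 1) >> mcnot >> (mbra ** mone 1).
  by rewrite -!cls_tens -!cls_cmp; apply/cls_eq; apply: CNT4b.
by rewrite prE -mcmpA a !mcmpA b.
Qed.

Lemma pr2E : mpr ** mpr ** mone 1 =
  (mbra ** mbra ** mone 1) >> (mket ** mket ** mone 1).
Proof. by rewrite -!mtens_cmp mcmp1m. Qed.

Lemma pr2_split : mpr ** mpr ** mone 1 =
  (mpr ** mone 2) >> ((mone 1 ** mpr) ** mone 1) :> mor 3 3.
Proof.
by rewrite {1}(tens_split mpr mpr) tens_cmp1 -(tA1 mpr (mone 1) (mone 1)) mtens1.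
Qed.

(** (CNT.7) made into a relation between endomorphisms: bras put in front and a ket put behind
    complete every ket and bra to a projection. *)
Lemma loc_7a :
  (mpr ** mpr ** mone 1) >> (mcnot ** mone 1) >> (mone 1 ** mcnot) >>
    (mpr ** mone 2) =
  (mpr ** mpr ** mone 1) >> (mcnot ** mone 1) >> (mpr ** mone 2) :> mor 3 3.
Proof.
have e : (mket ** mket ** mone 1) >> (mcnot ** mone 1) >> (mone 1 ** mcnot) >>
    (mbra ** mone 2) =
    (mket ** mket ** mone 1) >> (mcnot ** mone 1) >> (mbra ** mone 2).
  by rewrite -!cls_tens -!cls_cmp; apply/cls_eq; apply: CNT7a.
have p : mpr ** mone 2 = (mbra ** mone 2) >> (mket ** mone 2) :=
  tens_cmp1 2 mbra mket.
rewrite pr2E p !mcmpA.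
have := congr1 (fun x => (mbra ** mbra ** mone 1) >> x >> (mket ** mone 2)) e.
by rewrite !mcmpA.
Qed.

Lemma loc_7b :
  (mpr ** mone 2) >> (mone 1 ** mcnot) >> (mcnot ** mone 1) >>
    (mpr ** mpr ** mone 1) =
  (mpr ** mone 2) >> (mcnot ** mone 1) >> (mpr ** mpr ** mone 1) :> mor 3 3.
Proof.
have e : (mket ** mone 2) >> (mone 1 ** mcnot) >> (mcnot ** mone 1) >>
    (mbra ** mbra ** mone 1) =
    (mket ** mone 2) >> (mcnot ** mone 1) >> (mbra ** mbra ** mone 1).
  by rewrite -!cls_tens -!cls_cmp; apply/cls_eq; apply: CNT7b.
have p : mpr ** mone 2 = (mbra ** mone 2) >> (mket ** mone 2) :=
  tens_cmp1 2 mbra mket.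
rewrite pr2E p !mcmpA.
have := congr1 (fun x => (mbra ** mone 2) >> x >> (mket ** mket ** mone 1)) e.
by rewrite !mcmpA.
Qed.

(** The right side of (CNT.9) discards the third wire and creates it anew. Slid past the gate, the
    two operations meet and form the projection on that wire. *)
Lemma loc_9 :
  (mpr ** mpr ** mone 1) >> (mcnot ** mone 1) >> (mpr ** mpr ** mone 1) =
  (mpr ** mpr ** mone 1) >> (mcnot ** mone 1) >> (mpr ** mpr ** mone 1) >>
    (mone 2 ** mpr) :> mor 3 3.
Proof.
have e : (mket ** mket ** mone 1) >> (mcnot ** mone 1) >>
    (mbra ** mbra ** mone 1) =
    (mket ** mket ** mbra) >> mcnot >> (mbra ** mbra ** mket).
  by rewrite -!cls_tens -!cls_cmp; apply/cls_eq; apply: CNT9.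
have k : mket ** mket ** mbra = (mket ** mket ** mone 1) >> (mone 2 ** mbra).
  exact: (tens_split (mket ** mket) mbra).
have b : mbra ** mbra ** mket = (mone 2 ** mket) >> (mbra ** mbra ** mone 1).
  by have := tens_swap (mbra ** mbra) mket; rewrite -tens_split.
have c : (mone 2 ** mbra) >> mcnot >> (mone 2 ** mket) =
    (mcnot ** mone 1) >> (mone 2 ** mpr).
  have c0 : mcnot ** mone 0 = mcnot by have := mtensm0 mcnot; rewrite mcast_id.
  have := tens_swap mcnot mbra; rewrite c0 => <-.
  rewrite -mcmpA; congr (_ >> _).
  by rewrite -(mtens_cmp (mone 2) (mone 2) mbra mket) mcmp1m.
have s : (mone 2 ** mpr) >> (mpr ** mpr ** mone 1) =
    (mpr ** mpr ** mone 1) >> (mone 2 ** mpr) by apply/esym/tens_swap.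
rewrite -[RHS]mcmpA -s !mcmpA.
rewrite -(mcmpA (mpr ** mpr ** mone 1) (mcnot ** mone 1) (mone 2 ** mpr)) -c.
rewrite !pr2E !mcmpA.
have := congr1 (fun x => (mbra ** mbra ** mone 1) >> x >>
  (mket ** mket ** mone 1)) e.
by rewrite k b !mcmpA.
Qed.

Lemma msym00 : msym 0 0 = mone 0.
Proof.
have e1 : msym 0 0 = (msym 0 0 : mor 0 0) >> msym 0 0.
  have e0 : msym 0 0 ** mone 0 = msym 0 0.
    by have := mtensm0 (msym 0 0 : mor 0 0); rewrite mcast_id.
  by have := mhexagon 0 0 0; rewrite !mcast_id e0 (mtens0m (msym 0 0)).
have e2 : msym 0 0 >> msym 0 0 = mone 0 := msymK 0 0.
by rewrite e1.
Qed.

Lemma loc_PPS : (mpr ** mpr) >> mswap = mpr ** mpr.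
Proof.
have kk : (mket ** mket) >> mswap = mket ** mket.
  have := msym_nat mket mket; rewrite msym00.
  by rewrite (mcmp1m (mket ** mket : mor 0 2)).
by rewrite (mtens_cmp mbra mket mbra mket) -mcmpA kk.
Qed.

Lemma loc_S' : mcnot21 >> mcnot >> mcnot21 = mswap.
Proof.
have := congr1 (fun x => mswap >> x >> mswap) loc_S.
by rewrite swapK mcmp1m => h; rewrite -[RHS]h /mcnot21 !mcmpA.
Qed.

Lemma at1_3_0 g b : at1 g 0 b.+3 = (g ** mone 2) ** mone b :> mor b.+3 b.+3.
Proof. by rewrite -(tA1 g (mone 2) (mone b)) /= -(mtens1 2 b). Qed.

Lemma at1_3_1 g b :
  at1 g 1 b.+3 = ((mone 1 ** g) ** mone 1) ** mone b :> mor b.+3 b.+3.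
Proof.
rewrite -(tA2 (mone 1 ** g) (mone 1) (mone b)) (mtens1 1 b).
exact: (tA1 (mone 1) g (mone b.+1)).
Qed.

Lemma at1_3_2 g b : at1 g 2 b.+3 = (mone 2 ** g) ** mone b :> mor b.+3 b.+3.
Proof. by rewrite -(tA2 (mone 2) g (mone b)) /= up_up. Qed.

Lemma at1_2_0 g b : at1 g 0 b.+2 = (g ** mone 1) ** mone b :> mor b.+2 b.+2.
Proof. by rewrite -(tA1 g (mone 1) (mone b)) /= -(mtens1 1 b). Qed.

Lemma at1_2_1 g b : at1 g 1 b.+2 = (mone 1 ** g) ** mone b :> mor b.+2 b.+2.
Proof. exact: (tA1 (mone 1) g (mone b)). Qed.

Section Relations.
Variable N : nat.
Implicit Types i j k l : nat.
Local Notation C := (gateC N).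
Local Notation P := (gateP N).

Lemma transport2 i j : i < N -> j < N -> i != j -> exists u b,
  [/\ N = b.+2, C i j = cj u (C 0 1), C j i = cj u (C 1 0),
      P i = cj u (P 0) & P j = cj u (P 1)].
Proof.
move=> iN jN ij; have [||u [sN hC hP]] := @transport N [:: i; j].
- by rewrite /= inE ij.
- by rewrite /= iN jN.
exists u, N.-2; split.
- by case: N sN => [|[|b]].
- exact: (hC 0 1).
- exact: (hC 1 0).
- exact: (hP 0).
- exact: (hP 1).
Qed.

Lemma transport3 i j k : i < N -> j < N -> k < N ->
  i != j -> j != k -> i != k -> exists u b,
  [/\ N = b.+3, C i j = cj u (C 0 1), C j k = cj u (C 1 2) & 
   [/\ C i k = cj u (C 0 2), C j i = cj u (C 1 0), C k j = cj u (C 2 1),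
      P i = cj u (P 0) & P j = cj u (P 1) /\ P k = cj u (P 2)]].
Proof.
move=> iN jN kN ij jk ik; have [||u [sN hC hP]] := @transport N [:: i; j; k].
- by rewrite /= !inE negb_or ij ik jk.
- by rewrite /= iN jN kN.
exists u, N.-2.-1; split.
- by case: N sN => [|[|[|b]]].
- exact: (hC 0 1).
- exact: (hC 1 2).
- split; [exact: (hC 0 2) | exact: (hC 1 0) | exact: (hC 2 1) | exact: (hP 0) |].
  by split; [exact: (hP 1) | exact: (hP 2)].
Qed.

Lemma rel_CC i j : i < N -> j < N -> i != j -> C i j >> C i j = mone N.
Proof.
move=> iN jN ij; have [u [b [Nb -> _ _ _]]] := transport2 iN jN ij.
by rewrite -cj_cmp gateC_adj ?Nb // -at2_cmp loc_CC at2_1 cj1.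
Qed.

Lemma rel_CCC i j k : i < N -> j < N -> k < N -> i != j -> j != k -> i != k ->
  C i j >> C j k >> C i j = C j k >> C i k.
Proof.
move=> iN jN kN ij jk ik.
have [u [b [Nb -> -> [-> _ _ _ _]]]] := transport3 iN jN kN ij jk ik.
rewrite -!(cj_cmp u); congr cj; case: _ / (esym Nb).
rewrite gateC02 !gateC_adj // !at2_3_0 !at2_3_1.
by have := congr1 (fun x => x ** mone b) loc_8; rewrite !(tens_cmp1 b) !mcmpA.
Qed.

Lemma rel_CcommC i j k l : i < N -> j < N -> k < N -> l < N ->
  i != j -> k != l -> i != l -> j != k -> C i j >> C k l = C k l >> C i j.
Proof.
move=> iN jN kN lN ij kl il jk.
have [ik|ik] := eqVneq i k; have [jl|jl] := eqVneq j l; subst => //.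
- have ji : j != k by [].
  have [u [b [Nb _ -> [_ -> _ _ _]]]] := transport3 jN kN lN ji kl jl.
  rewrite -!(cj_cmp u); congr cj; case: _ / (esym Nb).
  rewrite gateC_adj' // !gateC_adj // !at2_3_0 !at2_3_1.
  by have := congr1 (fun x => x ** mone b) loc_3; rewrite !(tens_cmp1 b).
- have jk' : l != k by rewrite eq_sym.
  have [u [b [Nb -> _ [_ _ -> _ _]]]] := transport3 iN lN kN ij jk' ik.
  rewrite -!(cj_cmp u); congr cj; case: _ / (esym Nb).
  rewrite gateC_adj' // !gateC_adj // !at2_3_0 !at2_3_1.
  by have := congr1 (fun x => x ** mone b) loc_5; rewrite !(tens_cmp1 b).
- have [||u [sN hC _]] := @transport N [:: i; j; k; l].
  + by rewrite /= !inE !negb_or ij ik il jk jl kl.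
  + by rewrite /= iN jN kN lN.
  have /= -> := hC 0 1 isT isT isT; have /= -> := hC 2 3 isT isT isT.
  have N1 : 1 < N by apply: leq_trans sN.
  by rewrite -!(cj_cmp u) (gateC_adj N1) (gateC_adj sN) at2_comm.
Qed.

Definition gateS i j := C i j >> C j i >> C i j.

Lemma rel_SC i j : i < N -> j < N -> i != j -> gateS i j = gateS j i.
Proof.
move=> iN jN ij; rewrite /gateS.
have [u [b [Nb -> -> _ _]]] := transport2 iN jN ij.
rewrite -!(cj_cmp u) gateC_adj ?gateC_adj' ?Nb // -!at2_cmp.
by rewrite loc_S loc_S'.
Qed.

Lemma rel_PS i j : i < N -> j < N -> i != j ->
  P i >> gateS i j = gateS i j >> P j.
Proof.
move=> iN jN ij; rewrite /gateS.
have [u [b [Nb -> -> -> ->]]] := transport2 iN jN ij.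
rewrite -!(cj_cmp u) gateC_adj ?gateC_adj' ?gateP_adj ?Nb // -!at2_cmp.
by rewrite loc_S at1_S ?Nb // -/(sw 0 _) !mcmpA swK mcmp1m.
Qed.

Lemma rel_PPS i j : i < N -> j < N -> i != j ->
  P i >> P j >> gateS i j = P i >> P j.
Proof.
move=> iN jN ij; rewrite /gateS.
have [u [b [Nb -> -> -> ->]]] := transport2 iN jN ij.
rewrite -!(cj_cmp u); congr cj; case: _ / (esym Nb).
rewrite gateC_adj ?gateC_adj' ?gateP_adj // -!at2_cmp loc_S.
rewrite at1_2_0 at1_2_1 /=.
have := congr1 (fun x => x ** mone b) loc_PPS.
by rewrite (tens_split mpr mpr) !(tens_cmp1 b).
Qed.

Lemma rel_PP i : i < N -> P i >> P i = P i.
Proof.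
move=> iN; rewrite -cj_cmp; congr cj.
by rewrite -at1_cmp loc_PP.
Qed.

Lemma rel_PcommP i j : i < N -> j < N -> i != j -> P i >> P j = P j >> P i.
Proof.
move=> iN jN ij; have [u [b [Nb _ _ -> ->]]] := transport2 iN jN ij.
by rewrite -!(cj_cmp u) !gateP_adj ?Nb // at1_comm.
Qed.

Lemma rel_PC i j : i < N -> j < N -> i != j -> P i >> C i j = C i j >> P i.
Proof.
move=> iN jN ij; have [u [b [Nb -> _ -> _]]] := transport2 iN jN ij.
rewrite -!(cj_cmp u); congr cj; case: _ / (esym Nb).
rewrite gateC_adj ?gateP_adj // at1_2_0 /=.
by have := congr1 (fun x => x ** mone b) loc_PC; rewrite !(tens_cmp1 b).
Qed.

Lemma rel_PcommC i j k : i < N -> j < N -> k < N -> i != j -> k != i ->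
  k != j -> P k >> C i j = C i j >> P k.
Proof.
move=> iN jN kN ij ki kj; rewrite eq_sym in ki; rewrite eq_sym in kj.
have [u [b [Nb -> _ [_ _ _ _ [_ ->]]]]] := transport3 iN jN kN ij kj ki.
by rewrite -!(cj_cmp u) gateC_adj ?gateP_adj ?Nb // at21_comm.
Qed.

(** [loc_7a] has an additional [P i] at the end; it commutes back to the front, where idempotence
    removes it. *)
Lemma rel_PPCC i j k : i < N -> j < N -> k < N -> i != j -> j != k -> i != k ->
  P i >> P j >> C i j >> C j k = P i >> P j >> C i j.
Proof.
move=> iN jN kN ij jk ik.
have h : P i >> P j >> C i j >> C j k >> P i = P i >> P j >> C i j >> P i.
  have [u [b [Nb -> -> [_ _ _ -> [-> _]]]]] := transport3 iN jN kN ij jk ik.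
  rewrite -!(cj_cmp u); congr cj; case: _ / (esym Nb).
  rewrite !gateC_adj // !gateP_adj // !at2_3_0 !at2_3_1 at1_3_0 at1_3_1.
  have := congr1 (fun x => x ** mone b) loc_7a.
  by rewrite pr2_split !(tens_cmp1 b).
have PCjk : C j k >> P i = P i >> C j k.
  by apply/esym/rel_PcommC.
have PCij := rel_PC iN jN ij; have PP := rel_PcommP iN jN ij.
have PPi := rel_PP iN.
move: (P i) (P j) (C i j) (C j k) h PCjk PCij PP PPi => p q c d h pd pc pq pp.
have k1 : p >> q >> c >> p = p >> q >> c.
  by rewrite -!mcmpA -pc (mcmpA q) -pq !mcmpA pp.
by rewrite -[RHS]k1 -h -(mcmpA _ d p) pd mcmpA k1.
Qed.

Lemma rel_CCPP i j k : i < N -> j < N -> k < N -> i != j -> j != k -> i != k ->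
  C j k >> (C i j >> (P i >> P j)) = C i j >> (P i >> P j).
Proof.
move=> iN jN kN ij jk ik.
have h : P i >> C j k >> C i j >> (P i >> P j) = P i >> C i j >> (P i >> P j).
  have [u [b [Nb -> -> [_ _ _ -> [-> _]]]]] := transport3 iN jN kN ij jk ik.
  rewrite -!(cj_cmp u); congr cj; case: _ / (esym Nb).
  rewrite !gateC_adj // !gateP_adj // !at2_3_0 !at2_3_1 at1_3_0 at1_3_1.
  have := congr1 (fun x => x ** mone b) loc_7b.
  by rewrite pr2_split !(tens_cmp1 b).
have PCjk : P i >> C j k = C j k >> P i by apply: rel_PcommC.
have PCij := rel_PC iN jN ij.
have PPi := rel_PP iN.
move: (P i) (P j) (C i j) (C j k) h PCjk PCij PPi => p q c d h pd pc pp.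
have k1 : p >> (c >> (p >> q)) = c >> (p >> q).
  by rewrite mcmpA pc -mcmpA (mcmpA p p) pp.
by rewrite -k1 [LHS]mcmpA -pd [RHS]mcmpA -h !mcmpA.
Qed.

Lemma rel_PPCPP i j k : i < N -> j < N -> k < N ->
  i != j -> j != k -> i != k ->
  P i >> P j >> C i j >> (P i >> P j) >> P k =
  P i >> P j >> C i j >> (P i >> P j).
Proof.
move=> iN jN kN ij jk ik.
have [u [b [Nb -> _ [_ _ _ -> [-> ->]]]]] := transport3 iN jN kN ij jk ik.
rewrite -!(cj_cmp u); congr cj; case: _ / (esym Nb).
rewrite !gateC_adj // !gateP_adj // !at2_3_0 at1_3_0 at1_3_1 at1_3_2.
have := congr1 (fun x => x ** mone b) loc_9.
by rewrite pr2_split !(tens_cmp1 b).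
Qed.

End Relations.

Section CircuitMonoid.
Variables (N : nat) (W : finType) (v : W -> nat).
Hypotheses (vN : forall w, v w < N) (vi : injective v).

Let vn i j : i != j -> v i != v j. Proof. by rewrite (inj_eq vi). Qed.

Definition circuit_monoid : @cnot_monoid W (fun i j => i != j).
Proof.
exists (mor N N) (@mcmp N N N) (mone N) (fun i j => gateC N (v i) (v j))
  (fun i => gateP N (v i)).
- exact: mcmpA.
- exact: mcmp1m.
- exact: mcmpm1.
- by move=> *; apply: rel_CC; rewrite ?vn.
- by move=> *; apply: rel_CcommC; rewrite ?vn.
- by move=> *; apply: rel_CCC; rewrite ?vn.
- by move=> *; apply: rel_SC; rewrite ?vn.
- by move=> *; apply: rel_PS; rewrite ?vn.
- by move=> *; apply: rel_PPS; rewrite ?vn.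
- by move=> *; apply: rel_PP.
- by move=> *; apply: rel_PcommP; rewrite ?vn.
- by move=> *; apply: rel_PC; rewrite ?vn.
- by move=> *; apply: rel_PcommC; rewrite ?vn.
- by move=> *; apply: rel_PPCC; rewrite ?vn.
- by move=> *; apply: rel_CCPP; rewrite ?vn.
- by move=> *; apply: rel_PPCPP; rewrite ?vn.
Defined.

End CircuitMonoid.

Lemma mcast_cmp m m' n n' p p' (em : m = m') (en : n = n') (ep : p = p')
  (u : mor m n) (v : mor n p) :
  mcast em ep (u >> v) = mcast em en u >> mcast en ep v.
Proof. by case: m' / em; case: n' / en; case: p' / ep. Qed.

Lemma mcast_up m m' n n' (em : m = m') (en : n = n') (u : mor m n) :
  up (mcast em en u) = mcast (congr1 S em) (congr1 S en) (up u).
Proof. by case: m' / em; case: n' / en. Qed.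

Lemma mcast_irr m m' n n' (em em' : m = m') (en en' : n = n') (u : mor m n) :
  mcast em en u = mcast em' en' u.
Proof. by rewrite (eq_irrelevance em em') (eq_irrelevance en en'). Qed.

Lemma mcast_end (F : forall N, mor N N) N N' (e e' : N = N') :
  mcast e e' (F N) = F N'.
Proof. by rewrite (eq_irrelevance e' e); case: N' / e {e'}. Qed.

(** * Reduction to endomorphisms *)

Fixpoint ketk k : mor 0 k := if k is k'.+1 then mket ** ketk k' else mone 0.
Fixpoint brak k : mor k 0 := if k is k'.+1 then mbra ** brak k' else mone 0.
(** Defined by recursion on [m] because [mone m ** ketk k] has source [m + 0], which is not
    convertible to [m]. *)
Fixpoint km m k : mor m (m + k) :=
  if m is m'.+1 then up (km m' k) else ketk k.
Fixpoint bm m k : mor (m + k) m :=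
  if m is m'.+1 then up (bm m' k) else brak k.

Lemma ketk_brak k : ketk k >> brak k = mone 0.
Proof.
elim: k => [|k IH] /=; first exact: mcmp1m.
have := mtens_cmp mket mbra (ketk k) (brak k); rewrite IH ket_bra => <-.
exact (mtens1 0 0).
Qed.

Lemma km_bm m k : km m k >> bm m k = mone m.
Proof.
elim: m => [|m IH] /=; first exact: ketk_brak.
by rewrite -up_cmp IH up1.
Qed.

Lemma bmE m k : bm m k = mcast erefl (addn0 m) (mone m ** brak k).
Proof.
elim: m => [|m IH]; first by rewrite mcast_id mtens0m.
rewrite -[bm m.+1 k]/(up (bm m k)) IH mcast_up -(mtens1 1 m).
rewrite -(tA1 (mone 1) (mone m) (brak k)).
exact: mcast_irr.
Qed.

Lemma bm_nat m n k (u : mor m n) : (u ** mone k) >> bm n k = bm m k >> u.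
Proof.
have e := tens_swap u (brak k); rewrite !bmE.
have -> : (u ** mone k) >> mcast erefl (addn0 n) (mone n ** brak k) =
    mcast erefl (addn0 n) ((u ** mone k) >> (mone n ** brak k)).
  by rewrite (@mcast_cmp _ _ _ _ _ _ erefl erefl).
by rewrite e (@mcast_cmp _ _ _ _ _ _ erefl (addn0 m)) mtensm0.
Qed.

(** Generators with identity wires above and below. A tensor product is a composite of two padded
    morphisms, so [adj_emb] meets one elementary gate at a time. *)
Inductive gen : forall m n, mor m n -> Prop :=
| gen1 n : gen (mone n)
| genM m n p (u : mor m n) (v : mor n p) : gen u -> gen v -> gen (u >> v)
| gen_up m n (u : mor m n) : gen u -> gen (up u)
| gen_cnot b : @gen b.+2 b.+2 (mcnot ** mone b)
| gen_swap b : @gen b.+2 b.+2 (mswap ** mone b)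
| gen_ket b : @gen b b.+1 (mket ** mone b)
| gen_bra b : @gen b.+1 b (mbra ** mone b).

Lemma gen_cast m m' n n' (em : m = m') (en : n = n') (u : mor m n) :
  gen (mcast em en u) <-> gen u.
Proof. by case: m' / em; case: n' / en. Qed.

Lemma gen_tensl m n q (u : mor m n) : gen u -> gen (u ** mone q).
Proof.
elim=> {m n u} [n|m n p u v _ IHu _ IHv|m n u _ IH|b|b|b|b].
- rewrite mtens1; exact: gen1.
- by rewrite tens_cmp1; apply: genM.
- by have := gen_up IH; rewrite up_tens.
- by have := gen_cnot (b + q); rewrite -mtens1 (tA2 mcnot (mone b) (mone q)).
- by have := gen_swap (b + q); rewrite -mtens1 (tA2 mswap (mone b) (mone q)).
- by have := gen_ket (b + q); rewrite -mtens1 (tAket (mone b) (mone q)).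
- by have := gen_bra (b + q); rewrite -mtens1 (tAbra (mone b) (mone q)).
Qed.

Lemma gen_tensr m n p (u : mor m n) : gen u -> gen (mone p ** u).
Proof.
move=> gu; elim: p => [|p IH]; first by rewrite mtens0m.
have := gen_up IH; rewrite /up (tA1 (mone 1) (mone p) u).
by rewrite (mtens1 1 p).
Qed.

(** The hexagon decomposes a symmetry in its second argument only. [msym m 1] is reached as the
    inverse of [msym 1 m], so inverses of generated morphisms must be known to be generated. *)
Definition ginv m n (u : mor m n) :=
  gen u /\ exists2 v : mor n m, gen v & u >> v = mone m /\ v >> u = mone n.

Lemma ginv_unique m n (u : mor m n) (v : mor n m) :
  ginv u -> u >> v = mone m -> gen v.
Proof.
move=> [_ [w gw [_ wu]]] uv; suff <- : w = v by [].
by rewrite -[w]mcmpm1 -uv mcmpA wu mcmp1m.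
Qed.

Lemma ginv_1 n : ginv (mone n).
Proof.
by split; [apply: gen1 | exists (mone n); rewrite ?mcmp1m //; apply: gen1].
Qed.

Lemma ginvM m n p (u : mor m n) (v : mor n p) : ginv u -> ginv v -> ginv (u >> v).
Proof.
move=> [gu [u' gu' [e1 e2]]] [gv [v' gv' [e3 e4]]]; split; first exact: genM.
exists (v' >> u'); first exact: genM.
split.
  by rewrite mcmpA -(mcmpA u) e3 mcmpm1.
by rewrite mcmpA -(mcmpA v') e2 mcmpm1.
Qed.

Lemma ginv_up m n (u : mor m n) : ginv u -> ginv (up u).
Proof.
move=> [gu [v gv [e1 e2]]]; split; first exact: gen_up.
by exists (up v); [apply: gen_up | rewrite -!up_cmp e1 e2 !up1].
Qed.

Lemma ginv_tensl m n q (u : mor m n) : ginv u -> ginv (u ** mone q).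
Proof.
move=> [gu [v gv [e1 e2]]]; split; first exact: gen_tensl.
by exists (v ** mone q); [apply: gen_tensl | rewrite -!tens_cmp1 e1 e2 !mtens1].
Qed.

Lemma ginv_swap : ginv mswap.
Proof.
have g : gen mswap.
  have := gen_swap 0; suff -> : mswap ** mone 0 = mswap by [].
  by have := mtensm0 mswap; rewrite mcast_id.
by split=> //; exists mswap => //; rewrite swapK.
Qed.

Lemma ginv_sym1 n : ginv (msym 1 n).
Proof.
elim: n => [|n IH]; first by rewrite msym10; apply: ginv_1.
have := mhexagon 1 1 n; rewrite !mcast_id => e.
suff : ginv (msym 1 (1 + n)) by [].
rewrite e; exact: ginvM (ginv_tensl n ginv_swap) (ginv_up IH).
Qed.

Lemma ginv_sym0 n : ginv (msym 0 n).
Proof.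
elim: n => [|n IH]; first by rewrite msym00; apply: ginv_1.
have := mhexagon 0 1 n; rewrite !mcast_id => e.
suff : ginv (msym 0 (1 + n)) by [].
rewrite e msym01 mtens1; exact: ginvM (ginv_1 n.+1) (ginv_up IH).
Qed.

Lemma gen_sym m n : gen (msym m n).
Proof.
elim: n => [|n IH]; first exact: ginv_unique (ginv_sym0 m) (msymK 0 m).
apply/(gen_cast (addnA m 1 n) erefl); rewrite (mhexagon m 1 n); apply: genM.
  by apply: gen_tensl; apply: ginv_unique (ginv_sym1 m) (msymK 1 m).
by apply/gen_cast; apply: gen_up.
Qed.

Lemma gen_all m n (u : mor m n) : gen u.
Proof.
apply: (@mor_ind gen) => {m n u}.
- exact: gen1.
- exact: genM.
- by move=> m n p q u v gu gv; rewrite tens_split; apply: genM;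
    [apply: gen_tensl | apply: gen_tensr].
- exact: gen_sym.
- have := gen_cnot 0; suff -> : mcnot ** mone 0 = mcnot by [].
  by have := mtensm0 mcnot; rewrite mcast_id.
- have := gen_ket 0; suff -> : mket ** mone 0 = mket by [].
  by have := mtensm0 mket; rewrite mcast_id.
- have := gen_bra 0; suff -> : mbra ** mone 0 = mbra by [].
  by have := mtensm0 mbra; rewrite mcast_id.
Qed.

Inductive adj N : mor N N -> Prop :=
| adj1 : adj (mone N)
| adjM u v : adj u -> adj v -> adj (u >> v)
| adj_cnot a : a.+1 < N -> adj (at2 mcnot a N)
| adj_swap a : a.+1 < N -> adj (at2 mswap a N)
| adj_pr a : a < N -> adj (at1 mpr a N).

Lemma adj_up N (u : mor N N) : adj u -> adj (up u).
Proof.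
elim=> {u} [|u v _ IHu _ IHv|a aN|a aN|a aN].
- by rewrite up1; apply: adj1.
- by rewrite up_cmp; apply: adjM.
- exact: (@adj_cnot N.+1 a.+1).
- exact: (@adj_swap N.+1 a.+1).
- exact: (@adj_pr N.+1 a.+1).
Qed.

Lemma adj_cast N N' (e e' : N = N') (u : mor N N) : adj u -> adj (mcast e e' u).
Proof. by rewrite (eq_irrelevance e' e); case: N' / e {e'}. Qed.

Lemma adj_swW N u : valid N u -> adj (swW N u).
Proof.
elim: u => [|a u IH] /=; first by move=> _; apply: adj1.
by case/andP=> aN vu; apply: adjM; [apply: adj_swap | apply: IH].
Qed.

Lemma adj_bmkm m k : adj (bm m k >> km m k).
Proof.
elim: m => [|m IH] /=; last by rewrite -up_cmp; apply: adj_up.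
elim: k => [|k IH] /=; first by rewrite mcmp1m; apply: adj1.
rewrite -(mtens_cmp mbra mket (brak k) (ketk k)) -/mpr tens_split.
by apply: adjM; [apply: (@adj_pr k.+1 0) | apply: adj_up].
Qed.

Lemma ket_swap : (mone 1 ** mket) >> mswap = mket ** mone 1.
Proof.
have := msym_nat (mone 1) mket; rewrite msym10.
by rewrite (mcmp1m (mket ** mone 1 : mor 1 2)).
Qed.

Lemma swap_bra : mswap >> (mone 1 ** mbra) = mbra ** mone 1.
Proof.
have := msym_nat mbra (mone 1); rewrite msym01.
by rewrite (mcmpm1 (mbra ** mone 1 : mor 2 1)).
Qed.

Lemma ket_move b l :
  mcast erefl (addSnnS b l) ((mket ** mone b) >> km b.+1 l) =
  km b l.+1 >> swW (b + l.+1) (down b).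
Proof.
elim: b => [|b IH].
  rewrite mcast_id /= mcmpm1; exact (esym (tens_split mket (ketk l))).
rewrite down_S swW_cat [swW _ [:: 0]]/= mcmpm1 (swW_S (b + l.+1)) mcmpA.
rewrite -[km b.+1 l.+1]/(up (km b l.+1)) -up_cmp -IH mcast_up.
rewrite -(mcast_end (sw 0) (congr1 S (addSnnS b l)) (congr1 S (addSnnS b l))).
rewrite -mcast_cmp.
suff -> : up ((mket ** mone b) >> km b.+1 l) >> sw 0 (b.+1 + l).+1 =
    (mket ** mone b.+1) >> km b.+2 l by exact: mcast_irr.
rewrite up_cmp -mcmpA -[up (km b.+1 l)]/(up (up (km b l))) up_up.
have <- : (mswap ** mone b) >> (mone 2 ** km b l) =
  (mone 2 ** km b l) >> sw 0 (b.+1 + l).+1 by exact: tens_swap.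
rewrite mcmpA -[km b.+2 l]/(up (up (km b l))) up_up; congr (_ >> _).
rewrite up_tens -(tens_cmp1 b (up mket) mswap) ket_swap.
by rewrite -(tAket (mone 1) (mone b)) (mtens1 1 b).
Qed.

Lemma bra_move b k :
  mcast (addSnnS b k) erefl (bm b.+1 k >> (mbra ** mone b)) =
  swW (b + k.+1) (rev (down b)) >> bm b k.+1.
Proof.
elim: b => [|b IH].
  rewrite mcast_id /= mcmp1m.
  by have := tens_swap mbra (brak k); rewrite -tens_split => <-.
rewrite down_S rev_cat -map_rev swW_cat [swW _ (rev [:: 0])]/= mcmpm1.
rewrite (swW_S (b + k.+1)) -mcmpA.
rewrite -[bm b.+1 k.+1]/(up (bm b k.+1)) -up_cmp -IH mcast_up.
rewrite -(mcast_end (sw 0) (congr1 S (addSnnS b k)) (congr1 S (addSnnS b k))).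
rewrite -mcast_cmp.
suff -> : sw 0 (b.+1 + k).+1 >> up (bm b.+1 k >> (mbra ** mone b)) =
    bm b.+2 k >> (mbra ** mone b.+1) by exact: mcast_irr.
rewrite up_cmp mcmpA -[up (bm b.+1 k)]/(up (up (bm b k))) up_up.
have -> : sw 0 (b.+1 + k).+1 >> (mone 2 ** bm b k) =
  (mone 2 ** bm b k) >> (mswap ** mone b) by exact: (tens_swap mswap (bm b k)).
rewrite -mcmpA -[bm b.+2 k]/(up (up (bm b k))) up_up; congr (_ >> _).
rewrite (up_tens mbra (mone b)) -(tens_cmp1 b mswap (up mbra)) swap_bra.
by rewrite -(tAbra (mone 1) (mone b)) (mtens1 1 b).
Qed.

Lemma mcast_comp m m' m'' n n' n'' (e1 : m = m') (e2 : m' = m'')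
  (f1 : n = n') (f2 : n' = n'') (u : mor m n) :
  mcast e2 f2 (mcast e1 f1 u) = mcast (etrans e1 e2) (etrans f1 f2) u.
Proof. by case: m'' / e2; case: n'' / f2. Qed.

Lemma emb2 (g : mor 2 2) b : (forall N, 1 < N -> adj (at2 g 0 N)) ->
  exists K, forall k l (e : b.+2 + k = b.+2 + l), K <= b.+2 + k ->
  adj (mcast e erefl (bm b.+2 k >> (g ** mone b) >> km b.+2 l)).
Proof.
move=> ag; exists 0 => k l e _; have kl := addnI e; subst l.
rewrite mcast_id -(bm_nat k (g ** mone b : mor b.+2 b.+2)) -mcmpA.
apply: adjM; last exact: adj_bmkm.
have := ag (b.+2 + k) isT; rewrite /= -mtens1.
by rewrite (tA2 g (mone b) (mone k)).
Qed.

Lemma ltn_addn b l : b < b + l.+1.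
Proof. by rewrite addnS ltnS leq_addr. Qed.

(* Wires created or discarded by u are taken from the padding at the bottom. *)
Lemma adj_emb m n (u : mor m n) : exists K, forall k l (e : m + k = n + l),
  K <= m + k -> adj (mcast e erefl (bm m k >> u >> km n l)).
Proof.
elim: (gen_all u) => {m n u} [n|m n p u v _ [K1 IHu] _ [K2 IHv]|m n u _ [K IH]
  |b|b|b|b].
- exists 0 => k l e _; have kl := addnI e; subst l.
  by rewrite mcast_id mcmpm1; apply: adj_bmkm.
(* The intermediate arity [n] has to fit into the same total number of wires; the padding between
   the two factors cancels by [km_bm]. *)
- exists (maxn n (maxn K1 K2)) => k r e.
  rewrite !geq_max => /and3P [nmk K1mk K2mk].
  have [l el] : exists l, m + k = n + l by exists (m + k - n); rewrite subnKC.
  have er : n + l = p + r by rewrite -el.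
  have K2nl : K2 <= n + l by rewrite -el.
  have := adjM (adj_cast er er (IHu _ _ el K1mk)) (IHv _ _ er K2nl).
  rewrite mcast_comp (mcast_irr _ e _ er) -(mcast_cmp e er erefl).
  rewrite -!mcmpA (mcmpA (km _ _)).
  by rewrite km_bm mcmp1m.
- exists K.+1 => k l e Kmk; have e' : m + k = n + l by apply: succn_inj.
  have := adj_up (IH k l e' Kmk); rewrite mcast_up !up_cmp.
  by rewrite (mcast_irr _ e _ erefl).
- by apply: emb2 => N; apply: adj_cnot.
- by apply: emb2 => N; apply: adj_swap.
- exists 0 => k l e _.
  have kl : k = l.+1 by apply: (@addnI b); rewrite e addSnnS.
  subst k; have := adjM (adj_bmkm b l.+1) (adj_swW (valid_D (ltn_addn b l))).
  rewrite -mcmpA -ket_move => /(adj_cast e e).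
  have -> : bm b l.+1 >> mcast erefl (addSnnS b l) ((mket ** mone b) >> km b.+1 l)
    = mcast erefl (addSnnS b l) (bm b l.+1 >> ((mket ** mone b) >> km b.+1 l)).
    by rewrite [RHS](mcast_cmp erefl erefl).
  by rewrite mcast_comp (mcast_irr _ e _ erefl) mcmpA.
- exists 0 => k l e _.
  have kl : k.+1 = l by apply: (@addnI b); rewrite -e addSnnS.
  subst l; have := adjM (adj_swW (u := rev (down b)) (N := b + k.+1) _)
    (adj_bmkm b k.+1).
  rewrite valid_rev => /(_ (valid_D (ltn_addn b k))).
  rewrite mcmpA -bra_move.
  have -> : mcast (addSnnS b k) erefl (bm b.+1 k >> (mbra ** mone b)) >> km b k.+1
    = mcast (addSnnS b k) erefl (bm b.+1 k >> (mbra ** mone b) >> km b k.+1).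
    by rewrite [RHS](mcast_cmp (addSnnS b k) erefl erefl).
  by rewrite (mcast_irr _ e _ erefl).
Qed.

(** * Semantics and faithfulness *)

Definition ocat (y z : option (seq bool)) : option (seq bool) :=
  if y is Some y' then if z is Some z' then Some (y' ++ z') else None else None.

Fixpoint sem m n (f : circuit m n) : seq bool -> option (seq bool) :=
  match f in circuit m n return seq bool -> option (seq bool) with
  | cid n => fun x => if size x == n then Some x else None
  | ccmp _ _ _ f g => fun x => obind (sem g) (sem f x)
  | ctens m _ _ _ f g => fun x => ocat (sem f (take m x)) (sem g (drop m x))
  | csym m n => fun x =>
      if size x == (m + n)%N then Some (drop m x ++ take m x) else None
  | cnot => fun x => if x is [:: a; b] then Some [:: a; a (+) b] else None
  | ket1 => fun x => if x is [::] then Some [:: true] else None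
  | bra1 => fun x => if x is [:: true] then Some [::] else None
  end.

Lemma sem_size m n (f : circuit m n) x y :
  sem f x = Some y -> size x = m /\ size y = n.
Proof.
elim: f x y => {m n} [n|m n p f IHf g IHg|m n p q f IHf g IHg|m n|||] x y /=.
- by case: eqP => // <- [<-].
- case fx: (sem f x) => [z|] //= gz.
  by have [-> _] := IHf _ _ fx; have [_ ->] := IHg _ _ gz.
- case fx: (sem f _) => [y1|] //=; case gx: (sem g _) => [y2|] //= [<-].
  have [e1 e2] := IHf _ _ fx; have [e3 e4] := IHg _ _ gx.
  by rewrite size_cat e2 e4 -{1}(cat_take_drop m x) size_cat e1 e3.
- case: eqP => // e [<-]; split=> //.
  by rewrite size_cat addnC -size_cat cat_take_drop e addnC.
- by case: x => [|a [|b [|]]] // [<-].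
- by case: x => // [[<-]].
- by case: x => [|[] [|]] // [<-].
Qed.

Lemma sem_None m n (f : circuit m n) x : size x <> m -> sem f x = None.
Proof. by case e: (sem f x) => [y|] //; have [] := sem_size e. Qed.

Lemma sem_cast m m' n n' (em : m = m') (en : n = n') (f : circuit m n) :
  sem (ccast em en f) = sem f.
Proof. by case: m' / em; case: n' / en. Qed.

Lemma sem_tens_cat m n p q (f : circuit m n) (g : circuit p q) x1 x2 :
  size x1 = m -> sem (ctens f g) (x1 ++ x2) = ocat (sem f x1) (sem g x2).
Proof. by move=> s1 /=; rewrite take_size_cat // drop_size_cat. Qed.

Lemma sem_cid n x : size x = n -> sem (cid n) x = Some x.
Proof. by move=> <- /=; rewrite eqxx. Qed.

Lemma sem_sym_cat m n x1 x2 : size x1 = m -> size x2 = n ->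
  sem (csym m n) (x1 ++ x2) = Some (x2 ++ x1).
Proof.
by move=> <- <- /=; rewrite size_cat eqxx take_size_cat // drop_size_cat.
Qed.

Lemma split_size (x : seq bool) m n : size x = (m + n)%N ->
  exists x1 x2, [/\ x = x1 ++ x2, size x1 = m & size x2 = n].
Proof.
move=> e; exists (take m x), (drop m x); rewrite cat_take_drop.
by rewrite size_takel ?size_drop e ?addKn // leq_addr.
Qed.

Lemma ceq_sem m n (f g : circuit m n) : ceq f g -> sem f =1 sem g.
Proof.
have by_size m' n' (f' g' : circuit m' n') :
    (forall x, size x = m' -> sem f' x = sem g' x) -> sem f' =1 sem g'.
  move=> fg x; case: (eqVneq (size x) m') => [/fg //|/eqP ne].
  by rewrite !sem_None.
elim=> {m n f g}.
- by [].
- by move=> m n f g _ IH x; rewrite IH.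
- by move=> m n f g h _ IH _ IH' x; rewrite IH IH'.
- by move=> m n p f f' g g' _ IH _ IH' x /=; rewrite IH; case: (sem f' x).
- by move=> m n p q f f' g g' _ IH _ IH' x /=; rewrite IH IH'.
- by move=> m n p q f g h x /=; case: (sem f x).
- by move=> m n f; apply: by_size => x sx /=; rewrite sx eqxx.
- move=> m n f x /=; case e: (sem f x) => [y|] //=.
  by have [_ ->] := sem_size e; rewrite eqxx.
- move=> m n; apply: by_size => x /split_size [x1 [x2 [-> s1 s2]]].
  rewrite sem_tens_cat // !sem_cid // size_cat s1 s2 //.
- move=> m n p m' n' p' f g f' g'.
  apply: by_size => x /split_size [x1 [x2 [-> s1 s2]]].
  rewrite sem_tens_cat //= take_size_cat // drop_size_cat //.
  case e: (sem f x1) => [y1|] //=; case e': (sem f' x2) => [y2|] //=; last first.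
    by case: (sem g y1).
  have [_ sy1] := sem_size e.
  by rewrite take_size_cat // drop_size_cat.
- move=> m n p q r s f g h; rewrite sem_cast => x.
  have sz : size x = m + (p + r) ->
      sem (ctens f (ctens g h)) x = sem (ctens (ctens f g) h) x.
    move=> /split_size [x1 [x2 [-> s1 /split_size [x3 [x4 [-> s3 s4]]]]]].
    rewrite sem_tens_cat // sem_tens_cat // catA sem_tens_cat; last first.
      by rewrite size_cat s1 s3.
    rewrite sem_tens_cat //.
    by case: (sem f x1) => //= y1; case: (sem g x3) => //= y2;
      case: (sem h x4) => //= y3; rewrite catA.
  case: (eqVneq (size x) (m + (p + r))) => [/sz //|/eqP ne].
  by rewrite !sem_None // -addnA.
- by move=> m n f; apply: by_size => x sx; rewrite /= take0 drop0;
    case: (sem f x).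
- move=> m n f; rewrite sem_cast => x.
  case: (eqVneq (size x) m) => [sx|/eqP ne]; last first.
    by rewrite !sem_None // addn0.
  rewrite -[in LHS](cats0 x) sem_tens_cat //=.
  by case: (sem f x) => //= y; rewrite cats0.
- move=> m n p q f g; apply: by_size => x /split_size [x1 [x2 [-> s1 s2]]].
  rewrite -[LHS]/(obind (sem (csym n q)) (sem (ctens f g) (x1 ++ x2))).
  rewrite -[RHS]/(obind (sem (ctens g f)) (sem (csym m p) (x1 ++ x2))).
  rewrite sem_tens_cat // sem_sym_cat // [obind _ (Some _)]/=.
  rewrite -[RHS]/(sem (ctens g f) (x2 ++ x1)) sem_tens_cat //.
  case e: (sem f x1) => [y1|]; case e': (sem g x2) => [y2|] //.
  have [_ sy1] := sem_size e; have [_ sy2] := sem_size e'.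
  exact: sem_sym_cat.
- move=> m n; apply: by_size => x /split_size [x1 [x2 [-> s1 s2]]].
  rewrite -[LHS]/(obind (sem (csym n m)) (sem (csym m n) (x1 ++ x2))).
  rewrite sem_sym_cat // sem_cid ?size_cat ?s1 ?s2 //.
  exact: sem_sym_cat.
- move=> m n p; rewrite sem_cast => x.
  case: (eqVneq (size x) (m + (n + p))) => [|/eqP ne]; last first.
    by rewrite !sem_None // -addnA.
  move=> /split_size [x1 [x2 [-> s1 /split_size [x3 [x4 [-> s3 s4]]]]]].
  rewrite sem_sym_cat //; last by rewrite size_cat s3 s4.
  set F := ctens _ _; set G := ccast _ _ _.
  rewrite -[RHS]/(obind (sem G) (sem F (x1 ++ (x3 ++ x4)))) catA sem_tens_cat.
    rewrite sem_sym_cat // sem_cid //.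
    rewrite -[RHS]/(sem G ((x3 ++ x1) ++ x4)) sem_cast -(catA x3 x1).
    rewrite sem_tens_cat //.
    by rewrite sem_cid // sem_sym_cat //= catA.
  by rewrite size_cat s1 s3.
(* The identities (CNT.1) to (CNT.9) involve at most three wires and are checked on all inputs. *)
all: apply: by_size => x.
- by case: x => [|[] [|[] []]].
- by case: x => [|[] [|[] []]].
- by case: x => [|[] [|[] [|[] []]]].
- by case: x => [|[] []].
- by case: x => [|[] [|[] []]].
- by case: x => [|[] [|[] [|[] []]]].
- by case: x.
- by case: x => [|[] []].
- by case: x => [|[] [|[] []]].
- by case: x => [|[] [|[] [|[] []]]].
- by case: x => [|[] []].
Qed.

(** * Semantics of gates and completeness for circuits *)

Definition msem m n (u : mor m n) : seq bool -> option (seq bool) :=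
  sem (repr u).

Lemma msem_cls m n (f : circuit m n) : msem (cls f) =1 sem f.
Proof. exact/ceq_sem/repr_ceq. Qed.

Lemma msem1 n x : size x = n -> msem (mone n) x = Some x.
Proof. by move=> sx; rewrite msem_cls sem_cid. Qed.

Lemma msem_cmp m n p (u : mor m n) (v : mor n p) x :
  msem (u >> v) x = obind (msem v) (msem u x).
Proof.
rewrite -{1}(reprK u) -{1}(reprK v) -cls_cmp msem_cls /=.
by case e: (sem (repr u) x); rewrite /msem e.
Qed.

Lemma msem_tens m n p q (u : mor m n) (v : mor p q) x1 x2 : size x1 = m ->
  msem (u ** v) (x1 ++ x2) = ocat (msem u x1) (msem v x2).
Proof.
move=> s1; rewrite -{1}(reprK u) -{1}(reprK v) -cls_tens msem_cls.
exact: sem_tens_cat.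
Qed.

Lemma msem_cast m m' n n' (em : m = m') (en : n = n') (u : mor m n) :
  msem (mcast em en u) = msem u.
Proof. by case: m' / em; case: n' / en. Qed.

Lemma msem_up m n (u : mor m n) c x :
  msem (up u) (c :: x) = omap (cons c) (msem u x).
Proof.
rewrite -[LHS]/(msem (mone 1 ** u) ([:: c] ++ x)) msem_tens //.
by rewrite msem1 //=; case: (msem u x).
Qed.

Definition fn N (x : seq bool) : 'I_N -> bool := fun i => nth false x i.
Definition tos N (p : 'I_N -> bool) : seq bool := [seq p i | i <- enum 'I_N].

Lemma size_tos N (p : 'I_N -> bool) : size (tos p) = N.
Proof. by rewrite size_map size_enum_ord. Qed.

Lemma tosK N (p : 'I_N -> bool) : fn (tos p) = p.
Proof.
apply: functional_extensionality => i; rewrite /fn /tos.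
by rewrite (nth_map i) ?size_enum_ord // nth_ord_enum.
Qed.

Lemma fnK N x : size x = N -> tos (@fn N x) = x.
Proof.
move=> sx; apply: (@eq_from_nth _ false) => [|k]; rewrite size_tos // => kN.
by rewrite -[LHS]/(fn (tos (@fn N x)) (Ordinal kN)) tosK.
Qed.

Definition letter_gate N (l : letter N) : mor N N :=
  match l with LC i j => gateC N i j | LP i => gateP N i end.
Definition evN N (w : seq (letter N)) : mor N N :=
  foldr (fun l x => letter_gate l >> x) (mone N) w.

Lemma evN_cat N (w w' : seq (letter N)) : evN (w ++ w') = evN w >> evN w'.
Proof. by elim: w => [|l w IH] /=; rewrite ?mcmp1m // IH mcmpA. Qed.

Lemma run_cat N (w w' : seq (letter N)) p :
  run (w ++ w') p = obind (run w') (run w p).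
Proof. by elim: w p => [|l w IH] p //=; case: (step l p). Qed.

Lemma msem_at2 (g : mor 2 2) N c d x : size x = N ->
  msem (at2 g 0 N.+2) [:: c, d & x] = ocat (msem g [:: c; d]) (Some x).
Proof.
by move=> /msem1 <-; exact: (@msem_tens 2 2 N N g (mone N) [:: c; d] x).
Qed.

Lemma msem_at1 (g : mor 1 1) N c x : size x = N ->
  msem (at1 g 0 N.+1) (c :: x) = ocat (msem g [:: c]) (Some x).
Proof.
by move=> /msem1 <-; exact: (@msem_tens 1 1 N N g (mone N) [:: c] x).
Qed.

Lemma msem_cnot a N x : a.+1 < N -> size x = N ->
  msem (at2 mcnot a N) x = Some (mkseq (fun k =>
    if k == a.+1 then nth false x a.+1 (+) nth false x a else nth false x k) N).
Proof.
elim: a N x => [|a IH] [|N] // [|c x] // aN [sx]; last first.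
  rewrite -[at2 _ _ _]/(up (at2 _ a N)) msem_up IH // [omap _ _]/=; congr Some.
  apply: (@eq_from_nth _ false) => [|[|k]]; rewrite [size (_ :: _)]/= !size_mkseq //.
  by move=> kN; rewrite (nth_mkseq _ _ kN) [nth _ (_ :: _) _]/= nth_mkseq.
case: N aN x sx => [|N] // _ [|d x] // [sx].
rewrite (msem_at2 _ c d sx) msem_cls [sem _ _]/= [ocat _ _]/=; congr Some.
apply: (@eq_from_nth _ false) => [|k]; first by rewrite size_mkseq /= sx.
rewrite [size _]/= sx => kN; rewrite nth_mkseq //.
by case: k kN => [|[|k]] //= _; rewrite addbC.
Qed.

Lemma msem_swap a N x : a.+1 < N -> size x = N ->
  msem (at2 mswap a N) x = Some (mkseq (fun k => nth false x (tr a k)) N).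
Proof.
elim: a N x => [|a IH] [|N] // [|c x] // aN [sx]; last first.
  rewrite -[at2 _ _ _]/(up (at2 _ a N)) msem_up IH // [omap _ _]/=; congr Some.
  apply: (@eq_from_nth _ false) => [|[|k]]; rewrite [size (_ :: _)]/= !size_mkseq //.
  move=> kN; rewrite (nth_mkseq _ _ kN) [nth _ (_ :: _) _]/= nth_mkseq //.
  by rewrite -[tr a.+1 k.+1]/(actw (map S [:: a]) k.+1) actw_S.
case: N aN x sx => [|N] // _ [|d x] // [sx].
rewrite (msem_at2 _ c d sx) msem_cls [sem _ _]/= [ocat _ _]/=; congr Some.
apply: (@eq_from_nth _ false) => [|k]; first by rewrite size_mkseq /= sx.
rewrite [size _]/= sx => kN; rewrite nth_mkseq //.
by case: k kN => [|[|k]].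
Qed.

Lemma msem_pr a N x : a < N -> size x = N ->
  msem (at1 mpr a N) x = if nth false x a then Some x else None.
Proof.
elim: a N x => [|a IH] [|N] // [|c x] // aN [sx]; last first.
  by rewrite -[at1 _ _ _]/(up (at1 _ a N)) msem_up IH //=; case: nth.
rewrite (msem_at1 _ c sx) msem_cmp msem_cls /=.
by case: c => //=; rewrite msem_cls.
Qed.

Definition realizes N (w : seq (letter N)) (u : mor N N) :=
  [/\ all (@letter_wf N) w, u = evN w &
   forall x, size x = N -> msem u x = omap (@tos N) (run w (fn x))].

Lemma adj_realizes N (u : mor N N) : adj u -> exists w, realizes w u.
Proof.
elim=> {u} [|u v _ [w [ww uw su]] _ [w' [ww' vw' sv]]|a aN|a aN|a aN].
- by exists [::]; split=> // x sx /=; rewrite msem1 // fnK.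
- exists (w ++ w'); split; rewrite ?all_cat ?ww // ?evN_cat ?uw ?vw' //.
  move=> x sx; rewrite -uw -vw' msem_cmp su // run_cat.
  by case: (run w _) => //= p; rewrite sv ?size_tos // tosK.
- have aN' := ltnW aN.
  exists [:: LC (Ordinal aN') (Ordinal aN)]; split.
  + by rewrite /= andbT -val_eqE /= ltn_eqF.
  + by rewrite /= mcmpm1 gateC_adj.
  move=> x sx; rewrite msem_cnot //=; congr Some.
  apply: (@eq_from_nth _ false); rewrite size_mkseq ?size_tos // => k kN.
  rewrite nth_mkseq // -[RHS]/(fn (tos _) (Ordinal kN)) tosK /push.
  by rewrite -val_eqE.
- have aN' := ltnW aN; pose i := Ordinal aN'; pose j := Ordinal aN.
  have ij : i != j by rewrite -val_eqE /= ltn_eqF.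
  (* Swaps are not letters; (CNT.1) writes each as three gates. *)
  exists [:: LC i j; LC j i; LC i j]; split.
  + by rewrite /= ij eq_sym ij.
  + rewrite /= mcmpm1 gateC_adj // gateC_adj' // -loc_S !at2_cmp.
    by rewrite -mcmpA.
  move=> x sx; rewrite msem_swap //=; congr Some.
  apply: (@eq_from_nth _ false); rewrite size_mkseq ?size_tos // => k kN.
  rewrite nth_mkseq // -[RHS]/(fn (tos _) (Ordinal kN)) tosK /push.
  rewrite -!val_eqE /= !eqxx /tr /fn /=.
  have -> : (a == a.+1) = false by rewrite ltn_eqF.
  have -> : (a.+1 == a) = false by rewrite gtn_eqF.
  case: eqP => [->|ka].
    rewrite ltn_eqF //=.
    by case: (nth _ _ a); case: (nth _ _ a.+1).
  by case: eqP => //= _; case: (nth _ _ a); case: (nth _ _ a.+1).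
- exists [:: LP (Ordinal aN)]; split=> //.
  + by rewrite /= mcmpm1 gateP_adj.
  by move=> x sx; rewrite msem_pr //= /fn /=; case: nth => //=; rewrite fnK.
Qed.

Lemma at2_tens g a N K : a.+1 < N ->
  at2 g a N ** mone K = at2 g a (N + K) :> mor (N + K) (N + K).
Proof.
elim: a N => [|a IH] [|N] // aN; last by rewrite /= -up_tens IH.
case: N aN => [|N] // _.
by rewrite /= -(tA2 g (mone N) (mone K)) mtens1.
Qed.

Lemma at1_tens g a N K : a < N ->
  at1 g a N ** mone K = at1 g a (N + K) :> mor (N + K) (N + K).
Proof.
elim: a N => [|a IH] [|N] // aN; last by rewrite /= -up_tens IH.
by rewrite /= -(tA1 g (mone N) (mone K)) mtens1.
Qed.

Lemma swW_tens u N K : valid N u -> swW N u ** mone K = swW (N + K) u.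
Proof.
elim: u => [|a u IH] /=; first by rewrite mtens1.
by case/andP=> aN vu; rewrite tens_cmp1 IH // /sw at2_tens.
Qed.

Lemma gateC_tens i j N K : i < N -> j < N -> j != i ->
  gateC N i j ** mone K = gateC (N + K) i j.
Proof.
move=> iN jN ji; have vr := route_valid iN jN ji.
rewrite /gateC /cj !tens_cmp1 !swW_tens ?valid_rev // at2_tens //.
by case: N iN jN ji {vr} => [|[|N]] //; case: i => //; case: j.
Qed.

Lemma gateP_tens i N K : i < N -> gateP N i ** mone K = gateP (N + K) i.
Proof.
move=> iN; have vr := valid_D iN.
rewrite /gateP /cj !tens_cmp1 !swW_tens ?valid_rev // at1_tens //.
exact: leq_ltn_trans iN.
Qed.

Lemma ketk_pr K c : c < K -> ketk K >> at1 mpr c K = ketk K.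
Proof.
elim: K c => // K IH [|c] cK /=.
  have := mtens_cmp mket mpr (ketk K) (mone K).
  by rewrite mcmpm1 /mpr mcmpA ket_bra mcmp1m => <-.
have := mtens_cmp mket (mone 1) (ketk K) (at1 mpr c K).
by rewrite mcmpm1 IH // => <-.
Qed.

Lemma km_pr N K c : c < K -> km N K >> gateP (N + K) (N + c) = km N K.
Proof.
move=> cK; rewrite gateP_adj ?ltn_add2l //; elim: N => [|N IH] /=.
  exact: ketk_pr.
by rewrite -up_cmp IH.
Qed.

(* The N wires of the words come first, then their copies, then the constant
   and the two wires set to 0. *)
Definition wire_pos N (c : option (option (option ('I_N + 'I_N)))) : nat :=
  match c with
  | None => N + N
  | Some None => N + (N + 1)
  | Some (Some None) => N + (N + 2)
  | Some (Some (Some (inl i))) => i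
  | Some (Some (Some (inr i))) => N + i
  end.

Lemma wire_pos_lt N (c : option (option (option ('I_N + 'I_N)))) :
  wire_pos c < N + (N + 3).
Proof.
by case: c => [[[[i|i]|]|]|] /=; apply/ltP; rewrite -!plusE;
  try (have /ltP hi := ltn_ord i); lia.
Qed.

Lemma wire_pos_inj N : injective (@wire_pos N).
Proof.
move=> [[[[i|i]|]|]|] [[[[j|j]|]|]|] //=; rewrite -?plusE => e;
  try (have /ltP hi := ltn_ord i); try (have /ltP hj := ltn_ord j);
  try (exfalso; lia).
- by rewrite (ord_inj e).
- by rewrite (ord_inj (addnI e)).
Qed.

Theorem evN_complete N (w w' : seq (letter N)) :
  all (@letter_wf N) w -> all (@letter_wf N) w' ->
  (forall p, run w p = run w' p) -> evN w = evN w'.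
Proof.
move=> ww ww' eqw; set K := N + 3.
pose M := circuit_monoid (@wire_pos_lt N) (@wire_pos_inj N).
have evE v : all (@letter_wf N) v ->
    (ev M v : mor (N + K) (N + K)) = evN v ** mone K.
  elim: v => [|l v IH] /=; first by rewrite mtens1.
  case/andP=> ll vv; rewrite IH // tens_cmp1; congr (_ >> _).
  case: l ll => [i j|i] /= ij; last by rewrite gateP_tens.
  by rewrite gateC_tens // eq_sym.
(* The prefix leaves all padding wires in state 1 and so absorbs their projections, as
   [words_complete_ones] requires. *)
have xP c : c < K -> bm N K >> km N K >> gateP (N + K) (N + c) = bm N K >> km N K.
  by move=> cK; rewrite -mcmpA km_pr.
have := @words_complete_ones N M (bm N K >> km N K) w w'.
rewrite !evE // => h.
have {h} : (bm N K >> km N K) >> (evN w ** mone K) =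
    (bm N K >> km N K) >> (evN w' ** mone K).
  apply: h => //; first by apply: (xP N); rewrite /K addn3 ltnS leqW.
  move=> c; rewrite !inE => /or3P [/eqP ->|/eqP ->|/mapP [i _ ->]] /=.
  - by apply: (xP (N + 1)); rewrite ltn_add2l.
  - by apply: (xP (N + 2)); rewrite ltn_add2l.
  - by apply: (xP i); rewrite ltn_addr.
move/(congr1 (fun x => km N K >> x >> bm N K)).
by rewrite -!mcmpA !bm_nat !(mcmpA (km N K)) !km_bm !mcmp1m.
Qed.

Lemma mcast_inj m m' n n' (em : m = m') (en : n = n') :
  injective (@mcast m m' n n' em en).
Proof. by case: m' / em; case: n' / en. Qed.

Theorem mor_complete m n (u v : mor m n) : msem u =1 msem v -> u = v.
Proof.
move=> uv; have [K1 h1] := adj_emb u; have [K2 h2] := adj_emb v.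
pose N := maxn (maxn m n) (maxn K1 K2).
have mN : m <= N by rewrite !leq_max leqnn.
have nN : n <= N by rewrite !leq_max leqnn orbT.
have e : m + (N - m) = n + (N - n) by rewrite !subnKC.
move: (N - m) (N - n) e (subnKC mN) => k l e kN.
have K1N : K1 <= m + k by rewrite kN !leq_max leqnn !orbT.
have K2N : K2 <= m + k by rewrite kN !leq_max leqnn !orbT.
have [w [ww uw su]] := adj_realizes (h1 k l e K1N).
have [w' [ww' vw' sv]] := adj_realizes (h2 k l e K2N).
have eUV : bm m k >> u >> km n l = bm m k >> v >> km n l.
  apply: (@mcast_inj _ _ _ _ e erefl); rewrite uw vw'; apply: evN_complete => // p.
  have := su _ (size_tos p); rewrite msem_cast !msem_cmp.
  have := sv _ (size_tos p); rewrite msem_cast !msem_cmp !tosK.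
  have -> : obind (msem v) (msem (bm m k) (tos p)) =
      obind (msem u) (msem (bm m k) (tos p)).
    by case: (msem (bm m k) (tos p)) => //= y; rewrite uv.
  move=> -> /=; case: (run w p) => [q|]; case: (run w' p) => [q'|] //= [qq].
  by rewrite -(tosK q) -(tosK q') qq.
have := congr1 (fun x => km m k >> x >> bm n l) eUV.
by rewrite !mcmpA !km_bm !mcmp1m -!mcmpA !km_bm !mcmpm1.
Qed.

Lemma ceq_complete m n (f g : circuit m n) : sem f =1 sem g -> ceq f g.
Proof.
move=> fg; apply/cls_eq; apply: mor_complete => x.
by rewrite !msem_cls.
Qed.

(** * Torsors of bit vectors *)

Fixpoint x3 (a b c : seq bool) : seq bool :=
  match a, b, c with
  | x :: a', y :: b', z :: c' => (x (+) y (+) z) :: x3 a' b' c'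
  | _, _, _ => [::]
  end.

Lemma size_x3 n a b c :
  size a = n -> size b = n -> size c = n -> size (x3 a b c) = n.
Proof.
elim: a n b c => [|x a IH] [|n] [|y b] [|z c] //= [sa] [sb] [sc].
by rewrite (IH n).
Qed.

Lemma nth_x3 n a b c k : size a = n -> size b = n -> size c = n ->
  nth false (x3 a b c) k = nth false a k (+) nth false b k (+) nth false c k.
Proof.
elim: a n b c k => [|x a IH] [|n] [|y b] [|z c] //= [|k] // [sa] [sb] [sc].
exact: (IH n).
Qed.

Lemma take_x3 m a b c : take m (x3 a b c) = x3 (take m a) (take m b) (take m c).
Proof.
elim: m a b c => [|m IH] [|x a] [|y b] [|z c] //=; last by rewrite IH.
all: by case: (take m a).
Qed.

Lemma drop_x3 n m a b c : size a = n -> size b = n -> size c = n ->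
  drop m (x3 a b c) = x3 (drop m a) (drop m b) (drop m c).
Proof.
elim: m n a b c => [|m IH] n a b c; first by rewrite !drop0.
by case: n a b c => [|n] [|x a] [|y b] [|z c] //= [sa] [sb] [sc]; apply: (IH n).
Qed.

Lemma x3_cat n a1 b1 c1 a2 b2 c2 : size a1 = n -> size b1 = n -> size c1 = n ->
  x3 (a1 ++ a2) (b1 ++ b2) (c1 ++ c2) = x3 a1 b1 c1 ++ x3 a2 b2 c2.
Proof.
elim: n a1 b1 c1 => [|n IH] [|x a1] [|y b1] [|z c1] //= [sa] [sb] [sc].
by rewrite IH.
Qed.

Lemma sem_affine m n (f : circuit m n) a b c a' b' c' :
  sem f a = Some a' -> sem f b = Some b' -> sem f c = Some c' ->
  sem f (x3 a b c) = Some (x3 a' b' c').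
Proof.
elim: f a b c a' b' c' =>
  {m n} [n|m n p f IHf g IHg|m n p q f IHf g IHg|m n|||] a b c a' b' c' /=.
- case: eqP => // sa [<-]; case: eqP => // sb [<-]; case: eqP => // sc [<-].
  by rewrite (size_x3 sa sb sc) eqxx.
- case ea: (sem f a) => [a1|] //= ga; case eb: (sem f b) => [b1|] //= gb.
  case ec: (sem f c) => [c1|] //= gc.
  by rewrite (IHf _ _ _ _ _ _ ea eb ec) /=; apply: IHg.
- case ea1: (sem f _) => [a1|] //=; case ea2: (sem g _) => [a2|] //= [<-].
  case eb1: (sem f _) => [b1|] //=; case eb2: (sem g _) => [b2|] //= [<-].
  case ec1: (sem f _) => [c1|] //=; case ec2: (sem g _) => [c2|] //= [<-].
  have sz x y z : sem f (take m x) = Some y -> sem g (drop m x) = Some z ->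
      size x = m + p.
    move=> e1 e2; rewrite -(cat_take_drop m x) size_cat.
    by have [-> _] := sem_size e1; have [-> _] := sem_size e2.
  rewrite take_x3 (IHf _ _ _ _ _ _ ea1 eb1 ec1).
  rewrite (drop_x3 _ (sz _ _ _ ea1 ea2) (sz _ _ _ eb1 eb2) (sz _ _ _ ec1 ec2)).
  rewrite (IHg _ _ _ _ _ _ ea2 eb2 ec2) /=.
  have [_ s1] := sem_size ea1; have [_ s2] := sem_size eb1.
  have [_ s3] := sem_size ec1.
  by rewrite (x3_cat _ _ _ s1 s2 s3).
- case: eqP => // sa [<-]; case: eqP => // sb [<-]; case: eqP => // sc [<-].
  have sd (x : seq bool) : size x = m + n -> size (drop m x) = n.
    by move=> sx; rewrite size_drop sx addKn.
  rewrite (size_x3 sa sb sc) eqxx take_x3 (drop_x3 _ sa sb sc).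
  by rewrite (x3_cat _ _ _ (sd a sa) (sd b sb) (sd c sc)).
- case: a => [|a0 [|a1 []]] //= [<-]; case: b => [|b0 [|b1 []]] //= [<-].
  case: c => [|c0 [|c1 []]] //= [<-].
  by case: a0; case: a1; case: b0; case: b1; case: c0; case: c1.
- by case: a => // -[<-]; case: b => // -[<-]; case: c => // -[<-].
- by case: a => [|[] []] // -[<-]; case: b => [|[] []] // -[<-];
    case: c => [|[] []] // -[<-].
Qed.

(** Since [cnot] is an involution and the bra partially inverts the ket, the reversed circuit
    computes the converse relation. *)
Fixpoint dag m n (f : circuit m n) : circuit n m :=
  match f in circuit m n return circuit n m with
  | cid n => cid n
  | ccmp _ _ _ f g => ccmp (dag g) (dag f)
  | ctens _ _ _ _ f g => ctens (dag f) (dag g)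
  | csym m n => csym n m
  | cnot => cnot
  | ket1 => bra1
  | bra1 => ket1
  end.

Lemma sem_dag_half m n (f : circuit m n) x y :
  sem f x = Some y -> sem (dag f) y = Some x.
Proof.
elim: f x y => {m n} [n|m n p f IHf g IHg|m n p q f IHf g IHg|m n|||] x y.
- by move=> /=; case: eqP => // sx [<-]; rewrite sx eqxx.
- by move=> /=; case e: (sem f x) => [z|] //= /IHg ->; apply: IHf.
- move=> /=; case e1: (sem f _) => [y1|] //=.
  case e2: (sem g _) => [y2|] //= [<-]; have [_ s1] := sem_size e1.
  rewrite take_size_cat // drop_size_cat // (IHf _ _ e1) (IHg _ _ e2) /=.
  by rewrite cat_take_drop.
- move=> /=; case: eqP => // sx [<-]; move/split_size: sx => [x1 [x2 [-> s1 s2]]].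
  rewrite take_size_cat // drop_size_cat // size_cat s1 s2 eqxx.
  by rewrite take_size_cat // drop_size_cat.
- by case: x => [|a [|b []]] //= [<-]; rewrite addKb.
- by case: x => //= [[<-]].
- by case: x => [|[] []] //= [<-].
Qed.

Lemma dagK m n (f : circuit m n) : dag (dag f) = f.
Proof. by elim: f => //= *; congruence. Qed.

Lemma sem_dag m n (f : circuit m n) x y :
  sem (dag f) y = Some x <-> sem f x = Some y.
Proof.
split; last exact: sem_dag_half.
by move/sem_dag_half; rewrite dagK.
Qed.

Lemma vecP n (a b c : n.-tuple bool) : size (x3 a b c) == n.
Proof. by rewrite (@size_x3 n) ?size_tuple. Qed.

Definition vec_tor n (a b c : n.-tuple bool) : n.-tuple bool :=
  Tuple (vecP a b c).

Lemma nth_vec n (a b c : n.-tuple bool) k :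
  nth false (vec_tor a b c) k =
  nth false a k (+) nth false b k (+) nth false c k.
Proof. by rewrite (@nth_x3 n) ?size_tuple. Qed.

Lemma vec_eq n (a b : n.-tuple bool) : nth false a =1 nth false b -> a = b.
Proof.
move=> ab; apply: val_inj; apply: (@eq_from_nth _ false) => //=.
by rewrite !size_tuple.
Qed.

Definition vec_torsor (n : nat) : torsor.
Proof.
exists (n.-tuple bool) (@vec_tor n).
- move=> a b c d e; apply: vec_eq => k; rewrite !nth_vec.
  by do 5!case: (nth false _ k).
- move=> a b c d e; apply: vec_eq => k; rewrite !nth_vec.
  by do 5!case: (nth false _ k).
- by move=> a b; apply: vec_eq => k; rewrite !nth_vec addbK.
- by move=> a b; apply: vec_eq => k; rewrite !nth_vec addbb.
Defined.

Definition vec (n : nat) : ctor2.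
Proof.
exists (vec_torsor n).
- move=> a b c; apply: vec_eq => k; rewrite !nth_vec.
  by do 3!case: (nth false _ k).
- move=> a b; apply: vec_eq => k; rewrite !nth_vec.
  by do 2!case: (nth false _ k).
- exists (enum {: n.-tuple bool}) => P Ps _ x; apply: Ps.
  by apply/(In_mem x); rewrite mem_enum.
Defined.

Lemma vec_inhabited n : inhabited (vec n).
Proof. exact (inhabits (nseq_tuple n false)). Qed.

(** * Bases of commutative torsors of characteristic 2 *)

Section Medial.
Variable Y : ctor2.
Implicit Types a b c g h : Y.

(** With [a1] as origin the torsor is an abelian group in which [tor a b c] is the sum of its
    arguments. *)
Lemma tor_medial (a1 b1 c1 a2 b2 c2 a3 b3 c3 : Y) :
  tor (tor a1 b1 c1) (tor a2 b2 c2) (tor a3 b3 c3) =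
  tor (tor a1 a2 a3) (tor b1 b2 b3) (tor c1 c2 c3).
Proof.
have [add addE] : exists add : Y -> Y -> Y, forall a b, add a b = tor a a1 b.
  by exists (fun a b => tor a a1 b).
have addC a b : add a b = add b a by rewrite !addE; apply: ct_commutative.
have addA a b c : add a (add b c) = add (add a b) c.
  by rewrite !addE torAl torAr.
have torE a b c : tor a b c = add (add a b) c.
  by rewrite !addE torAl ct_char2.
have ACA a b c d : add (add a b) (add c d) = add (add a c) (add b d).
  by rewrite -addA (addA b) (addC b c) -(addA c) addA.
have ACA3 a b c a' b' c' :
    add (add (add a a') (add b b')) (add c c') =
    add (add (add a b) c) (add (add a' b') c').
  by rewrite (ACA a a') ACA.
by rewrite !torE (ACA3 (add a1 b1)) (ACA3 a1).
Qed.

End Medial.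

Definition vcons n (b : bool) (t : vec n) : vec n.+1 := cons_tuple b t.
Definition vtail n (t : vec n.+1) : vec n := behead_tuple t.
Definition vzero n : vec n := nseq_tuple n false.

Lemma vec_split n (t : vec n.+1) : t = vcons (thead t) (vtail t).
Proof. exact: tuple_eta. Qed.

Lemma vtailP n (a b c : vec n.+1) :
  vtail (tor a b c) = tor (vtail a) (vtail b) (vtail c).
Proof.
by rewrite (vec_split a) (vec_split b) (vec_split c); apply: val_inj.
Qed.

Lemma theadP n (a b c : vec n.+1) :
  thead (tor a b c : vec n.+1) = thead a (+) thead b (+) thead c.
Proof.
by rewrite (vec_split a) (vec_split b) (vec_split c) /thead !(tnth_nth false).
Qed.

Section Extension.
Variables (Y : ctor2) (N : nat) (phi : torsor_hom (vec N) Y) (h : Y).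

Let g := phi (vzero N).
Let pick b := if b then h else g.

(** With [g] as origin: the value of [phi] on the tail, plus [h] if the first bit is set. *)
Definition ext_fun (t : vec N.+1) : Y := tor (phi (vtail t)) g (pick (thead t)).

Lemma ext_funP a b c : ext_fun (tor a b c) = tor (ext_fun a) (ext_fun b) (ext_fun c).
Proof.
rewrite /ext_fun vtailP theadP thomP tor_medial torK; congr tor.
rewrite /pick; case: (thead a); case: (thead b); case: (thead c) => /=;
  by rewrite ?torK ?torKl ?ct_char2.
Qed.

Definition ext_hom : torsor_hom (vec N.+1) Y := TorsorHom ext_funP.

Lemma ext_hom_false t : ext_hom (vcons false t) = phi t.
Proof.
rewrite /= /ext_fun /= torK; congr (phi _); exact: val_inj.
Qed.

Lemma ext_hom_true : ext_hom (vcons true (vzero N)) = h.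
Proof.
rewrite /= /ext_fun /= (_ : vtail _ = vzero N) ?torKl //; exact: val_inj.
Qed.

Lemma ext_hom_inj : injective phi -> (forall t, phi t <> h) -> injective ext_hom.
Proof.
move=> inj nh.
have canc y k : tor (tor y g k) k g = y by rewrite torAl torKl torK.
(* Otherwise [h] would be the image of 0 + s' + s under [phi]. *)
have bad (s s' : vec N) : phi s <> tor (phi s') g h.
  move=> e; apply: (nh (tor (vzero N) s' s)); rewrite thomP e.
  by rewrite -torAr torK torKl.
move=> s s' /=; rewrite /ext_fun (vec_split s) (vec_split s').
have tl b (t : vec N) : vtail (vcons b t) = t by apply: val_inj.
have hd b (t : vec N) : thead (vcons b t) = b by [].
rewrite !tl !hd; case: (thead s); case: (thead s') => /=; rewrite ?torK.
- by move/(congr1 (fun y => tor y h g)); rewrite !canc => /inj ->.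
- by move/esym/bad.
- by move/bad.
- by move/inj ->.
Qed.

End Extension.

Fixpoint vpad n d (t : vec d) : vec (n + d) :=
  if n is n'.+1 return vec (n + d) then vcons false (vpad n' t) else t.
Fixpoint vdrop n d : vec (n + d) -> vec d :=
  if n is n'.+1 return vec (n + d) -> vec d
  then fun t => vdrop (vtail t) else fun t => t.

Lemma vpadK n d (t : vec d) : vdrop (vpad n t) = t.
Proof.
elim: n => //= n IH; rewrite -[in RHS]IH; congr (vdrop _); exact: val_inj.
Qed.

Lemma vdropP n d (a b c : vec (n + d)) :
  vdrop (tor a b c) = tor (vdrop a) (vdrop b) (vdrop c).
Proof.
elim: n a b c => // n IH a b c.
by rewrite -[LHS]/(vdrop (vtail (tor a b c : vec (n + d).+1))) vtailP IH.
Qed.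

(** An element gets a new coordinate only if it is not yet reached. Keeping [phi0] on the last [d]
    coordinates serves both for bases, with [d] = 0, and for retractions of injections. *)
Lemma extend_basis (Y : ctor2) d (phi0 : torsor_hom (vec d) Y) (l : list Y) :
  injective phi0 -> exists n (phi : torsor_hom (vec (n + d)) Y),
  [/\ injective phi, forall t, phi (vpad n t) = phi0 t &
   forall y, List.In y l -> exists t, phi t = y].
Proof.
move=> inj0; elim: l => [|h l [n [phi [inj ext cov]]]].
  by exists 0, phi0; split=> // y [].
have [[t th]|nh] := classic (exists t, phi t = h).
  by exists n, phi; split=> // y [<-|/cov //]; exists t.
exists n.+1, (ext_hom phi h : torsor_hom (vec (n.+1 + d)) Y); split.
- by apply: ext_hom_inj => // t th; apply: nh; exists t.
- by move=> t; rewrite -ext; apply: ext_hom_false.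
- move=> y [<-|/cov [t <-]]; first by eexists; apply: ext_hom_true.
  by exists (vcons false t); apply: ext_hom_false.
Qed.

Lemma bij_hom_inv (X Y : torsor) (phi : torsor_hom X Y) :
  injective phi -> (forall y, exists t, phi t = y) ->
  exists psi : torsor_hom Y X, cancel phi psi /\ cancel psi phi.
Proof.
move=> inj surj.
pose psi y := proj1_sig (constructive_indefinite_description _ (surj y)).
have psiK : cancel psi phi.
  by move=> y; rewrite /psi; case: constructive_indefinite_description.
have psiP a b c : psi (tor a b c) = tor (psi a) (psi b) (psi c).
  by apply: inj; rewrite thomP !psiK.
exists (TorsorHom psiP); split=> // t; apply: inj; exact: psiK.
Qed.

Lemma hom_retraction (Y : ctor2) d (phi0 : torsor_hom (vec d) Y) :
  injective phi0 -> exists r : torsor_hom Y (vec d), cancel phi0 r.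
Proof.
move=> inj0; have [l lP] := ctor2_finite Y.
have [n [phi [inj ext cov]]] := extend_basis l inj0.
have [psi [phiK _]] := bij_hom_inv inj (fun y => cov y (lP y)).
pose r y := vdrop (psi y).
have rP a b c : r (tor a b c) = tor (r a) (r b) (r c).
  by rewrite /r thomP vdropP.
by exists (TorsorHom rP) => t; rewrite /= /r -ext phiK vpadK.
Qed.

Lemma ctor2_basis (Y : ctor2) : inhabited Y ->
  exists n (phi : torsor_hom (vec n) Y) (psi : torsor_hom Y (vec n)),
  cancel phi psi /\ cancel psi phi.
Proof.
move=> [y0]; have [l lP] := ctor2_finite Y.
have cP (a b c : vec 0) : y0 = tor y0 y0 y0 by rewrite torK.
have [|n [phi [inj _ cov]]] := @extend_basis Y 0 (TorsorHom cP) l.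
  by move=> s t _; rewrite (tuple0 s) (tuple0 t).
exists (n + 0), phi; exact: bij_hom_inv inj (fun y => cov y (lP y)).
Qed.

(** * Fullness *)

(** The state 0: a gate between two wires carrying 1 clears its target, and the control is then
    consumed. *)
Definition ket0 : circuit 0 1 :=
  (ccmp (ccmp (ctens ket1 ket1) cnot) (ctens bra1 (cid 1))).

Lemma sem_ket0 : sem ket0 [::] = Some [:: false].
Proof. by []. Qed.

Lemma sem_up m n (f : circuit m n) c x :
  sem (ctens (cid 1) f) (c :: x) = omap (cons c) (sem f x).
Proof.
rewrite (@sem_tens_cat 1 1 m n (cid 1) f [:: c] x erefl) /=.
by case: (sem f x).
Qed.

Lemma sem_swap2 n c d x : size x = n ->
  sem (ctens swap (cid n)) [:: c, d & x] = Some [:: d, c & x].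
Proof.
move=> sx; rewrite (@sem_tens_cat 2 2 n n swap (cid n) [:: c; d] x erefl).
by rewrite sem_cid.
Qed.

Lemma far_cnot m : exists f : circuit m.+2 m.+2, forall c z s, size s = m ->
  sem f (c :: rcons s z) = Some (c :: rcons s (c (+) z)).
Proof.
elim: m => [|m [f fP]].
  by exists cnot => c z [].
exists (ccmp (ccmp (ctens swap (cid m.+1)) (ctens (cid 1) f))
  (ctens swap (cid m.+1))) => c z [|d s] // [ss].
rewrite -[LHS]/(obind (sem (ctens swap (cid m.+1)))
  (obind (sem (ctens (cid 1) f)) (sem (ctens swap (cid m.+1)) [:: c, d & rcons s z]))).
rewrite sem_swap2 ?size_rcons ?ss //.
rewrite -[obind _ (Some _)]/(sem (ctens (cid 1) f) [:: d, c & rcons s z]).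
rewrite sem_up fP //.
rewrite -[LHS]/(sem (ctens swap (cid m.+1)) [:: d, c & rcons s (c (+) z)]).
by rewrite sem_swap2 ?size_rcons ?ss.
Qed.

Definition affine m (lam : seq bool -> bool) :=
  forall a b c, size a = m -> size b = m -> size c = m ->
  lam (x3 a b c) = lam a (+) lam b (+) lam c.

Lemma x3_false s : x3 s (nseq (size s) false) (nseq (size s) false) = s.
Proof. by elim: s => //= b s ->; rewrite !addbF. Qed.

Lemma append_parity m lam : affine m lam ->
  exists f : circuit m m.+1, forall x, size x = m ->
  sem f x = Some (rcons x (lam x)).
Proof.
elim: m lam => [|m IH] lam al.
  exists (if lam [::] then ket1 else ket0) => -[] // _.
  by case: (lam [::]); rewrite ?sem_ket0.
have [|f fP] := IH (fun s => lam (false :: s)).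
  by move=> a b c sa sb sc /=; rewrite -al //= ?sa ?sb ?sc.
(* [d] is the coefficient of the first coordinate in [lam]; it decides whether the first wire must
   be added to the parity of the others. *)
pose z := nseq m false; pose d := lam (true :: z) (+) lam (false :: z).
have lamE c s : size s = m -> lam (c :: s) = lam (false :: s) (+) (c && d).
  move=> ss; case: c => /=; last by rewrite addbF.
  rewrite {1}(_ : true :: s = x3 (false :: s) (false :: z) (true :: z)).
    rewrite al /= ?ss ?size_nseq // /d -addbA; congr addb; exact: addbC.
  by rewrite /= /z -ss x3_false.
have [g gP] := far_cnot m.
case dE : d; last first.
  exists (ctens (cid 1) f) => -[|c s] // [ss].
  by rewrite sem_up fP //= (lamE c s) // dE andbF addbF.
exists (ccmp (ctens (cid 1) f) g) => -[|c s] // [ss].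
rewrite -[LHS]/(obind (sem g) (sem (ctens (cid 1) f) (c :: s))) sem_up fP //=.
by rewrite gP // (lamE c s) // dE andbT addbC.
Qed.

Lemma append_parities m (ls : seq (seq bool -> bool)) :
  (forall lam, List.In lam ls -> affine m lam) ->
  exists f : circuit m (m + size ls), forall x, size x = m ->
  sem f x = Some (x ++ [seq lam x | lam <- ls]).
Proof.
elim/last_ind: ls => [|ls lam IH] als.
  exists (ccast erefl (esym (addn0 m)) (cid m)) => x sx.
  by rewrite sem_cast sem_cid //= cats0.
have [|f fP] := IH.
  by move=> l' ll; apply: als; rewrite -cats1; apply/List.in_or_app; left.
have al : affine m lam.
  by apply: als; rewrite -cats1; apply/List.in_or_app; right; left.
have [|g gP] := @append_parity (m + size ls) (fun x => lam (take m x)).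
  move=> a b c sa sb sc; rewrite take_x3.
  by apply: al; rewrite size_takel ?sa ?sb ?sc ?leq_addr.
have e : (m + size ls).+1 = m + size (rcons ls lam).
  by rewrite size_rcons addnS.
exists (ccast erefl e (ccmp f g)) => x sx.
rewrite sem_cast -[LHS]/(obind (sem g) (sem f x)) fP //=.
rewrite gP ?size_cat ?sx ?size_map // take_size_cat // map_rcons.
by rewrite rcons_cat.
Qed.

Lemma graph_circuit m n (A : torsor_hom (vec m) (vec n)) :
  exists f : circuit m (m + n), forall x : vec m,
  sem f (x : m.-tuple bool) = Some (val x ++ val (A x)).
Proof.
pose tup (s : seq bool) : vec m := [tuple nth false s i | i < m].
have tupK (x : vec m) : tup (val x) = x.
  by apply: vec_eq => k; rewrite /tup; case: (ltnP k m) => km;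
    [rewrite -(tnth_nth _ _ (Ordinal km)) tnth_mktuple
    |rewrite !nth_default ?size_tuple].
pose ls := [seq (fun s => nth false (val (A (tup s))) i) | i <- iota 0 n].
have sls : size ls = n by rewrite size_map size_iota.
have [|f fP] := @append_parities m ls.
  move=> lam /List.in_map_iff [i [<- _]] a b c sa sb sc.
  have e : tup (x3 a b c) = tor (tup a) (tup b) (tup c).
    apply: vec_eq => k; rewrite [RHS](@nth_vec m).
    have nt s : size s = m -> nth false (tup s) k = nth false s k.
      move=> ss; rewrite /tup; case: (ltnP k m) => km.
        by rewrite -(tnth_nth _ _ (Ordinal km)) tnth_mktuple.
      by rewrite !nth_default ?size_tuple ?ss.
    by rewrite !nt ?(size_x3 sa sb sc) // (@nth_x3 m).
  by rewrite e thomP; apply: (@nth_vec n).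
exists (ccast erefl (congr1 (addn m) sls) f) => x.
rewrite sem_cast fP ?size_tuple //; congr (Some (_ ++ _)).
apply: (@eq_from_nth _ false); rewrite size_map sls ?size_tuple // => k kn.
rewrite (nth_map (fun=> false)) ?sls // (nth_map 0) ?size_iota // nth_iota //.
by rewrite add0n tupK.
Qed.

(** Preparing 0 and then testing for 1 is nowhere defined. *)
Lemma empty_circuit m n : exists f : circuit m n, forall x, sem f x = None.
Proof.
have [b bP] : exists b : circuit m 0, True.
  elim: m => [|m [b _]]; first by exists (cid 0).
  by exists (ctens bra1 b).
have [k kP] : exists k : circuit 0 n, True.
  elim: n => [|n [k _]]; first by exists (cid 0).
  by exists (ctens ket1 k).
exists (ccmp (ccmp b (ccmp ket0 bra1)) k) => x /=.
by case: (sem b x) => [[|? ?]|].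
Qed.

(** * Relations as torsors, and realization by circuits *)

Section RelationTorsor.
Variables (X Y : ctor2) (R : X -> Y -> Prop).

Definition tor_closed := forall a b c a' b' c', R a a' -> R b b' -> R c c' ->
  R (tor a b c) (tor a' b' c').
Definition functional := forall a b b', R a b -> R a b' -> b = b'.
Definition injective_rel := forall a a' b, R a b -> R a' b -> a = a'.

Hypothesis RP : tor_closed.

Definition rel_carrier := {p : X * Y | R p.1 p.2}.

Definition rel_tor (a b c : rel_carrier) : rel_carrier :=
  exist (fun p => R p.1 p.2)
    (tor (proj1_sig a).1 (proj1_sig b).1 (proj1_sig c).1,
     tor (proj1_sig a).2 (proj1_sig b).2 (proj1_sig c).2)
    (RP (proj2_sig a) (proj2_sig b) (proj2_sig c)).

Definition rel_torsor : torsor.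
Proof.
exists rel_carrier rel_tor.
- by move=> a b c d e; apply: sig_eq; rewrite /= !torAl.
- by move=> a b c d e; apply: sig_eq; rewrite /= !torAr.
- by move=> [[a1 a2] ea] b; apply: sig_eq; rewrite /= !torK.
- by move=> [[a1 a2] ea] b; apply: sig_eq; rewrite /= !torKl.
Defined.

Definition rel_ctor2 : ctor2.
Proof.
exists rel_torsor.
- by move=> a b c; apply: sig_eq => /=; congr pair; apply: ct_commutative.
- by move=> a [[b1 b2] eb]; apply: sig_eq; rewrite /= !ct_char2.
- have [lX lXP] := ctor2_finite X; have [lY lYP] := ctor2_finite Y.
  have [s sP] := finite_sig (fun p : X * Y => R p.1 p.2)
                   (List.list_prod lX lY).
  exists s => P Ps _ u; apply: Ps; apply: sP.
  by case: (proj1_sig u) => x y; apply/List.in_prod_iff; split.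
Defined.

Definition rel_fst : torsor_hom rel_ctor2 X :=
  @TorsorHom rel_ctor2 X (fun p => (proj1_sig p).1) (fun _ _ _ => erefl).
Definition rel_snd : torsor_hom rel_ctor2 Y :=
  @TorsorHom rel_ctor2 Y (fun p => (proj1_sig p).2) (fun _ _ _ => erefl).

Lemma rel_fst_inj : functional -> injective rel_fst.
Proof.
move=> Rf [[a b] /= ab] [[a' b'] /= ab'] aa; subst a'.
by apply: sig_eq => /=; rewrite (Rf _ _ _ ab ab').
Qed.

Lemma rel_snd_inj : injective_rel -> injective rel_snd.
Proof.
move=> Rf [[a b] /= ab] [[a' b'] /= ab'] bb; subst b'.
by apply: sig_eq => /=; rewrite (Rf _ _ _ ab ab').
Qed.

End RelationTorsor.

(* A nonempty partial affine isomorphism is the set of solutions of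
   [b = A a] and [a = B b] for total affine maps A and B: take a basis of the
   graph and retractions of its two projections. *)
Theorem full m n (R : vec m -> vec n -> Prop) :
  tor_closed R -> functional R -> injective_rel R ->
  exists f : circuit m n, forall (a : vec m) (b : vec n),
  sem f (val a) = Some (val b) <-> R a b.
Proof.
move=> RP Rf Ri.
have [[a0 [b0 R0]]|nR] := classic (exists a b, R a b); last first.
  have [f fP] := empty_circuit m n; exists f => a b; rewrite fP.
  by split=> // ab; case: nR; exists a, b.
have [|d [phi [psi [phiK psiK]]]] := @ctor2_basis (rel_ctor2 RP).
  exact (inhabits (exist (fun p => R p.1 p.2) (a0, b0) R0)).
pose u := torsor_hom_cmp phi (rel_fst RP).
pose v := torsor_hom_cmp phi (rel_snd RP).
have ui : injective u by move=> s t /(rel_fst_inj Rf) /(can_inj phiK).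
have vi : injective v by move=> s t /(rel_snd_inj Ri) /(can_inj phiK).
have [r uK] := hom_retraction ui; have [q vK] := hom_retraction vi.
have [f fP] := graph_circuit (torsor_hom_cmp r v).
have [g gP] := graph_circuit (torsor_hom_cmp q u).
exists (ccmp (ccmp f (csym m n)) (dag g)) => a b.
rewrite -[sem _ _]/(obind (sem (dag g)) (obind (sem (csym m n)) (sem f (val a)))).
rewrite fP -[obind _ (Some _)]/(sem (csym m n) _) sem_sym_cat ?size_tuple //.
rewrite -[obind _ (Some _)]/(sem (dag g) _) sem_dag gP.
have cat_inj (x x' : vec n) (y y' : vec m) :
    val x ++ val y = val x' ++ val y' <-> x = x' /\ y = y'.
  split=> [/eqP|[-> ->] //].
  rewrite eqseq_cat ?size_tuple // => /andP [/eqP xx /eqP yy].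
  by split; apply: val_inj.
split=> [[/cat_inj [/= bE aE]]|ab].
  (* From [a = u (q b)] the retraction gives [r a = q b], hence [b = v (q b)]: the pair is the point
     [phi (q b)] of the graph. *)
  have tE : u (q b) = a by [].
  have -> : b = v (q b) by rewrite {1}bE -tE uK.
  by rewrite -{1}aE; apply: (proj2_sig (phi (q b))).
pose t := psi (exist (fun p => R p.1 p.2) (a, b) ab).
have ut : u t = a by rewrite /u /= /t psiK.
have vt : v t = b by rewrite /v /= /t psiK.
by congr Some; apply/cat_inj; rewrite /= -ut -vt uK vK.
Qed.

(** * The equivalence *)

Section Equivalence.
Local Open Scope cat_scope.

Lemma equivalence_of_ff_eso (C D : category) (F : functor C D) :
  (forall (A B : C) (h : Hom (F A) (F B)), exists f, fmap F f =~ h) ->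
  (forall (A B : C) (f g : Hom A B), fmap F f =~ fmap F g -> f =~ g) ->
  (forall X : D, exists (A : C) (i : Hom (F A) X), is_iso i) ->
  equivalent_categories C D.
Proof.
move=> Ffull Ffaith Feso.
have /constructive_indefinite_description [pre preP] :
    exists pre : forall (A B : C), Hom (F A) (F B) -> Hom A B,
    forall A B h, fmap F (pre A B h) =~ h.
  exists (fun A B h =>
    proj1_sig (constructive_indefinite_description _ (Ffull A B h))).
  by move=> A B h; case: constructive_indefinite_description.
have /constructive_indefinite_description [ob obP] :
    exists ob : D -> C, forall X, exists i : Hom (F (ob X)) X, is_iso i.
  exists (fun X => proj1_sig (constructive_indefinite_description _ (Feso X))).
  by move=> X; case: constructive_indefinite_description.
have /constructive_indefinite_description [i iP] :
    exists i : forall X, Hom (F (ob X)) X, forall X, is_iso (i X).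
  exists (fun X => proj1_sig (constructive_indefinite_description _ (obP X))).
  by move=> X; case: constructive_indefinite_description.
have /constructive_indefinite_description [j jP] :
    exists j : forall X, Hom X (F (ob X)), forall X, inverse_pair (i X) (j X).
  exists (fun X => proj1_sig (constructive_indefinite_description _ (iP X))).
  by move=> X; case: constructive_indefinite_description.
have ij X : i X ;; j X =~ idm _ by have [] := jP X.
have ji X : j X ;; i X =~ idm _ by have [] := jP X.
pose Gm (X Y : D) (h : Hom X Y) : Hom (ob X) (ob Y) :=
  pre _ _ (i X ;; h ;; j Y).
have FG X Y (h : Hom X Y) : fmap F (Gm X Y h) =~ i X ;; h ;; j Y.
  exact: preP.
have Gheq X Y (h h' : Hom X Y) : h =~ h' -> Gm X Y h =~ Gm X Y h'.
  by move=> hh; apply: Ffaith; rewrite !FG hh.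
have G1 X : Gm X X (idm X) =~ idm (ob X).
  by apply: Ffaith; rewrite FG fmap_id cmpm1 ij.
have Gc X Y Z (h : Hom X Y) (k : Hom Y Z) :
    Gm X Z (h ;; k) =~ Gm X Y h ;; Gm Y Z k.
  apply: Ffaith; rewrite fmap_cmp !FG.
  by rewrite -!cmpA (cmpA (j Y)) ji cmp1m.
pose G := Functor Gheq G1 Gc.
exists F, G; split.
- exists (fun A => pre (ob (F A)) A (i (F A))); split.
    move=> A B f; apply: Ffaith; rewrite !fmap_cmp !preP.
    by rewrite -(cmpA (i (F A) ;; fmap F f)) ji cmpm1.
  move=> A; exists (pre A (ob (F A)) (j (F A))); split; apply: Ffaith.
    by rewrite fmap_cmp !preP ij fmap_id.
  by rewrite fmap_cmp !preP ji fmap_id.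
- exists i; split=> // X Y h /=.
  by rewrite FG -(cmpA (i X ;; h)) ji cmpm1.
Qed.

End Equivalence.

(** * Partial maps of torsors as relations *)

Section PartialMaps.
Implicit Types X Y A B : ctor2.

Definition prel A B (s : @partial_map CTor2 A B) (a : A) (b : B) : Prop :=
  exists u : (pm_ob s : ctor2),
  (pm_dom s : torsor_hom _ _) u = a /\ (pm_map s : torsor_hom _ _) u = b.

(** As [tor y y y = y], each element is a constant homomorphism from [vec 0], so monics can be
    tested on elements. *)
Lemma monic_injective X Y (m : torsor_hom X Y) :
  @monic CTor2 X Y m -> injective m.
Proof.
move=> mm x x' xx.
have cP (y : X) (a b c : vec 0) : y = tor y y y by rewrite torK.
by apply: (mm (vec 0) (TorsorHom (cP x)) (TorsorHom (cP x')) _ (vzero 0)).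
Qed.

Lemma injective_monic X Y (m : torsor_hom X Y) :
  injective m -> @monic CTor2 X Y m.
Proof. by move=> mi Q h k hk x; apply: mi; apply: hk. Qed.

Lemma prel_functional A B (s : @partial_map CTor2 A B) : functional (prel s).
Proof.
move=> a b b' [u [ua ub]] [v [va vb]].
have uv : u = v.
  by apply: (monic_injective (pm_monic (p := s))); rewrite ua va.
by rewrite -ub -vb uv.
Qed.

Lemma prel_tor_closed A B (s : @partial_map CTor2 A B) : tor_closed (prel s).
Proof.
move=> a b c a' b' c' [u [<- <-]] [v [<- <-]] [w [<- <-]].
by exists (tor u v w); rewrite !thomP.
Qed.

(** The domain leg is injective; it therefore forces the comparison map between two spans with the
    same graph to be a homomorphism. *)
Lemma partial_map_iso_prel A B (s t : @partial_map CTor2 A B) :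
  partial_map_iso s t <-> (forall a b, prel s a b <-> prel t a b).
Proof.
split=> [[phi [[psi [pp pp']] [pd pm]]] a b|st].
  split=> -[u [ua ub]].
    exists ((phi : torsor_hom _ _) u); split.
      by rewrite -ua -(pd u).
    by rewrite -ub -(pm u).
  have ppu : (phi : torsor_hom _ _) ((psi : torsor_hom _ _) u) = u := pp' u.
  exists ((psi : torsor_hom _ _) u); split.
    by rewrite -ua -[in RHS]ppu; apply/esym/(pd ((psi : torsor_hom _ _) u)).
  by rewrite -ub -[in RHS]ppu; apply/esym/(pm ((psi : torsor_hom _ _) u)).
have half (s' t' : @partial_map CTor2 A B) :
    (forall a b, prel s' a b -> prel t' a b) ->
    exists phi : torsor_hom (pm_ob s' : ctor2) (pm_ob t' : ctor2),
    (forall u, (pm_dom t' : torsor_hom _ _) (phi u) =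
       (pm_dom s' : torsor_hom _ _) u) /\
    (forall u, (pm_map t' : torsor_hom _ _) (phi u) =
       (pm_map s' : torsor_hom _ _) u).
  move=> sub.
  have ex (u : (pm_ob s' : ctor2)) : exists v : (pm_ob t' : ctor2),
      (pm_dom t' : torsor_hom _ _) v = (pm_dom s' : torsor_hom _ _) u /\
      (pm_map t' : torsor_hom _ _) v = (pm_map s' : torsor_hom _ _) u.
    by apply: sub; exists u.
  pose phi u := proj1_sig (constructive_indefinite_description _ (ex u)).
  have phiP u : (pm_dom t' : torsor_hom _ _) (phi u) =
        (pm_dom s' : torsor_hom _ _) u /\
      (pm_map t' : torsor_hom _ _) (phi u) = (pm_map s' : torsor_hom _ _) u.
    by rewrite /phi; case: constructive_indefinite_description.
  have phiH a b c : phi (tor a b c) = tor (phi a) (phi b) (phi c).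
    apply: (monic_injective (pm_monic (p := t'))).
    by rewrite thomP !(phiP _).1 thomP.
  by exists (TorsorHom phiH); split=> u; have [] := phiP u.
have [phi [pd pm]] := half s t (fun a b => (st a b).1).
have [psi [qd qm]] := half t s (fun a b => (st a b).2).
exists phi; split; last by split=> u; [apply: pd | apply: pm].
exists psi; split=> u.
  by apply: (monic_injective (pm_monic (p := s))); rewrite /= qd pd.
by apply: (monic_injective (pm_monic (p := t))); rewrite /= pd qd.
Qed.

Lemma prel_id A (a b : A) : prel (@pm_id CTor2 A) a b <-> a = b.
Proof. by split=> [[u [/= <- <-]]|<-] //; exists a. Qed.

Lemma prel_cmp A B C (s : @partial_map CTor2 A B) (t : @partial_map CTor2 B C)
    (a : A) (c : C) :
  prel (pm_cmp CTor2_pullbacks s t) a c <-> exists b, prel s a b /\ prel t b c.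
Proof.
split=> [[[[u v] /= uv] [/= <- <-]]|[b [[u [ua ub]] [v [va vb]]]]].
  exists ((pm_map s : torsor_hom _ _) u); split; first by exists u.
  by exists v.
have uv : (pm_map s : torsor_hom _ _) u = (pm_dom t : torsor_hom _ _) v.
  by rewrite ub va.
by exists (exist (fun p => (pm_map s : torsor_hom _ _) p.1 =
  (pm_dom t : torsor_hom _ _) p.2) (u, v) uv).
Qed.

Lemma prel_restr A B (s : @partial_map CTor2 A B) (a a' : A) :
  prel (pm_restr s) a a' <-> a = a' /\ exists b, prel s a b.
Proof.
split=> [[u [/= ua ua']]|[<- [b [u [ua ub]]]]].
  by split; [rewrite -ua | eexists; exists u; split].
by exists u.
Qed.

Section OfRelation.
Variables (A B : ctor2) (R : A -> B -> Prop).
Hypotheses (RP : tor_closed R) (Rf : functional R).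

Definition pm_of_rel : @partial_map CTor2 A B :=
  @PartialMap CTor2 A B (rel_ctor2 RP) (rel_fst RP) (rel_snd RP)
    (injective_monic (rel_fst_inj (RP := RP) Rf)).

Lemma prel_of_rel a b : prel pm_of_rel a b <-> R a b.
Proof.
split=> [[[[x y] /= xy] [/= <- <-]] //|ab].
by exists (exist (fun p => R p.1 p.2) (a, b) ab).
Qed.

End OfRelation.

(** The graph of a partial inverse contains the converse of the graph of [s], whence injectivity.
    Conversely, if the graph of [s] is injective, its converse is functional and is itself a partial
    inverse. *)
Lemma partial_iso_prel A B (s : @Hom (Par CTor2_pullbacks) A B) :
  partial_iso s <-> injective_rel (prel (s : @partial_map CTor2 A B)).
Proof.
split=> [[g [/partial_map_iso_prel sg _]] a a' b sab sab'|inj].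
  have back x : prel (s : @partial_map CTor2 A B) x b ->
      prel (g : @partial_map CTor2 B A) b x.
    move=> sxb; have /sg /prel_cmp [y [sxy gyx]] : prel (pm_restr s) x x.
      by apply/prel_restr; split=> //; exists b.
    by rewrite (prel_functional sxb sxy).
  exact: prel_functional (back _ sab) (back _ sab').
pose R (b : B) (a : A) := prel (s : @partial_map CTor2 A B) a b.
have RP : tor_closed R by move=> *; apply: prel_tor_closed.
have Rf : functional R by move=> b a a'; apply: inj.
exists (pm_of_rel RP Rf); split; apply/partial_map_iso_prel => x y.
  rewrite prel_cmp prel_restr; split.
    move=> [b [sxb /prel_of_rel syb]]; split; last by exists b.
    exact: inj sxb syb.
  by move=> [<- [b sxb]]; exists b; split=> //; apply/prel_of_rel.
rewrite prel_cmp prel_restr; split.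
  move=> [a [/prel_of_rel sax say]]; split; last by exists a; apply/prel_of_rel.
  exact: prel_functional sax say.
by move=> [<- [a /prel_of_rel sax]]; exists a; split=> //; apply/prel_of_rel.
Qed.

End PartialMaps.

(** * The semantic functor *)

Definition rel_sem m n (f : circuit m n) (a : vec m) (b : vec n) : Prop :=
  sem f (val a) = Some (val b).

Lemma rel_sem_closed m n (f : circuit m n) : tor_closed (rel_sem f).
Proof. by move=> a b c a' b' c'; apply: sem_affine. Qed.

Lemma rel_sem_functional m n (f : circuit m n) : functional (rel_sem f).
Proof.
by move=> a b b'; rewrite /rel_sem => -> [bb]; apply: val_inj.
Qed.

Lemma rel_sem_injective m n (f : circuit m n) : injective_rel (rel_sem f).
Proof.
move=> a a' b /sem_dag fa /sem_dag; rewrite fa => -[aa]; exact: val_inj.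
Qed.

Lemma sem_of_rel m n (f g : circuit m n) :
  (forall a b, rel_sem f a b <-> rel_sem g a b) -> sem f =1 sem g.
Proof.
have half (f' g' : circuit m n) x y :
    (forall a b, rel_sem f' a b -> rel_sem g' a b) ->
    sem f' x = Some y -> sem g' x = Some y.
  move=> fg fx; have [/eqP sx /eqP sy] := sem_size fx.
  exact: (fg (Tuple sx) (Tuple sy) fx).
move=> fg x; case fx: (sem f x) => [y|].
  by apply/esym; apply: half fx => a b /fg.
case gx: (sem g x) => [y|] //; rewrite -fx.
by apply: half gx => a b /fg.
Qed.

Definition circuit_pm m n (f : circuit m n) : @partial_map CTor2 (vec m) (vec n) :=
  pm_of_rel (@rel_sem_closed m n f) (@rel_sem_functional m n f).

Lemma circuit_pm_iso m n (f : circuit m n) :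
  @partial_iso (Par CTor2_pullbacks) (vec m) (vec n) (circuit_pm f).
Proof.
apply/partial_iso_prel => a a' b /prel_of_rel fa /prel_of_rel.
exact: rel_sem_injective fa.
Qed.

Lemma circuit_pm_ceq m n (f g : circuit m n) :
  ceq f g -> partial_map_iso (circuit_pm f) (circuit_pm g).
Proof.
move=> fg; apply/partial_map_iso_prel => a b.
by rewrite !prel_of_rel /rel_sem (ceq_sem fg).
Qed.

Lemma circuit_pm_id n :
  partial_map_iso (circuit_pm (cid n)) (@pm_id CTor2 (vec n)).
Proof.
apply/partial_map_iso_prel => a b.
rewrite prel_of_rel prel_id /rel_sem sem_cid; last exact: size_tuple.
by split=> [[/val_inj]|->].
Qed.

Lemma circuit_pm_cmp m n p (f : circuit m n) (g : circuit n p) :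
  partial_map_iso (circuit_pm (ccmp f g))
    (pm_cmp CTor2_pullbacks (circuit_pm f) (circuit_pm g)).
Proof.
apply/partial_map_iso_prel => a c; rewrite prel_of_rel prel_cmp /rel_sem /=.
split.
  case fa: (sem f (val a)) => [y|] //= gc; have [_ /eqP sy] := sem_size fa.
  by exists (Tuple sy); split; apply/prel_of_rel.
by move=> [b [/prel_of_rel fb /prel_of_rel gc]]; rewrite fb.
Qed.

Definition star (X : ctor2) (x : inhabited X) : ParIso_CTor2_star :=
  exist (fun X : ParIso (Par CTor2_pullbacks) => inhabited (X : ctor2)) X x.

Definition sem_functor : functor CNOT ParIso_CTor2_star.
Proof.
exists (fun n : nat => star (vec_inhabited n))
  (fun (m n : nat) (f : circuit m n) =>
     exist (fun s => @partial_iso (Par CTor2_pullbacks) (vec m) (vec n) s)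
       (circuit_pm f) (circuit_pm_iso f)).
- exact circuit_pm_ceq.
- exact circuit_pm_id.
- exact circuit_pm_cmp.
Defined.

Section HomIso.
Variables (X Y : ctor2) (phi : torsor_hom X Y) (psi : torsor_hom Y X).
Hypotheses (phiK : cancel phi psi).

Let graph (a : X) (b : Y) := phi a = b.

Let graph_closed : tor_closed graph.
Proof. by move=> a b c _ _ _ <- <- <-; apply: thomP. Qed.

Let graph_functional : functional graph.
Proof. by move=> a b b' <-. Qed.

Definition hom_pm : @partial_map CTor2 X Y :=
  pm_of_rel graph_closed graph_functional.

Lemma prel_hom_pm a b : prel hom_pm a b <-> phi a = b.
Proof. exact: prel_of_rel. Qed.

Lemma hom_pm_iso : @partial_iso (Par CTor2_pullbacks) X Y hom_pm.
Proof.
apply/partial_iso_prel => a a' b /prel_hom_pm <- /prel_hom_pm.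
by move/(can_inj phiK).
Qed.

End HomIso.

Lemma hom_pm_inv (X Y : ctor2) (phi : torsor_hom X Y) (psi : torsor_hom Y X) :
  cancel phi psi ->
  partial_map_iso (pm_cmp CTor2_pullbacks (hom_pm phi) (hom_pm psi))
    (@pm_id CTor2 X).
Proof.
move=> phiK; apply/partial_map_iso_prel => a b; rewrite prel_cmp prel_id; split.
  by move=> [c [/prel_hom_pm <- /prel_hom_pm <-]].
by move=> <-; exists (phi a); rewrite !prel_hom_pm.
Qed.

Lemma star_iso (X Y : ctor2) (iX : inhabited X) (iY : inhabited Y)
    (phi : torsor_hom X Y) (psi : torsor_hom Y X) :
  cancel phi psi -> cancel psi phi ->
  exists i : @Hom ParIso_CTor2_star (star iX) (star iY), is_iso i.
Proof.
move=> phiK psiK.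
exists (exist (fun s => @partial_iso (Par CTor2_pullbacks) X Y s)
  (hom_pm phi) (hom_pm_iso phiK)).
exists (exist (fun s => @partial_iso (Par CTor2_pullbacks) Y X s)
  (hom_pm psi) (hom_pm_iso psiK)).
exact (conj (hom_pm_inv phiK) (hom_pm_inv psiK)).
Qed.

Lemma sem_functor_full m n (s : @partial_map CTor2 (vec m) (vec n)) :
  @partial_iso (Par CTor2_pullbacks) (vec m) (vec n) s ->
  exists f : circuit m n, partial_map_iso (circuit_pm f) s.
Proof.
move=> /partial_iso_prel sP.
have [f fP] := full (@prel_tor_closed _ _ s) (@prel_functional _ _ s) sP.
by exists f; apply/partial_map_iso_prel => a b; rewrite prel_of_rel; apply: fP.
Qed.

Lemma sem_functor_faithful m n (f g : circuit m n) :
  partial_map_iso (circuit_pm f) (circuit_pm g) -> ceq f g.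
Proof.
move=> /partial_map_iso_prel fg; apply: ceq_complete.
by apply: sem_of_rel => a b; have := fg a b; rewrite !prel_of_rel.
Qed.

Theorem mainTheorem1 : equivalent_categories CNOT ParIso_CTor2_star.
Proof.
apply: (equivalence_of_ff_eso (F := sem_functor)).
- by move=> m n [s sP]; exact (sem_functor_full sP).
- exact sem_functor_faithful.
- move=> [X iX]; have [n [phi [psi [phiK psiK]]]] := ctor2_basis iX.
  by exists n; exact (star_iso (vec_inhabited n) iX phiK psiK).
Qed.
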